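(* The Bloch spectrum of a quantum graph determines its Albanese torus as a Riemannian manifold: if $G$ and $G'$ are Bloch isospectral quantum graphs, then the flat Riemannian tori $Alb(G)=H_1(G,\mathbb{R})/H_1(G,\mathbb{Z})$ and $Alb(G')=H_1(G',\mathbb{R})/H_1(G',\mathbb{Z})$ are isometric.
   Context: Combinatorial graphs are finite; loops and multiple edges are allowed, and a loop contributes $2$ to the degree of its vertex. All graphs are assumed connected, without isolated vertices and without vertices of degree $2$. A quantum graph $G$ is a combinatorial graph with vertex set $V$ and edge set $E$ together with a length function $L:E\to\mathbb{R}_{>0}$; each edge $e$ is identified with $[0,L(e)]$. Let $\nu_{v,e}$ be the outward unit normal of the edge $e$ at the vertex $v$; in sums over edges $e\sim v$ adjacent to $v$ a loop contributes at both ends. $\Lambda^0$ is the space of continuous functions $f$ on $G$, smooth on each closed edge, with $\sum_{e\sim v}\nu_{v,e}(f|_e)=0$ at all $v$. $\Lambda^1$ is the space of $1$-forms $\alpha$, consisting of a smooth $1$-form $\alpha_e$ on each closed edge with $\sum_{e\sim v}\alpha_e(\nu_{v,e})=0$ at all $v$. $H^1_{dR}(G,\mathbb{R})$ is the space of real $1$-forms modulo differentials of real $0$-forms, and $H^1_{dR}(G,\mathbb{Z})$ is the lattice of classes whose integrals over all closed walks are integers. For a real $1$-form $\alpha$, written $\alpha_e=a_e\,dx$ in an arclength parameter, $\Delta_\alpha=d_\alpha^*d_\alpha$ with $d_\alpha=d+2\pi i\alpha$ acts on each edge as $f\mapsto-\left(\frac{d}{dx}+2\pi i a_e\right)^2f$,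 with domain all continuous $f$ on $G$ lying in the Sobolev space $W_2$ (two derivatives in $L^2$) on each edge and satisfying $\sum_{e\sim v}\nu_{v,e}(f|_e)=0$ at every $v$. $Spec_\alpha(G)$ is the set of eigenvalues of $\Delta_\alpha$ including multiplicities; it depends only on the coset of $[\alpha]$ in $H^1_{dR}(G,\mathbb{R})/H^1_{dR}(G,\mathbb{Z})$. The Bloch spectrum of $G$ is the map $[\alpha]\mapsto Spec_\alpha(G)$ on this torus, regarded as an abstract torus without Riemannian structure. $G$ and $G'$ are Bloch isospectral if there is a Lie group isomorphism $\Phi:H^1_{dR}(G,\mathbb{R})/H^1_{dR}(G,\mathbb{Z})\to H^1_{dR}(G',\mathbb{R})/H^1_{dR}(G',\mathbb{Z})$ with $Spec_\alpha(G)=Spec_{\Phi(\alpha)}(G')$ for all $[\alpha]$. For $A\in\{\mathbb{Z},\mathbb{R}\}$ let $C_1(G,A)$ be the $A$-module generated by oriented edges modulo $\overline{b}=-b$ (reversal of orientation), and $H_1(G,A)=\ker\partial$, where $\partial(b)=t(b)-o(b)$ (terminal vertex minus origin). The inner product on $C_1(G,\mathbb{R})$ is the bilinear extension of $e\cdot e'=L(e)$ if $e=e'$, $-L(e)$ if $e=\overline{e'}$, and $0$ otherwise; $H_1(G,\mathbb{R})$ carries the restricted inner product and $Alb(G)$ the induced flat metric. *)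

(* Defs.v *)
From HB Require Import structures.
From mathcomp Require Import all_boot all_order all_algebra.
From mathcomp Require Import ring_quotient complex.
From mathcomp Require Import all_classical all_reals all_analysis.
Import Order.TTheory GRing.Theory Num.Theory.
Import numFieldNormedType.Exports.

Set Implicit Arguments.
Unset Strict Implicit.
Unset Printing Implicit Defensive.

Local Open Scope classical_set_scope.
Local Open Scope ring_scope.
Local Open Scope quotient_scope.
Local Open Scope complex_scope.

(* Each edge e carries a reference orientation.  The pairs (e, false) and
   (e, true) encode the two ends of e, located at the points 0 and L(e) of
   [0, L(e)]; [vtx] attaches them to vertices.  A loop thus contributes two
   ends to its vertex. *)
Record quantum_graph (R : realType) := QuantumGraph {
  vertex : finType;
  edge : finType;
  vtx : edge * bool -> vertex;
  len : edge -> R;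
  len_gt0 : forall e, 0 < len e;
  vertex_nonempty : (0 < #|vertex|)%N;
  connected_graph : forall u v : vertex,
    connect (fun x y => [exists e, exists b,
               (vtx (e, b) == x) && (vtx (e, ~~ b) == y)]) u v;
  no_isolated : forall v, #|[pred h | vtx h == v]| != 0%N;
  no_degree2 : forall v, #|[pred h | vtx h == v]| != 2%N
}.

Section Graph.
Variables (R : realType) (G : quantum_graph R).

Definition position (h : edge G * bool) : R := if h.2 then len h.1 else 0.

(* The sign is the outward unit normal (minus d/dx at 0, d/dx at L(e)). *)
Definition flux (A : pzRingType) (F : edge G * bool -> A) (v : vertex G) : A :=
  \sum_(h | vtx h == v) (-1) ^+ (~~ h.2) * F h.

Lemma fluxB (A : pzRingType) (F K : edge G * bool -> A) v :
  flux (fun h => F h - K h) v = flux F v - flux K v.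
Proof. by rewrite /flux -sumrB; apply: eq_bigr => h _; rewrite mulrBr. Qed.

Lemma flux0 (A : pzRingType) v : flux (fun=> 0 : A) v = 0.
Proof. by rewrite /flux big1 // => h _; rewrite mulr0. Qed.

Definition continuous_at_vertices (T : Type) (f : edge G -> R -> T) :=
  forall h k : edge G * bool, vtx h = vtx k ->
    f h.1 (position h) = f k.1 (position k).

(* Smooth functions on a closed edge [0, L(e)] are the restrictions of smooth
   functions on R; the latter are used as representatives, and only their
   values on [0, L(e)] are ever relevant. *)
Definition smooth (f : R -> R) :=
  forall n x, derivable (derive1n n f) x 1.

Lemma derive1nB_smooth (f g : R -> R) n : smooth f -> smooth g ->
  derive1n n (f \- g) = derive1n n f \- derive1n n g.
Proof.
move=> sf sg; elim: n => [//|n IH].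
rewrite !derive1nS IH; apply/funext => x /=.
by rewrite !derive1E deriveB.
Qed.

Lemma smoothB (f g : R -> R) : smooth f -> smooth g -> smooth (f \- g).
Proof.
move=> sf sg n x; rewrite derive1nB_smooth //.
by apply: derivableB; [exact: sf|exact: sg].
Qed.

Lemma smooth0 : smooth (fun=> 0).
Proof.
have E n : derive1n n (fun=> 0 : R) = (fun=> 0).
  elim: n => [//|n IH]; rewrite derive1nS IH; apply/funext => x.
  by rewrite derive1_cst.
by move=> n x; rewrite E; exact: derivable_cst.
Qed.

Lemma smooth_integrable (f : R -> R) (l : R) : smooth f ->
  lebesgue_measure.-integrable `[0, l] (EFin \o f).
Proof.
move=> sf; apply: continuous_compact_integrable; first exact: segment_compact.
apply: continuous_subspaceT => x; apply: differentiable_continuous.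
by apply/derivable1_diffP; exact: (sf 0%N).
Qed.

Definition zero_form (f : edge G -> R -> R) :=
  [/\ forall e, smooth (f e), continuous_at_vertices f &
      forall v, flux (fun h => derive1 (f h.1) (position h)) v = 0].

(* a e is the coefficient of the form: alpha_e = a_e dx. *)
Definition one_form : pred (edge G -> R -> R) := fun a =>
  `[< (forall e, smooth (a e)) /\
      forall v, flux (fun h => a h.1 (position h)) v = 0 >].

Fact one_form_zmod_closed : zmod_closed one_form.
Proof.
split; first by apply/asboolP; split => [e|v]; [exact: smooth0|exact: flux0].
move=> a b /asboolP[sa fa] /asboolP[sb fb]; apply/asboolP; split=> [e|v].
  exact: smoothB.
by rewrite fluxB fa fb subr0.
Qed.
HB.instance Definition _ := GRing.isZmodClosed.Build _ one_form
  one_form_zmod_closed.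

Record Lambda1 := OneForm {
  coef :> edge G -> R -> R;
  _ : coef \in one_form
}.
HB.instance Definition _ := [isSub for coef].
HB.instance Definition _ := [Choice of Lambda1 by <:].
HB.instance Definition _ := [SubChoice_isSubZmodule of Lambda1 by <:].

Definition exact_form : pred Lambda1 := fun a =>
  `[< exists2 f, zero_form f &
      forall e x, x \in `[0, len e] -> a e x = derive1 (f e) x >].

Fact exact_form_zmod_closed : zmod_closed exact_form.
Proof.
split.
  apply/asboolP; exists (fun _ _ => 0).
    split=> [e|//|v]; first exact: smooth0.
    by rewrite -[RHS](flux0 _ v); apply: eq_bigr => h _; rewrite derive1_cst.
  by move=> e x _; rewrite derive1_cst.
move=> a b /asboolP[f [sf cf ff] af] /asboolP[g [sg cg fg] bg].
have dB e x : derive1 (f e \- g e) x = derive1 (f e) x - derive1 (g e) x.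
  by rewrite !derive1E deriveB //; [exact: (sf e 0%N)|exact: (sg e 0%N)].
apply/asboolP; exists (fun e => f e \- g e); first split.
- by move=> e; exact: smoothB.
- by move=> h k hk /=; rewrite (cf h k) // (cg h k).
- move=> v; transitivity (flux (fun h => derive1 (f h.1) (position h) -
      derive1 (g h.1) (position h)) v); last by rewrite fluxB ff fg subr0.
  by apply: eq_bigr => h _; rewrite dB.
- by move=> e x xe; rewrite dB -af // -bg.
Qed.
HB.instance Definition _ := GRing.isZmodClosed.Build _ exact_form
  exact_form_zmod_closed.

Definition H1dR : Type := Quotient.quot (GRing.ZmodClosed.clone _ exact_form _).
HB.instance Definition _ := EqQuotient.on H1dR.
HB.instance Definition _ := GRing.Zmodule.on H1dR.

(* (e, true) is the edge e traversed from 0 to L(e), (e, false) its reversal. *)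
Definition terminus (b : edge G * bool) := vtx b.
Definition origin (b : edge G * bool) := vtx (b.1, ~~ b.2).

Definition closed_walk := {w : seq (edge G * bool) |
  cycle (fun b c => terminus b == origin c) w}.

Definition integral_walk (a : edge G -> R -> R) (w : seq (edge G * bool)) : R :=
  \sum_(b <- w) (-1) ^+ (~~ b.2) *
    \int[lebesgue_measure]_(x in `[0, len b.1]) a b.1 x.

Lemma integral_walkB (a b : Lambda1) w :
  integral_walk (a - b) w = integral_walk a w - integral_walk b w.
Proof.
rewrite /integral_walk -sumrB; apply: eq_bigr => h _; rewrite -mulrBr.
have /asboolP[sa _] := valP a; have /asboolP[sb _] := valP b.
by congr (_ * _); rewrite -RintegralB //=; apply: smooth_integrable.
Qed.

Definition H1dR_Z : pred H1dR := fun c =>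
  `[< exists2 a : Lambda1, c = \pi_H1dR a &
      forall w : closed_walk, integral_walk a (sval w) \is a Num.int >].

Fact H1dR_Z_zmod_closed : zmod_closed H1dR_Z.
Proof.
split.
  apply/asboolP; exists 0; first by rewrite raddf0.
  move=> w; suff -> : integral_walk (0 : Lambda1) (sval w) = 0 by rewrite rpred0.
  by rewrite -[0 in LHS](subrr 0) integral_walkB subrr.
move=> c d /asboolP[a ca ia] /asboolP[b db ib]; apply/asboolP; exists (a - b).
  by rewrite raddfB ca db.
by move=> w; rewrite integral_walkB rpredB.
Qed.
HB.instance Definition _ := GRing.isZmodClosed.Build _ H1dR_Z
  H1dR_Z_zmod_closed.

(* H1dR is finite-dimensional and the integrals over closed walks span its dual
   space, so the initial topology they induce is the usual topology of this
   finite-dimensional real vector space.  The integrals do not depend on the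
   representative, since exact forms integrate to 0 over closed walks. *)
Definition periods (c : H1dR) : {ptws closed_walk -> R} :=
  fun w => integral_walk (repr c) (sval w).
HB.instance Definition _ := Topological.copy H1dR (initial_topology periods).

Definition bloch_torus : Type :=
  Quotient.quot (GRing.ZmodClosed.clone _ H1dR_Z _).
HB.instance Definition _ := EqQuotient.on bloch_torus.
HB.instance Definition _ := GRing.Zmodule.on bloch_torus.

Definition torus_class (a : Lambda1) : bloch_torus :=
  \pi_bloch_torus (\pi_H1dR a).

(* f lies in W_1(0, l), is its absolutely continuous representative, and g is
   its weak derivative. *)
Definition sobolev1 (l : R) (f g : R -> R) :=
  [/\ measurable_fun `[0, l] g,
      lebesgue_measure.-integrable `[0, l] (EFin \o (fun x => g x ^+ 2)) &
      forall x, x \in `[0, l] ->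
        f x = f 0 + \int[lebesgue_measure]_(t in `[0, x]) g t].

(* f lies in W_2(0, l), with derivatives f1 and f2; f1 is determined
   everywhere on [0, l] and f2 almost everywhere. *)
Definition sobolev2 (l : R) (f f1 f2 : R -> R[i]) :=
  (sobolev1 l (@complex.Re R \o f) (@complex.Re R \o f1) /\
   sobolev1 l (@complex.Im R \o f) (@complex.Im R \o f1)) /\
  (sobolev1 l (@complex.Re R \o f1) (@complex.Re R \o f2) /\
   sobolev1 l (@complex.Im R \o f1) (@complex.Im R \o f2)).

(* -(d/dx + 2 pi i a)^2 f, where f1 = f' and f2 = f''. *)
Definition magnetic_laplacian (a : R -> R) (f f1 f2 : R -> R[i]) (x : R) :
    R[i] :=
  let p : R[i] := 0 +i* (2 * pi * a x) in
  let p1 : R[i] := 0 +i* (2 * pi * derive1 a x) in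
  - ((f2 x + (p1 * f x + p * f1 x)) + p * (f1 x + p * f x)).

Definition eigenspace (a : Lambda1) (lambda : R[i]) :
    set (edge G -> R -> R[i]) :=
  [set f | exists f1 f2 : edge G -> R -> R[i],
    [/\ forall e, sobolev2 (len e) (f e) (f1 e) (f2 e),
        continuous_at_vertices f,
        forall v, flux (fun h => f1 h.1 (position h)) v = 0 &
        forall e, {ae lebesgue_measure, forall x : R, x \in `[0, len e] ->
          magnetic_laplacian (a e) (f e) (f1 e) (f2 e) x = lambda * f e x}]].

(* Functions on G are compared on the intervals [0, L(e)] only. *)
Definition multiplicity (a : Lambda1) (lambda : R[i]) (n : nat) :=
  exists b : 'I_n -> edge G -> R -> R[i],
    (forall i, eigenspace a lambda (b i)) /\
    (forall f, eigenspace a lambda f ->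
      exists! c : 'rV[R[i]]_n, forall e (x : R), x \in `[0, len e] ->
        f e x = \sum_i c 0 i * b i e x).

(* The eigenvalues paired with their multiplicities, which are all finite. *)
Definition Spec (a : Lambda1) : set (R[i] * nat) :=
  [set p | (0 < p.2)%N /\ multiplicity a p.1 p.2].

(* The module C_1(G, R) of real chains, in the basis of the positively
   oriented edges. *)
Local Notation C1 := 'rV[R]_#|edge G|.

Definition chain_coef (c : C1) (e : edge G) : R := c 0 (enum_rank e).

Definition boundary (c : C1) (v : vertex G) : R :=
  flux (fun h => chain_coef c h.1) v.

Definition inner (c d : C1) : R :=
  \sum_e len e * chain_coef c e * chain_coef d e.

Definition cycles : pred C1 := fun c => [forall v, boundary c v == 0].

Fact cycles_zmod_closed : zmod_closed cycles.
Proof.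
split.
  apply/forallP => v; apply/eqP; rewrite -[RHS](flux0 _ v).
  by apply: eq_bigr => h _; rewrite /chain_coef mxE.
move=> c d /forallP cc /forallP cd; apply/forallP => v.
have <- : boundary c v - boundary d v = boundary (c - d) v.
  by rewrite -fluxB; apply: eq_bigr => h _; rewrite /chain_coef !mxE.
by rewrite (eqP (cc v)) (eqP (cd v)) subr0.
Qed.
HB.instance Definition _ := GRing.isZmodClosed.Build _ cycles
  cycles_zmod_closed.

Record H1 := Cycle {
  chain :> C1;
  _ : chain \in cycles
}.
HB.instance Definition _ := [isSub for chain].
HB.instance Definition _ := [Choice of H1 by <:].
HB.instance Definition _ := [SubChoice_isSubZmodule of H1 by <:].

Definition H1_Z : pred H1 := fun c =>
  [forall e, chain_coef c e \is a Num.int].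

Fact H1_Z_zmod_closed : zmod_closed H1_Z.
Proof.
split; first by apply/forallP => e; rewrite /chain_coef mxE rpred0.
move=> c d /forallP ic /forallP id; apply/forallP => e.
by rewrite /chain_coef !mxE rpredB // ?ic ?id.
Qed.
HB.instance Definition _ := GRing.isZmodClosed.Build _ H1_Z H1_Z_zmod_closed.

Definition Alb : Type := Quotient.quot (GRing.ZmodClosed.clone _ H1_Z _).
HB.instance Definition _ := EqQuotient.on Alb.
HB.instance Definition _ := GRing.Zmodule.on Alb.

End Graph.

(* A Lie group isomorphism is an isomorphism of groups that is a homeomorphism:
   continuous homomorphisms between Lie groups are smooth. *)
Definition bloch_isospectral (R : realType) (G G' : quantum_graph R) :=
  exists (Phi : {additive bloch_torus G -> bloch_torus G'})
         (Psi : bloch_torus G' -> bloch_torus G),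
    [/\ cancel Phi Psi /\ cancel Psi Phi,
        continuous (Phi : quotient_topology (bloch_torus G) ->
                          quotient_topology (bloch_torus G')),
        continuous (Psi : quotient_topology (bloch_torus G') ->
                          quotient_topology (bloch_torus G)) &
        forall (a : Lambda1 G) (a' : Lambda1 G'),
          Phi (torus_class a) = torus_class a' -> Spec a = Spec a'].

Definition smooth_map (R : realType) (V W : normedModType R) (F : V -> W) :=
  forall (vs : seq V) (x : V),
    differentiable (foldr (fun v K => 'D_v K) F vs) x.

(* The projections H_1(G, R) -> Alb(G) are local isometries and serve as charts:
   near every point, phi is represented by a smooth map F between the ambient
   chain spaces, whose differential restricted to H_1(G, R) preserves the inner
   products. *)
Definition local_isometry (R : realType) (G G' : quantum_graph R)
    (phi : Alb G -> Alb G') :=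
  forall x : H1 G, exists F : 'rV[R]_#|edge G| -> 'rV[R]_#|edge G'|,
    [/\ smooth_map F,
        \forall z \near chain x, forall y : H1 G, chain y = z ->
          exists2 y' : H1 G', chain y' = F z &
            phi (\pi_(Alb G) y) = \pi_(Alb G') y' &
        forall u v : H1 G,
          inner ('D_(chain u) F (chain x)) ('D_(chain v) F (chain x)) =
          inner u v].

Definition isometric_albanese (R : realType) (G G' : quantum_graph R) :=
  exists (phi : Alb G -> Alb G') (psi : Alb G' -> Alb G),
    [/\ cancel phi psi, cancel psi phi, local_isometry phi &
        local_isometry psi].

(* Main.v *)
From HB Require Import structures.
From mathcomp Require Import all_boot all_order all_algebra.
From mathcomp Require Import ring lra.
From mathcomp Require Import complex perm.
From mathcomp Require Import all_classical all_reals all_analysis measurable_realfun.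
Require Import Defs.

(** Why isospectral quantum graphs have isometric Albanese tori.

    On an edge, the solutions of the eigenvalue equation for [k ^ 2 != 0] are,
    up to a gauge factor, sums of two plane waves.  The vertex conditions say
    that the vector of the amplitudes of the incoming waves is fixed by the
    unitary matrix [B k] that describes propagation along the edges and
    scattering at the vertices; the 1-form enters only through the phases of
    [B k].  Therefore the spectrum determines the dimension of the kernel of
    [1 - B k] for all real [k != 0] ([Spec_kernel]).

    The secular function [D z], the determinant of [1 - B z], extends this to
    complex wave numbers.  For [Im z > 0] the matrix [1 - B z] is accretive, so
    that [D] does not vanish and has a bounded continuous argument there
    ([secular_arg]).  If two forms, possibly on two graphs, have the same
    spectrum, then the difference of the arguments of their secular functions
    is a bounded harmonic function; as the zeros on the real line match, it has
    boundary values, and these are constant on each half-line by the functional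
    equation of [D].  The maximum principle and the behaviour at infinity then
    show that the ratio of the two secular functions is positive for
    [Im z > 0] ([ratio_positive]).  In particular the product of one of them
    with the conjugate of the other is real.

    Expanded over the sets of bonds ([secular_expansion]), this is a linear
    relation between characters in [z] and in the form, which must hold for
    each character separately ([characters_independent]).  The sets of bonds
    that occur are those whose sum is a cycle with integer entries; the
    dependence on [z] gives their length and the dependence on the form their
    class.  For a simple cycle of the second graph this yields a cycle of the
    first one that defines the same character on the identified tori and is not
    longer ([indecomposable_dual]); here the length of a cycle is its weighted
    l1-norm [norm1].

    The simple cycles are the indecomposable elements of the lattice of integer
    cycles, and each element decomposes into them with additive length
    ([lattice_ind]).  Hence the isomorphism between the two lattices that is
    dual to the one between the tori does not increase lengths; neither does
    its inverse, so that it preserves lengths and simple cycles.  As a simple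
    cycle has entries -1, 0 and 1, the inner product of two of them can be
    computed from lengths ([inner_norm1]), and it is preserved as well.  The
    linear extension of the isomorphism is an isometry of the spaces of real
    cycles that maps one lattice onto the other. *)

Import Order.TTheory GRing.Theory Num.Theory.
Import numFieldNormedType.Exports.

Set Implicit Arguments.
Unset Strict Implicit.
Unset Printing Implicit Defensive.

Local Open Scope classical_set_scope.
Local Open Scope ring_scope.
Local Open Scope complex_scope.


(** * Arguments of complex numbers *)

Notation Re := complex.Re.
Notation Im := complex.Im.

Section Ray.
Variable R : realType.
Implicit Types (c d w : R[i]) (s t r : R).

Lemma ReM c d : Re (c * d) = Re c * Re d - Im c * Im d.
Proof. by case: c d => [a b] [a' b']. Qed.
Lemma ImM c d : Im (c * d) = Re c * Im d + Im c * Re d.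
Proof. by case: c d => [a b] [a' b']. Qed.
Lemma ReD c d : Re (c + d) = Re c + Re d.
Proof. by case: c d => [a b] [a' b']. Qed.
Lemma ImD c d : Im (c + d) = Im c + Im d.
Proof. by case: c d => [a b] [a' b']. Qed.
Lemma ReN c : Re (- c) = - Re c. Proof. by case: c. Qed.
Lemma ImN c : Im (- c) = - Im c. Proof. by case: c. Qed.
Lemma Re_sum I (r : seq I) (P : pred I) (F : I -> R[i]) :
  Re (\sum_(i <- r | P i) F i) = \sum_(i <- r | P i) Re (F i).
Proof. by elim/big_rec2: _ => // i x y _ <-; rewrite ReD. Qed.
Lemma complexP c d : Re c = Re d -> Im c = Im d -> c = d.
Proof. by case: c d => [a b] [a' b'] /= -> ->. Qed.

Definition cis t : R[i] := cos t +i* sin t.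

Lemma cisD s t : cis (s + t) = cis s * cis t.
Proof. by apply: complexP; rewrite ?ReM ?ImM /= ?cosD ?sinD ?(addrC (sin s * _)). Qed.
Lemma cis0 : cis 0 = 1.
Proof. by rewrite /cis cos0 sin0. Qed.
Lemma cisN t : cis (- t) = (cis t)^*.
Proof. by rewrite /cis cosN sinN. Qed.
Lemma cisVN t : cis t * cis (- t) = 1.
Proof. by rewrite -cisD subrr cis0. Qed.
Lemma cis_neq0 t : cis t != 0.
Proof. by apply/eqP=> h; have := cisVN t; rewrite h mul0r => /eqP; rewrite eq_sym oner_eq0. Qed.
Lemma cisNV t : cis (- t) = (cis t)^-1.
Proof. by rewrite -[LHS](mulKf (cis_neq0 t)) cisVN mulr1. Qed.
Lemma cis_sum I (r : seq I) (P : pred I) (F : I -> R) :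
  cis (\sum_(i <- r | P i) F i) = \prod_(i <- r | P i) cis (F i).
Proof. by apply: (big_morph cis cisD cis0). Qed.

(** The sine of half of [t] vanishes, and half of [t] lies within pi. *)
Lemma cis_eq1 t : `|t| < 2 * pi -> cis t = 1 -> t = 0.
Proof.
move=> tpi [c1 s0]; apply/eqP; rewrite -normr_eq0 eq_le normr_ge0 andbT leNgt.
apply/negP => t0.
have : sin (`|t| / 2) ^+ 2 = 0.
  have e : `|t| / 2 *+ 2 = `|t| by rewrite -mulr_natr divfK.
  have := cos_mulr2n (`|t| / 2); rewrite e cos_norm c1 cos2sin2 => h; lra.
move/eqP; rewrite sqrf_eq0 => /eqP s.
have := @sin_gt0_pi R (`|t| / 2); rewrite s ltxx => h.
suff: false by []. by apply: h; apply/andP; split; lra.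
Qed.

(** The complex numbers of argument [t], for real [t] rather than [t] modulo
    2 pi: a continuous choice of [t] makes sense. *)
Definition ray c t := exists2 r, 0 < r & c = r%:C * cis t.

Lemma ray_neq0 c t : ray c t -> c != 0.
Proof.
case=> r r0 ->; rewrite mulf_neq0 ?cis_neq0//.
by apply/eqP => -[] h; rewrite h ltxx in r0.
Qed.
Lemma rayM c d s t : ray c s -> ray d t -> ray (c * d) (s + t).
Proof.
move=> [r r0 ->] [r' r'0 ->]; exists (r * r'); first exact: mulr_gt0.
by rewrite cisD rmorphM /= mulrACA.
Qed.
Lemma rayV c s : ray c s -> ray c^-1 (- s).
Proof.
move=> [r r0 ->]; exists r^-1; rewrite ?invr_gt0//.
by rewrite invfM cisNV fmorphV.
Qed.
Lemma ray_conj c s : ray c s -> ray c^* (- s).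
Proof.
move=> [r r0 ->]; exists r => //; rewrite rmorphM cisN; congr (_ * _).
by rewrite /= oppr0.
Qed.
Lemma ray_real r : 0 < r -> ray r%:C 0.
Proof. by move=> r0; exists r => //; rewrite cis0 mulr1. Qed.
Lemma ray_atan w : 0 < Re w -> ray w (atan (Im w / Re w)).
Proof.
case: w => [a b] /= a0; set t := atan _.
have ct : 0 < cos t by apply: cos_gt0_pihalf; rewrite atan_gtNpi2 atan_ltpi2.
exists (a / cos t); first exact: divr_gt0.
have st : sin t = b / a * cos t by rewrite -[b / a]atanK /tan divfK// gt_eqF.
apply: complexP; rewrite ?ReM ?ImM /= mul0r ?subr0 ?addr0 ?st.
  by rewrite divfK// gt_eqF.
by field; rewrite !gt_eqF.
Qed.
Lemma ray_uniq c s t : ray c s -> ray c t -> cis s = cis t.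
Proof.
move=> [r r0 ->] [r' r'0 e].
have q (a x : R) : Re (a%:C * cis x) ^+ 2 + Im (a%:C * cis x) ^+ 2 = a ^+ 2.
  rewrite ReM ImM /= -[RHS]mulr1 -(cos2Dsin2 x); ring.
have rr : r = r'.
  by apply/eqP; rewrite -(eqrXn2 (n := 2))// ?ltW// -(q r s) e q.
move: e; rewrite rr => /mulfI; apply.
by apply/eqP => -[] h; rewrite h ltxx in r'0.
Qed.
End Ray.

Section ComponentContinuity.
Variables (R : realType) (T : topologicalType).
Implicit Types (f g : T -> R[i]) (p : T).

Definition ccont f p :=
  {for p, continuous (fun x => Re (f x))} /\
  {for p, continuous (fun x => Im (f x))}.

Lemma ccont_ext f g p : f =1 g -> ccont f p -> ccont g p.
Proof. by move=> /funext ->. Qed.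
Lemma ccont_cst (c : R[i]) p : ccont (fun=> c) p.
Proof. by split; exact: cvg_cst. Qed.
Lemma ccontD f g p : ccont f p -> ccont g p -> ccont (fun x => f x + g x) p.
Proof.
move=> [f1 f2] [g1 g2]; split.
  have -> : (fun x => Re (f x + g x)) = (fun x => Re (f x)) \+ (fun x => Re (g x)).
    by apply/funext => x; rewrite ReD.
  exact: continuousD.
have -> : (fun x => Im (f x + g x)) = (fun x => Im (f x)) \+ (fun x => Im (g x)).
  by apply/funext => x; rewrite ImD.
exact: continuousD.
Qed.
Lemma ccontM f g p : ccont f p -> ccont g p -> ccont (fun x => f x * g x) p.
Proof.
move=> [f1 f2] [g1 g2]; split.
  have -> : (fun x => Re (f x * g x)) =
    (fun x => Re (f x) * Re (g x) - Im (f x) * Im (g x)).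
    by apply/funext => x; rewrite ReM.
  by apply: continuousB; apply: continuousM.
have -> : (fun x => Im (f x * g x)) =
    (fun x => Re (f x) * Im (g x) + Im (f x) * Re (g x)).
  by apply/funext => x; rewrite ImM.
by apply: continuousD; apply: continuousM.
Qed.
Lemma ccontN f p : ccont f p -> ccont (fun x => - f x) p.
Proof.
move=> cf; apply: (ccont_ext (f := fun x => (-1) * f x)).
  by move=> x; rewrite mulN1r.
by apply: ccontM cf; exact: ccont_cst.
Qed.
Lemma ccont_conj f p : ccont f p -> ccont (fun x => (f x)^*) p.
Proof.
move=> [f1 f2]; split.
  have -> // : (fun x => Re (f x)^*) = (fun x => Re (f x)).
  by apply/funext => x; case: (f x).
have -> : (fun x => Im (f x)^*) = (fun x => - Im (f x)).
  by apply/funext => x; case: (f x).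
exact: continuousN.
Qed.
Lemma ccontV f p : f p != 0 -> ccont f p -> ccont (fun x => (f x)^-1) p.
Proof.
move=> fp [f1 f2].
pose n x := Re (f x) ^+ 2 + Im (f x) ^+ 2.
have np : n p != 0.
  apply: contra fp; rewrite /n paddr_eq0 ?sqr_ge0// !sqrf_eq0.
  by move=> /andP[/eqP r0 /eqP i0]; apply/eqP/complexP.
have cn : {for p, continuous n}.
  by apply: continuousD; apply: continuousM.
have cnV : {for p, continuous (fun x => (n x)^-1)} by exact: continuousV.
split.
  have -> : (fun x => Re (f x)^-1) = (fun x => Re (f x) * (n x)^-1).
    by apply/funext => x; rewrite /n; case: (f x).
  exact: continuousM.
have -> : (fun x => Im (f x)^-1) = (fun x => - (Im (f x) * (n x)^-1)).
  by apply/funext => x; rewrite /n; case: (f x).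
by apply: continuousN; exact: continuousM.
Qed.
Lemma ccont_sum I (r : seq I) (P : pred I) (F : I -> T -> R[i]) p :
  (forall i, P i -> ccont (F i) p) ->
  ccont (fun x => \sum_(i <- r | P i) F i x) p.
Proof.
move=> cF; elim: r => [|i r IH].
  by apply: (ccont_ext (f := fun=> 0)) (ccont_cst _ _) => x; rewrite big_nil.
case: (boolP (P i)) => Pi; last first.
  by apply: ccont_ext IH => x; rewrite big_cons (negbTE Pi).
by apply: ccont_ext (ccontD (cF i Pi) IH) => x; rewrite big_cons Pi.
Qed.
Lemma ccont_prod I (r : seq I) (P : pred I) (F : I -> T -> R[i]) p :
  (forall i, P i -> ccont (F i) p) ->
  ccont (fun x => \prod_(i <- r | P i) F i x) p.
Proof.
move=> cF; elim: r => [|i r IH].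
  by apply: (ccont_ext (f := fun=> 1)) (ccont_cst _ _) => x; rewrite big_nil.
case: (boolP (P i)) => Pi; last first.
  by apply: ccont_ext IH => x; rewrite big_cons (negbTE Pi).
by apply: ccont_ext (ccontM (cF i Pi) IH) => x; rewrite big_cons Pi.
Qed.
Lemma ccont_det n (M : T -> 'M[R[i]]_n) p :
  (forall i j, ccont (fun x => M x i j) p) -> ccont (fun x => \det (M x)) p.
Proof.
move=> cM; apply: ccont_sum => s _; apply: ccontM; first exact: ccont_cst.
by apply: ccont_prod => i _.
Qed.
Lemma ccont_cis (u : T -> R) p :
  {for p, continuous u} -> ccont (fun x => cis (u x)) p.
Proof.
move=> cu; split; first exact: (continuous_comp cu (@continuous_cos R _)).
exact: (continuous_comp cu (@continuous_sin R _)).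
Qed.
Lemma ccont_real (u : T -> R) p :
  {for p, continuous u} -> ccont (fun x => (u x)%:C) p.
Proof. by move=> cu; split => //; exact: cvg_cst. Qed.
End ComponentContinuity.

(** * Determinants of accretive matrices *)

Section Accretive.
Variable R : realType.

Definition accretive n (M : 'M[R[i]]_n) :=
  forall v : 'cV_n, v != 0 -> 0 < Re (\sum_i (v i 0)^* * (M *m v) i 0).

(** Vectors supported outside the index 0 see the minor only. *)
Lemma accretive_minor n (M : 'M[R[i]]_n.+1) :
  accretive M -> accretive (row' 0 (col' 0 M)).
Proof.
move=> aM v v0.
pose w : 'cV_n.+1 := \col_i (if unlift 0 i is Some j then v j 0 else 0).
have wl j : w (lift 0 j) 0 = v j 0 by rewrite mxE liftK.
have w0 : w 0 0 = 0 by rewrite mxE unlift_none.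
have /aM : w != 0.
  apply: contra v0 => /eqP w0'; apply/eqP/colP => j.
  by rewrite -wl w0' !mxE.
rewrite big_ord_recl w0 rmorph0 mul0r add0r.
congr (0 < Re _); apply: eq_bigr => j _; rewrite wl; congr (_ * _).
rewrite !mxE big_ord_recl w0 mulr0 add0r.
by apply: eq_bigr => k _; rewrite wl !mxE.
Qed.

(** The first column of the adjugate is mapped to a multiple of the first basis
    vector; the accretivity inequality at this column is the conclusion. *)
Lemma accretive_pivot n (M : 'M[R[i]]_n.+1) : accretive M ->
  \det (row' 0 (col' 0 M)) != 0 ->
  0 < Re ((\det (row' 0 (col' 0 M)))^* * \det M).
Proof.
move=> aM d0; pose v := col 0 (\adj M).
have v0 : v 0 0 = \det (row' 0 (col' 0 M)).
  by rewrite !mxE /cofactor /= addn0 expr0 mul1r.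
have Mv i : (M *m v) i 0 = \det M *+ (i == 0).
  by rewrite /v colE mulmxA mul_mx_adj mul_scalar_mx !mxE eqxx andbT mulr_natr.
have : v != 0 by apply: contra d0 => /eqP h; rewrite -v0 h mxE.
move=> /aM; rewrite big_ord_recl Mv eqxx mulr1n v0 big1 ?addr0// => i _.
by rewrite Mv mulr0.
Qed.

Lemma accretive_det_neq0 n (M : 'M[R[i]]_n) : accretive M -> \det M != 0.
Proof.
elim: n M => [|n IH] M aM; first by rewrite det_mx00 oner_eq0.
have := accretive_pivot aM (IH _ (accretive_minor aM)).
by apply: contraTneq => ->; rewrite mulr0 ltxx.
Qed.

(** By [accretive_pivot] the arguments of two successive leading minors differ
    by less than pi / 2, so that an arctangent gives the difference and the
    argument of the determinant is found by induction. *)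
Lemma arg_of_accretive (T : topologicalType) (H : set T) n (M : T -> 'M[R[i]]_n) :
  (forall p, H p -> forall i j, ccont (fun x => M x i j) p) ->
  (forall p, H p -> accretive (M p)) ->
  exists u : T -> R, forall p, H p ->
    [/\ {for p, continuous u}, `|u p| <= n%:R * pi & ray (\det (M p)) (u p)].
Proof.
elim: n M => [|n IH] M cM aM.
  exists (fun=> 0) => p Hp; split; rewrite ?mul0r ?normr0//; first exact: cvg_cst.
  by rewrite det_mx00; apply: ray_real.
pose M' x := row' 0 (col' 0 (M x)).
have cM' p : H p -> forall i j, ccont (fun x => M' x i j) p.
  move=> Hp i j; apply: ccont_ext (cM p Hp (lift 0 i) (lift 0 j)) => x.
  by rewrite !mxE.
have aM' p : H p -> accretive (M' p) by move=> Hp; exact/accretive_minor/aM.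
have [u' u'P] := IH M' cM' aM'.
pose w x := (\det (M' x))^* * \det (M x).
have w0 p : H p -> 0 < Re (w p).
  by move=> Hp; apply: accretive_pivot; [exact: aM|exact/accretive_det_neq0/aM'].
exists (fun x => u' x + atan (Im (w x) / Re (w x))) => p Hp.
have [cu bu ru] := u'P p Hp.
have [cw1 cw2] : ccont w p.
  apply: ccontM; first exact/ccont_conj/ccont_det/cM'.
  exact/ccont_det/cM.
split.
- apply: continuousD => //.
  have cq : {for p, continuous (fun x => Im (w x) / Re (w x))}.
    by apply: continuousM => //; apply: continuousV => //; rewrite gt_eqF ?w0.
  exact: (continuous_comp cq (@continuous_atan R _)).
- rewrite (le_trans (ler_normD _ _))// -addn1 natrD mulrDl mul1r lerD//.
  have h1 := atan_gtNpi2 (Im (w p) / Re (w p)).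
  have h2 := atan_ltpi2 (Im (w p) / Re (w p)).
  have := pi_gt0 R => pi0.
  by rewrite ler_norml; apply/andP; split; lra.
- have := rayM (rayV (ray_conj ru)) (ray_atan (w0 p Hp)).
  rewrite opprK; congr ray; rewrite /w mulKf//.
  by rewrite conjc_eq0; exact/accretive_det_neq0/aM'.
Qed.
End Accretive.

(** * Functions that are harmonic in a weak sense *)

Section WeaklyHarmonic.
Variable R : realType.
Implicit Types (u v w : R * R -> R) (z p : R * R) (t e d x : R).

Lemma contP u p : {for p, continuous u} <->
  (forall e, 0 < e -> exists2 d, 0 < d &
     forall z, `|z.1 - p.1| < d -> `|z.2 - p.2| < d -> `|u z - u p| < e).
Proof.
split.
  move=> /cvgrPdist_lt cu e /cu /nbhs_ballP[d /= d0 h]; exists d => // z z1 z2.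
  by rewrite distrC; apply: h; split; rewrite /= /ball /= distrC.
move=> h; apply/cvgrPdist_lt => e /h[d d0 {}h].
apply: filterS (nbhsx_ballx p d d0) => z [z1 z2].
by rewrite distrC; apply: h; rewrite distrC.
Qed.

(** The five-point Laplacian, before division by [t ^ 2]. *)
Definition lap4 v z t := v (z.1 + t, z.2) + v (z.1 - t, z.2) +
  v (z.1, z.2 + t) + v (z.1, z.2 - t) - 4 * v z.

(** Harmonicity in a weak sense that suffices for the maximum principle and asks
    for no derivatives. *)
Definition flat v z := forall e, 0 < e -> exists2 d, 0 < d &
  forall t, 0 < t -> t < d -> `|lap4 v z t| <= e * t ^+ 2.

Lemma flatD v w z : flat v z -> flat w z -> flat (fun z => v z + w z) z.
Proof.
move=> fv fw e e0; have e2 : 0 < e / 2 by rewrite divr_gt0.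
have [d d0 h] := fv _ e2; have [d' d'0 h'] := fw _ e2.
exists (Num.min d d'); rewrite ?lt_min ?d0// => t t0.
rewrite lt_min => /andP[td td'].
have -> : lap4 (fun z => v z + w z) z t = lap4 v z t + lap4 w z t.
  by rewrite /lap4; ring.
rewrite (le_trans (ler_normD _ _))// [e in leRHS]splitr mulrDl lerD ?h ?h'//.
Qed.

Lemma flatZ (c : R) v z : flat v z -> flat (fun z => c * v z) z.
Proof.
move=> fv e e0; have c0 : 0 < `|c| + 1 by rewrite ltr_wpDl.
have [d d0 h] := fv _ (divr_gt0 e0 c0); exists d => // t t0 /(h t t0){}h.
have -> : lap4 (fun z => c * v z) z t = c * lap4 v z t by rewrite /lap4; ring.
rewrite normrM (le_trans (ler_wpM2l (normr_ge0 c) h))//.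
rewrite [leLHS](_ : _ = (`|c| / (`|c| + 1)) * (e * t ^+ 2)); last by ring.
apply: ler_piMl; first by rewrite mulr_ge0 ?sqr_ge0 ?(ltW e0).
by rewrite ler_pdivrMr// mul1r lerDl.
Qed.

Lemma flat_ext v w z : v =1 w -> flat v z -> flat w z.
Proof. by move=> /funext ->. Qed.

Lemma flatB v w z : flat v z -> flat w z -> flat (fun z => v z - w z) z.
Proof.
move=> fv fw; apply: flat_ext (flatD fv (flatZ (-1) fw)) => x.
by rewrite mulN1r.
Qed.

Lemma flat_cst (c : R) z : flat (fun=> c) z.
Proof.
move=> e e0; exists 1 => // t t0 _.
have -> : lap4 (fun=> c) z t = 0 by rewrite /lap4; ring.
by rewrite normr0 mulr_ge0 ?sqr_ge0 ?(ltW e0).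
Qed.

Lemma ln1Dx_bound x : `|x| <= 1 / 2 -> `|ln (1 + x)| <= 2 * `|x|.
Proof.
move=> x2; have := x2; rewrite ler_norml => /andP[xl xu].
have x0 : 0 < 1 + x by lra.
have h1 : ln (1 + x) <= x by apply: le_ln1Dx; lra.
have h2 : - ln (1 + x) <= - x / (1 + x).
  rewrite -lnV ?posrE//.
  have e : (1 + x)^-1 = 1 + - x / (1 + x) by field; rewrite gt_eqF.
  by rewrite [X in ln X]e; apply: le_ln1Dx; rewrite ltr_pdivlMr//; lra.
have h3 : - x / (1 + x) <= 2 * `|x|.
  rewrite ler_pdivrMr// (@le_trans _ _ `|x|)//.
    by rewrite -normrN ler_norm.
  by have := normr_ge0 x; nra.
rewrite ler_norml; apply/andP; split; first by rewrite lerNl (le_trans h2).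
by rewrite (le_trans h1)// (le_trans (ler_norm x))//; have := normr_ge0 x; lra.
Qed.


(** The average over the four fourth roots of [t ^ 4] cancels the first and
    second order terms of a holomorphic function, so that the product below is
    [1 + o(t ^ 2)].  Both the logarithm of its modulus and its argument are
    then harmonic in the weak sense of [flat]. *)
Definition mul4 (g : R * R -> R[i]) z t : R[i] :=
  g (z.1 + t, z.2) * g (z.1 - t, z.2) * g (z.1, z.2 + t) * g (z.1, z.2 - t).

Definition cflat (g : R * R -> R[i]) z := forall e, 0 < e ->
  exists2 d, 0 < d & forall t, 0 < t -> t < d ->
    `|Re (mul4 g z t / g z ^+ 4) - 1| <= e * t ^+ 2 /\
    `|Im (mul4 g z t / g z ^+ 4)| <= e * t ^+ 2.

Definition sqmod (c : R[i]) : R := Re c ^+ 2 + Im c ^+ 2.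

Lemma sqmodM (c d : R[i]) : sqmod (c * d) = sqmod c * sqmod d.
Proof. by rewrite /sqmod ReM ImM; ring. Qed.

Lemma sqmod_ge0 (c : R[i]) : 0 <= sqmod c.
Proof. by rewrite addr_ge0 ?sqr_ge0. Qed.

Lemma sqmod_eq0 c : (sqmod c == 0) = (c == 0).
Proof.
rewrite /sqmod paddr_eq0 ?sqr_ge0// !sqrf_eq0.
by case: c => a b; rewrite eq_complex.
Qed.

Lemma sqmod_gt0 c : (0 < sqmod c) = (c != 0).
Proof. by rewrite lt_neqAle eq_sym sqmod_eq0 addr_ge0 ?sqr_ge0 ?andbT. Qed.

Lemma cflat_small (g : R * R -> R[i]) z e : cflat g z -> 0 < e -> e <= 1 ->
  exists2 d, 0 < d & forall t, 0 < t -> t < d ->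
    [/\ `|Re (mul4 g z t / g z ^+ 4) - 1| <= e * t ^+ 2,
        `|Im (mul4 g z t / g z ^+ 4)| <= e * t ^+ 2 & e * t ^+ 2 <= 1 / 8].
Proof.
move=> gz e0 e1; have [d d0 h] := gz e e0.
exists (Num.min d (1 / 8)); first by rewrite lt_min d0/=; lra.
move=> t t0; rewrite lt_min => /andP[/(h t t0)[h1 h2] t8]; split => //.
have : t ^+ 2 <= 1 / 8 * t by rewrite expr2 ler_pM2r// ltW.
by move=> ht; nra.
Qed.

(** The Laplacian of the logarithm is the logarithm of the modulus of the
    product in [cflat]. *)
Lemma flat_ln (g : R * R -> R[i]) z : g z != 0 -> cflat g z ->
  flat (fun z => ln (sqmod (g z))) z.
Proof.
move=> gz0 gz e e0; pose e' := Num.min (e / 8) 1.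
have e'0 : 0 < e' by rewrite lt_min divr_gt0//=.
have e'1 : e' <= 1 by rewrite ge_min lexx orbT.
have e'e : e' <= e / 8 by rewrite ge_min lexx.
have [d /= d0 h] := cflat_small gz e'0 e'1; exists d => // t t0 td.
have [] := h t t0 td; set P : R[i] := mul4 g z t / g z ^+ 4 => h1 h2 h3.
have P0 : P != 0.
  apply/eqP => P0; move: h1; rewrite P0 /= sub0r normrN normr1 => h1; lra.
have : mul4 g z t != 0 by apply: contra P0; rewrite /P => /eqP ->; rewrite mul0r.
rewrite /mul4 !mulf_eq0 !negb_or => /andP[/andP[/andP[n1 n2] n3] n4].
have PE : sqmod P * sqmod (g z) ^+ 4 = sqmod (mul4 g z t).
  have -> : sqmod (g z) ^+ 4 = sqmod (g z ^+ 4).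
    by rewrite !exprS expr0 !mulr1 !sqmodM.
  by rewrite -sqmodM /P divfK// expf_neq0.
clearbody P.
have -> : lap4 (fun z => ln (sqmod (g z))) z t = ln (sqmod P).
  have : ln (sqmod P * sqmod (g z) ^+ 4) = ln (sqmod (mul4 g z t)) by rewrite PE.
  rewrite [X in X = _]lnM ?posrE ?exprn_gt0 ?sqmod_gt0// lnXn ?sqmod_gt0//.
  rewrite /mul4 !sqmodM !lnM ?posrE ?mulr_gt0 ?sqmod_gt0// => E.
  rewrite /lap4; rewrite -mulr_natl in E.
  lra.
set a := Re P - 1 in h1; set b := Im P in h2; set x : R := e' * t ^+ 2 in h1 h2 h3.
have -> : sqmod P = 1 + (2 * a + a ^+ 2 + b ^+ 2).
  by rewrite /sqmod /a /b; ring.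
have xe : x <= e / 8 * t ^+ 2 by rewrite ler_wpM2r ?sqr_ge0.
clearbody x.
have a2 : a ^+ 2 <= x / 8.
  rewrite -real_normK ?num_real// expr2.
  by have := normr_ge0 a; nra.
have b2 : b ^+ 2 <= x / 8.
  rewrite -real_normK ?num_real// expr2.
  by have := normr_ge0 b; nra.
have s : `|2 * a + a ^+ 2 + b ^+ 2| <= 3 * x.
  have := sqr_ge0 a; have := sqr_ge0 b; move: h1; rewrite !ler_norml => /andP[? ?] ? ?.
  by apply/andP; split; lra.
have h4 : 3 * x <= 1 / 2 by lra.
rewrite (le_trans (ln1Dx_bound (le_trans s h4)))//.
have et : 0 <= e * t ^+ 2 by rewrite mulr_ge0 ?sqr_ge0 ?ltW.
have xt : 2 * (3 * x) <= e * t ^+ 2 by lra.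
by apply: le_trans xt; rewrite ler_pM2l.
Qed.

Lemma deriv_bound (f f' : R -> R) (C : R) n :
  (forall x, is_derive x 1 f (f' x)) -> f 0 = 0 ->
  (forall x, `|x| <= 1 -> `|f' x| <= C * `|x| ^+ n) ->
  forall x, `|x| <= 1 -> `|f x| <= C * `|x| ^+ n.+1.
Proof.
move=> df f0 bf x x1.
have C0 : 0 <= C.
  have := bf 1; rewrite normr1 expr1n mulr1 lexx => /(_ isT).
  exact: le_trans (normr_ge0 _).
have cf : continuous f.
  by move=> y; apply/differentiable_continuous/derivable1_diffP; case: (df y).
have [c [c1 fc]] : exists c, `|c| <= `|x| /\ f x = f' c * x.
  have [x0|x0] := leP 0 x.
    have [c] := @MVT_segment R f f' 0 x x0 (fun y _ => df y) (continuous_subspaceT cf).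
    rewrite in_itv/= f0 !subr0 => /andP[c0 cx] E; exists c; split => //.
    by rewrite !ger0_norm.
  have [c] := @MVT_segment R f f' x 0 (ltW x0) (fun y _ => df y) (continuous_subspaceT cf).
  rewrite in_itv/= f0 !sub0r mulrN => /andP[c0 cx] /oppr_inj E.
  by exists c; split => //; rewrite (ltr0_norm x0) ler0_norm// lerN2.
rewrite fc normrM exprSr mulrA ler_wpM2r// (le_trans (bf _ _))//.
  exact: le_trans x1.
by rewrite ler_wpM2l// lerXn2r// ?nnegrE.
Qed.

Lemma atan_bound x : `|x| <= 1 -> `|atan x| <= `|x|.
Proof.
move=> x1; rewrite -[leRHS]mul1r -[`|x| in leRHS]expr1.
have da (y : R) : is_derive y 1 (@atan R) (1 + y ^+ 2)^-1.
  by split; [exact: derivable_atan|rewrite -derive1E derive1_atan].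
apply: (deriv_bound da) => //; first exact: atan0.
move=> y _; rewrite expr0 mulr1 ger0_norm ?invr_ge0 ?addr_ge0 ?sqr_ge0//.
by rewrite invf_le1 ?ltr_pwDl ?sqr_ge0// lerDl sqr_ge0.
Qed.

(** The Laplacian of the argument is an argument of the product in [cflat]; by
    continuity it is the small one. *)
Lemma flat_ray (g : R * R -> R[i]) u z : cflat g z -> {for z, continuous u} ->
  (exists2 d, 0 < d & forall y, `|y.1 - z.1| < d -> `|y.2 - z.2| < d ->
     ray (g y) (u y)) ->
  flat u z.
Proof.
move=> gz cu [d2 d20 ru] e e0; pose e' := Num.min (e / 8) 1.
have e'0 : 0 < e' by rewrite lt_min divr_gt0//=.
have e'1 : e' <= 1 by rewrite ge_min lexx orbT.
have e'e : e' <= e / 8 by rewrite ge_min lexx.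
have [d /= d0 h] := cflat_small gz e'0 e'1.
have [d1 d10 h1] := (contP u z).1 cu (1 / 4) ltac:(lra).
exists (Num.min d (Num.min d1 d2)); first by rewrite !lt_min d0 d10.
move=> t t0; rewrite !lt_min => /andP[td /andP[td1 td2]].
have [] := h t t0 td; set P : R[i] := mul4 g z t / g z ^+ 4 => hr hi hs.
have near (y : R * R) : (`|y.1 - z.1| <= t /\ `|y.2 - z.2| <= t) ->
    `|u y - u z| < 1 / 4 /\ ray (g y) (u y).
  by move=> [y1 y2]; split; [apply: h1|apply: ru]; apply: le_lt_trans td1 || apply: le_lt_trans td2.
have e1 : z.1 + t - z.1 = t by ring.
have e2 : z.1 - t - z.1 = - t by ring.
have e3 : z.2 + t - z.2 = t by ring.
have e4 : z.2 - t - z.2 = - t by ring.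
have nt : `|t| = t by rewrite gtr0_norm.
have [u1 r1] := near (z.1 + t, z.2) ltac:(by rewrite /= e1 subrr normr0 nt lexx ltW).
have [u2 r2] := near (z.1 - t, z.2) ltac:(by rewrite /= e2 subrr normr0 normrN nt lexx ltW).
have [u3 r3] := near (z.1, z.2 + t) ltac:(by rewrite /= e3 subrr normr0 nt lexx ltW).
have [u4 r4] := near (z.1, z.2 - t) ltac:(by rewrite /= e4 subrr normr0 normrN nt lexx ltW).
have [_ r0] := near z ltac:(by rewrite !subrr normr0 ltW).
have rP : ray P (lap4 u z t).
  have := rayM (rayM (rayM (rayM r1 r2) r3) r4) (rayV (rayM (rayM (rayM r0 r0) r0) r0)).
  congr ray; first by rewrite /P /mul4 !exprS expr0 mulr1 !mulrA.
  by rewrite /lap4; ring.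
have s1 : `|lap4 u z t| < 1.
  move: u1 u2 u3 u4; rewrite /lap4 !ltr_norml => /andP[a1 b1] /andP[a2 b2] /andP[a3 b3] /andP[a4 b4].
  by clear -a1 b1 a2 b2 a3 b3 a4 b4; apply/andP; split; lra.
have RP : 1 / 2 < Re P.
  by move: hr; rewrite ler_norml => /andP[hr _]; clear -hr hs; lra.
have q : `|Im P / Re P| <= 2 * (e' * t ^+ 2).
  rewrite normrM normfV (gtr0_norm (x := Re P)); last by clear -RP; lra.
  by rewrite ler_pdivrMr; [|by clear -RP; lra]; have i0 := normr_ge0 (Im P); clear -RP hi i0; nra.
(* Both are arguments of P, and they differ by less than 2 pi. *)
have : lap4 u z t - atan (Im P / Re P) = 0.
  apply: cis_eq1; last first.
    by rewrite cisD cisN (ray_uniq rP (ray_atan _)) -?cisN ?cisVN//; clear -RP; lra.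
  have l := atan_gtNpi2 (Im P / Re P); have r := atan_ltpi2 (Im P / Re P).
  have := pi_ge2 R; move: s1; rewrite !ltr_norml => /andP[s1 s2] p2.
  by clear -l r s1 s2 p2; apply/andP; split; lra.
move/subr0_eq => ->; rewrite (le_trans (atan_bound _))//; first by lra.
rewrite (le_trans q)//.
have : e' * t ^+ 2 <= e / 8 * t ^+ 2 by rewrite ler_wpM2r ?sqr_ge0.
by have := sqr_ge0 t; nra.
Qed.
End WeaklyHarmonic.

(** * Second-order expansions of holomorphic functions *)

Section Jets.
Variable R : realType.
Local Notation normc := Normc.normc.
Implicit Types (f g : R[i] -> R[i]) (G : R * R -> R[i]) (z : R * R) (w : R[i]).

Lemma normc_ge0 w : 0 <= normc w.
Proof. by case: w => a b; exact: sqrtr_ge0. Qed.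
Lemma Re_le_normc w : `|Re w| <= normc w.
Proof. by case: w => a b /=; rewrite -sqrtr_sqr ler_wsqrtr// lerDl sqr_ge0. Qed.
Lemma Im_le_normc w : `|Im w| <= normc w.
Proof. by case: w => a b /=; rewrite -sqrtr_sqr ler_wsqrtr// lerDr sqr_ge0. Qed.
Lemma normc_real (r : R) : normc r%:C = `|r|.
Proof. by rewrite /= expr0n addr0 sqrtr_sqr. Qed.
Lemma normci (w : R[i]) : normc ('i%C * w) = normc w.
Proof. by rewrite Normc.normcM /= expr0n expr1n add0r sqrtr1 mul1r. Qed.

Definition bigO n f := exists2 K : R, 0 <= K &
  forall w, normc w <= 1 -> normc (f w) <= K * normc w ^+ n.

Lemma bigO_ext n f g : f =1 g -> bigO n f -> bigO n g.
Proof. by move=> /funext ->. Qed.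
Lemma bigO_cst (c : R[i]) : bigO 0 (fun=> c).
Proof.
by exists (normc c) => [|w _]; [exact: normc_ge0|rewrite expr0 mulr1].
Qed.
Lemma bigO_id : bigO 1 id.
Proof. by exists 1 => // w _; rewrite expr1 mul1r. Qed.
Lemma bigOD n f g : bigO n f -> bigO n g -> bigO n (fun w => f w + g w).
Proof.
move=> [K K0 h] [K' K'0 h']; exists (K + K') => [|w w1]; first exact: addr_ge0.
by rewrite (le_trans (le_normcD _ _))// mulrDl lerD ?h ?h'.
Qed.
Lemma bigOM m n f g : bigO m f -> bigO n g -> bigO (m + n) (fun w => f w * g w).
Proof.
move=> [K K0 h] [K' K'0 h']; exists (K * K') => [|w w1]; first exact: mulr_ge0.
by rewrite Normc.normcM exprD mulrACA ler_pM ?normc_ge0 ?h ?h'.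
Qed.
Lemma bigO_le m n f : (m <= n)%N -> bigO n f -> bigO m f.
Proof.
move=> mn [K K0 h]; exists K => // w w1; rewrite (le_trans (h w w1))//.
by rewrite ler_wpM2l// ler_wiXn2l ?normc_ge0.
Qed.
Lemma bigOX n f k : bigO k f -> bigO (k * n) (fun w => f w ^+ n).
Proof.
move=> fk; elim: n => [|n IH]; first by rewrite muln0; exact: bigO_cst.
rewrite mulnS; apply: bigO_ext (bigOM fk IH) => w; by rewrite exprS.
Qed.
Lemma bigO_real n (h : R -> R) (k : R[i] -> R) : (forall w, `|k w| <= normc w) ->
  (exists2 K, 0 <= K & forall x, `|x| <= 1 -> `|h x| <= K * `|x| ^+ n) ->
  bigO n (fun w => (h (k w))%:C).
Proof.
move=> kw [K K0 hK]; exists K => // w w1; rewrite normc_real.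
rewrite (le_trans (hK _ _))//; first exact: le_trans w1.
by rewrite ler_wpM2l// lerXn2r ?nnegrE ?normc_ge0.
Qed.

Definition shift z w : R * R := (z.1 + Re w, z.2 + Im w).

(** The second order expansion, with complex coefficients, of a holomorphic
    function.  Being closed under sums and products, this class contains the
    determinants of matrices of plane waves. *)
Definition jet2 G z := exists a b : R[i],
  bigO 3 (fun w => G (shift z w) - (G z + a * w + b * w ^+ 2)).

Lemma jet2_ext G G' z : G =1 G' -> jet2 G z -> jet2 G' z.
Proof. by move=> /funext ->. Qed.

Lemma jet2_cst (c : R[i]) z : jet2 (fun=> c) z.
Proof.
exists 0, 0; apply: (@bigO_ext _ (fun=> 0)) => [w|]; first by ring.
by exists 0 => // w _; rewrite Normc.normc0 mul0r.
Qed.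

Lemma jet2_id (c : R[i]) z : jet2 (fun z => (z.1 +i* z.2) + c) z.
Proof.
exists 1, 0; apply: (@bigO_ext _ (fun=> 0)) => [w|].
  have -> : (shift z w).1 +i* (shift z w).2 = (z.1 +i* z.2) + w.
    by case: w.
  by ring.
by exists 0 => // w _; rewrite Normc.normc0 mul0r.
Qed.

Lemma jet2D G G' z : jet2 G z -> jet2 G' z -> jet2 (fun z => G z + G' z) z.
Proof.
move=> [a [b h]] [a' [b' h']]; exists (a + a'), (b + b').
by apply: bigO_ext (bigOD h h') => w; ring.
Qed.

Lemma bigO_poly2 (c a b : R[i]) : bigO 0 (fun w => c + a * w + b * w ^+ 2).
Proof.
apply: bigOD; first apply: bigOD; first exact: bigO_cst.
  exact: (bigO_le (n := 1)) (bigOM (bigO_cst a) bigO_id).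
exact: (bigO_le (n := 2)) (bigOM (bigO_cst b) (bigOX 2 bigO_id)).
Qed.

Lemma jet2M G G' z : jet2 G z -> jet2 G' z -> jet2 (fun z => G z * G' z) z.
Proof.
move=> [a [b h]] [a' [b' h']]; exists (G z * a' + a * G' z).
exists (G z * b' + a * a' + b * G' z).
have G'0 : bigO 0 (fun w => G' (shift z w)).
  apply: bigO_ext (bigOD (bigO_le (m := 0) isT h') (bigO_poly2 (G' z) a' b')) => w.
  by rewrite subrK.
have r : bigO 3 (fun w => (a * b' + b * a') * w ^+ 3 + (b * b') * w ^+ 4).
  apply: bigOD; first exact: (bigOM (bigO_cst _) (bigOX 3 bigO_id)).
  exact: (bigO_le (n := 4)) (bigOM (bigO_cst _) (bigOX 4 bigO_id)).
apply: bigO_ext (bigOD (bigOD (bigOM h G'0) (bigOM (bigO_poly2 (G z) a b) h')) r) => w.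
ring.
Qed.

Lemma jet2_sum I (r : seq I) (P : pred I) (F : I -> R * R -> R[i]) z :
  (forall i, P i -> jet2 (F i) z) -> jet2 (fun x => \sum_(i <- r | P i) F i x) z.
Proof.
move=> cF; elim: r => [|i r IH].
  by apply: (jet2_ext (G := fun=> 0)) (jet2_cst _ _) => x; rewrite big_nil.
case: (boolP (P i)) => Pi; last first.
  by apply: jet2_ext IH => x; rewrite big_cons (negbTE Pi).
by apply: jet2_ext (jet2D (cF i Pi) IH) => x; rewrite big_cons Pi.
Qed.
Lemma jet2_prod I (r : seq I) (P : pred I) (F : I -> R * R -> R[i]) z :
  (forall i, P i -> jet2 (F i) z) -> jet2 (fun x => \prod_(i <- r | P i) F i x) z.
Proof.
move=> cF; elim: r => [|i r IH].
  by apply: (jet2_ext (G := fun=> 1)) (jet2_cst _ _) => x; rewrite big_nil.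
case: (boolP (P i)) => Pi; last first.
  by apply: jet2_ext IH => x; rewrite big_cons (negbTE Pi).
by apply: jet2_ext (jet2M (cF i Pi) IH) => x; rewrite big_cons Pi.
Qed.
Lemma jet2_det n (M : R * R -> 'M[R[i]]_n) z :
  (forall i j, jet2 (fun x => M x i j) z) -> jet2 (fun x => \det (M x)) z.
Proof.
move=> cM; apply: jet2_sum => s _; apply: jet2M; first exact: jet2_cst.
by apply: jet2_prod => i _.
Qed.

(** The product of the expansions at the displacements t, -t, it and -it has no
    terms of order 1, 2 or 3. *)
Lemma jet2_cflat G z : G z != 0 -> jet2 G z -> cflat G z.
Proof.
move=> G0 [a [b h]].
pose al := a / G z; pose be := b / G z.
pose r w := (G (shift z w) - (G z + a * w + b * w ^+ 2)) / G z.
have r3 : bigO 3 r.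
  rewrite /r -[3%N]addn0; apply: (bigOM h); exact: bigO_cst.
have GE w : G (shift z w) / G z = 1 + al * w + be * w ^+ 2 + r w.
  by rewrite /r /al /be; field.
have rot m : bigO 3 (fun w => r ('i%C ^+ m * w)).
  case: r3 => K K0 rK; exists K => // w w1.
  have e : normc ('i%C ^+ m * w) = normc w.
    by elim: m => [|m IH]; rewrite ?expr0 ?mul1r// exprS -mulrA normci.
  by rewrite (le_trans (rK _ _)) ?e.
pose p m w := 1 + al * ('i%C ^+ m * w) + be * ('i%C ^+ m * w) ^+ 2 : R[i].
have p0 m : bigO 0 (p m).
  apply: bigO_ext (bigO_poly2 1 (al * 'i%C ^+ m) (be * 'i%C ^+ m ^+ 2)) => w.
  by rewrite /p exprMn !mulrA.
pose q m w := p m w + r ('i%C ^+ m * w).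
have q0 m : bigO 0 (q m) by apply: bigOD => //; exact: (bigO_le (n := 3)).
have i2 : 'i%C ^+ 2 = -1 :> R[i] by rewrite sqr_i.
have i3 : 'i%C ^+ 3 = - 'i%C :> R[i] by rewrite exprS i2 mulrN1.
(* The remainders are replaced by zero one factor at a time. *)
have B : bigO 3 (fun w => q 0%N w * q 2%N w * q 1%N w * q 3%N w - 1).
  have b1 : bigO 3 (fun w => p 0%N w * p 2%N w * p 1%N w * p 3%N w - 1).
    have : bigO 3 (fun w => (2 * be ^+ 2 - (2 * be - al ^+ 2) ^+ 2 + be ^+ 4 * w ^+ 4) * w ^+ 4).
      apply: (bigO_le (n := 4)) => //; apply: (@bigOM 0 4); last exact: (bigOX 4 bigO_id).
      apply: bigOD; first exact: bigO_cst.
      exact: (bigO_le (n := 4)) (bigOM (bigO_cst _) (bigOX 4 bigO_id)).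
    apply: bigO_ext => w.
    have jj : 'i%C * 'i%C = -1 :> R[i] by rewrite -expr2.
    have -> : p 2%N w = 1 - al * w + be * w ^+ 2.
      by rewrite /p i2; ring.
    have -> : p 1%N w = 1 + al * 'i%C * w - be * w ^+ 2.
      by rewrite /p expr1 exprMn i2; ring.
    have -> : p 3%N w = 1 - al * 'i%C * w - be * w ^+ 2.
      by rewrite /p i3 exprMn sqrrN i2; ring.
    rewrite /p expr0 mul1r; symmetry.
    transitivity ((1 + al * w + be * w ^+ 2) * (1 - al * w + be * w ^+ 2) *
      ((1 - be * w ^+ 2) ^+ 2 - al ^+ 2 * w ^+ 2 * ('i%C * 'i%C)) - 1); first by ring.
    by rewrite jj; ring.
  have p02 : bigO 0 (fun w => p 0%N w * p 2%N w) by exact: (bigOM (p0 _) (p0 _)).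
  have p021 : bigO 0 (fun w => p 0%N w * p 2%N w * p 1%N w) by exact: (bigOM p02 (p0 _)).
  have b2 := bigOM (rot 0%N) (bigOM (bigOM (q0 2%N) (q0 1%N)) (q0 3%N)).
  have b3 := bigOM (p0 0%N) (bigOM (rot 2%N) (bigOM (q0 1%N) (q0 3%N))).
  have b4 := bigOM p02 (bigOM (rot 1%N) (q0 3%N)).
  have b5 := bigOM p021 (rot 3%N).
  apply: bigO_ext (bigOD (bigOD (bigOD (bigOD b1 b2) b3) b4) b5) => w.
  by rewrite /q; ring.
have [K K0 KB] := B.
move=> e e0; exists (Num.min 1 (e / (K + 1))).
  by rewrite lt_min ltr01 divr_gt0// ltr_wpDl.
move=> t t0; rewrite lt_min => /andP[t1 te].
have sh m : G (shift z ('i%C ^+ m * t%:C)) / G z = q m t%:C by rewrite GE.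
have PE : mul4 G z t / G z ^+ 4 = q 0%N t%:C * q 2%N t%:C * q 1%N t%:C * q 3%N t%:C.
  rewrite -!sh /mul4 expr0 mul1r expr1 i2 i3.
  have -> : shift z t%:C = (z.1 + t, z.2) by rewrite /shift /= addr0.
  have -> : shift z (-1 * t%:C) = (z.1 - t, z.2).
    by rewrite /shift mulN1r /= oppr0 addr0.
  have -> : shift z ('i%C * t%:C) = (z.1, z.2 + t).
    by congr (_, _); rewrite /=; ring.
  have -> : shift z (- 'i%C * t%:C) = (z.1, z.2 - t).
    by congr (_, _); rewrite /=; ring.
  by field.
have nt : normc t%:C = t by rewrite normc_real gtr0_norm.
have := KB t%:C; rewrite nt => /(_ (ltW t1)); rewrite -PE.
set P := mul4 G z t / G z ^+ 4 => bP.
have Kt : K * t ^+ 3 <= e * t ^+ 2.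
  rewrite exprS mulrA ler_wpM2r ?sqr_ge0//.
  move: te; rewrite ltr_pdivlMr ?ltr_wpDl// => te.
  by rewrite (le_trans _ (ltW te))// mulrC ler_pM2l// lerDl.
split; apply: le_trans Kt; apply: le_trans bP.
  by apply: le_trans (Re_le_normc _); rewrite ReD ReN.
by apply: le_trans (Im_le_normc _); rewrite ImD ImN /= subr0.
Qed.
End Jets.

(** * Plane waves *)

Section Waves.
Variable R : realType.
Local Notation normc := Normc.normc.
Implicit Types (z : R * R) (w : R[i]) (l x : R).

(** The plane wave [exp (i l z)]. *)
Definition wave l z : R[i] := (expR (- (l * z.2)))%:C * cis (l * z.1).

Lemma waveD l z z' : wave l (z.1 + z'.1, z.2 + z'.2) = wave l z * wave l z'.
Proof.
by rewrite /wave /= !mulrDr cisD opprD expRD rmorphM /= mulrACA.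
Qed.


Lemma ccont_wave l z : ccont (wave l) z.
Proof.
have c1 : {for z, continuous (fun z : R * R => z.1)} by apply: cvg_fst.
have c2 : {for z, continuous (fun z : R * R => z.2)} by apply: cvg_snd.
apply: ccontM.
  apply: ccont_real.
  have h : {for z, continuous (fun z : R * R => - (l * z.2))}.
    by apply: continuousN; apply: continuousM => //; exact: cvg_cst.
  exact: (continuous_comp h (@continuous_expR R _)).
by apply: ccont_cis; apply: continuousM => //; exact: cvg_cst.
Qed.

Definition realO n (h : R -> R) := exists2 K, 0 <= K & forall x, `|x| <= 1 -> `|h x| <= K * `|x| ^+ n.

(** Each integration gains one order: this gives the Taylor expansions of exp,
    sin and cos from their derivatives. *)
Lemma realO_prim n (h h' : R -> R) : (forall x, is_derive x 1 h (h' x)) ->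
  h 0 = 0 -> realO n h' -> realO n.+1 h.
Proof. by move=> dh h0 [K K0 hK]; exists K => //; exact: deriv_bound hK. Qed.


Lemma realOZ n (c : R) (h : R -> R) : realO n h -> realO n (fun x => c * h x).
Proof.
move=> [K K0 hK]; exists (`|c| * K) => [|x x1]; first exact: mulr_ge0.
by rewrite normrM -mulrA ler_wpM2l// hK.
Qed.

Lemma realO_bnd (h : R -> R) C : (forall x, `|x| <= 1 -> `|h x| <= C) -> 0 <= C -> realO 0 h.
Proof. by move=> hC C0; exists C => // x x1; rewrite expr0 mulr1 hC. Qed.

Lemma dexp l x : is_derive x 1 (fun x => expR (l * x)) (l * expR (l * x)).
Proof.
have -> : (fun x => expR (l * x)) = expR \o ( *%R l) by [].
apply: is_derive_eq.
by rewrite /GRing.scale/=; ring.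
Qed.

Lemma dsin l x : is_derive x 1 (fun x => sin (l * x)) (l * cos (l * x)).
Proof.
have -> : (fun x => sin (l * x)) = @sin R \o ( *%R l) by [].
apply: is_derive_eq.
by rewrite /GRing.scale/=; ring.
Qed.

Lemma dcos l x : is_derive x 1 (fun x => cos (l * x)) (- (l * sin (l * x))).
Proof.
have -> : (fun x => cos (l * x)) = @cos R \o ( *%R l) by [].
apply: is_derive_eq.
by rewrite /GRing.scale/=; ring.
Qed.

Lemma realO_exp l : realO 3 (fun x => expR (l * x) - (1 + l * x + (l * x) ^+ 2 / 2)).
Proof.
have e0 : realO 0 (fun x => expR (l * x)).
  apply: (@realO_bnd _ (expR `|l|)); last exact: expR_ge0.
  move=> x x1; rewrite ger0_norm ?expR_ge0// ler_expR.
  by rewrite (le_trans (ler_norm _))// normrM ler_piMr.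
have e1 : realO 1 (fun x => expR (l * x) - 1).
  apply: (@realO_prim _ _ (fun x => l * expR (l * x))); last exact: realOZ.
    move=> x; have := dexp l x => d; apply: is_derive_eq; rewrite subr0//.
  by rewrite mulr0 expR0 subrr.
have e2 : realO 2 (fun x => expR (l * x) - (1 + l * x)).
  apply: (@realO_prim _ _ (fun x => l * (expR (l * x) - 1))); last exact: realOZ.
    move=> x; have := dexp l x => d; apply: is_derive_eq.
    by rewrite /GRing.scale/=; ring.
  by rewrite mulr0 expR0 addr0 subrr.
apply: (@realO_prim _ _ (fun x => l * (expR (l * x) - (1 + l * x)))); last exact: realOZ.
  move=> x; have := dexp l x => d; apply: is_derive_eq.
  by rewrite /GRing.scale/=; field.
by rewrite mulr0 expR0 expr0n /= mul0r !addr0 subrr.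
Qed.

Lemma realO_sin1 l : realO 1 (fun x => sin (l * x)).
Proof.
apply: (@realO_prim _ _ (fun x => l * cos (l * x))); first exact: dsin.
  by rewrite mulr0 sin0.
by apply: realOZ; apply: (@realO_bnd _ 1) => // x _; exact: cos_max.
Qed.

Lemma realO_cos l : realO 2 (fun x => cos (l * x) - 1).
Proof.
apply: (@realO_prim _ _ (fun x => (- l) * sin (l * x))).
- move=> x; have := dcos l x => d; apply: is_derive_eq.
  by rewrite subr0 mulNr.
- by rewrite mulr0 cos0 subrr.
exact/realOZ/realO_sin1.
Qed.

Lemma realO_sin3 l : realO 3 (fun x => sin (l * x) - l * x).
Proof.
apply: (@realO_prim _ _ (fun x => l * (cos (l * x) - 1))).
- move=> x; have := dsin l x => d; apply: is_derive_eq.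
  by rewrite /GRing.scale/=; ring.
- by rewrite mulr0 sin0 subrr.
exact/realOZ/realO_cos.
Qed.

Lemma realO_cos3 l : realO 3 (fun x => cos (l * x) - (1 - (l * x) ^+ 2 / 2)).
Proof.
have [K K0 hK] : realO 4 (fun x => cos (l * x) - (1 - (l * x) ^+ 2 / 2)).
  apply: (@realO_prim _ _ (fun x => (- l) * (sin (l * x) - l * x))).
  - move=> x; have := dcos l x => d; apply: is_derive_eq.
    by rewrite /GRing.scale/=; field.
  - by rewrite mulr0 cos0 expr0n /= mul0r !subr0 subrr.
  exact/realOZ/realO_sin3.
exists K => // x x1; rewrite (le_trans (hK x x1))// ler_wpM2l// ler_wiXn2l//.
Qed.

Lemma wave_expansion l : bigO 3 (fun w => wave l (Re w, Im w) -
  (1 + 'i%C * l%:C * w + (- (l ^+ 2 / 2))%:C * w ^+ 2)).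
Proof.
pose x w : R[i] := (Re w)%:C; pose y w : R[i] := (Im w)%:C; pose L : R[i] := l%:C.
have xO : bigO 1 x by apply: (bigO_real (h := id) (@Re_le_normc R)); exists 1 => // x0; rewrite mul1r.
have yO : bigO 1 y by apply: (bigO_real (h := id) (@Im_le_normc R)); exists 1 => // x0; rewrite mul1r.
have r1 := bigO_real (@Im_le_normc R) (realO_exp (- l)).
have r2 := bigO_real (@Re_le_normc R) (realO_cos3 l).
have r3 := bigO_real (@Re_le_normc R) (realO_sin3 l).
pose e w : R[i] := (expR (- l * Im w))%:C.
pose c w : R[i] := cis (l * Re w).
have r23 := bigOD r2 (bigOM (bigO_cst 'i%C) r3).
have c0 : bigO 0 c.
  exists 1 => // w _; rewrite mul1r expr0 /c /= cos2Dsin2.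
  by rewrite sqrtr1.
have lin (a : R[i]) (u : R[i] -> R[i]) : bigO 1 u -> bigO 1 (fun w => a * u w).
  by move=> uO; exact: (bigOM (bigO_cst a) uO).
have p0 : bigO 0 (fun w => 1 - L * y w + (L * y w) ^+ 2 / 2).
  apply: bigOD; first apply: bigOD; first exact: bigO_cst.
    apply: bigO_ext (bigO_le (m := 0) isT (lin (- L) y yO)) => w; by rewrite mulNr.
  apply: bigO_ext (bigO_le (m := 0) isT (bigOM (bigO_cst (1 / 2)) (bigOX 2 (lin L y yO)))) => w.
  by rewrite mulrC; field.
have cub (u v : R[i] -> R[i]) : bigO 1 u -> bigO 1 v ->
    bigO 3 (fun w => u w * v w ^+ 2 / 2 + u w ^+ 2 * v w / 2 + u w ^+ 2 * v w ^+ 2 / 4).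
  move=> uO vO; apply: bigOD; first apply: bigOD.
  - apply: bigO_ext (bigOM (bigO_cst (1 / 2)) (bigOM uO (bigOX 2 vO))) => w.
    by rewrite mulrC; field.
  - apply: bigO_ext (bigOM (bigO_cst (1 / 2)) (bigOM (bigOX 2 uO) vO)) => w.
    by rewrite mulrC; field.
  - apply: (bigO_le (n := 4)) => //.
    apply: bigO_ext (bigOM (bigO_cst (1 / 4)) (bigOM (bigOX 2 uO) (bigOX 2 vO))) => w.
    by rewrite mulrC; field.
have r4 := cub _ _ (lin (- L) y yO) (lin ('i%C * L) x xO).
apply: bigO_ext (bigOD (bigOD (bigOM r1 c0) (bigOM p0 r23)) r4) => w.
have we : w = x w + 'i%C * y w.
  by rewrite /x /y {1}[w]complexE.
have wE : wave l (Re w, Im w) = e w * c w by rewrite /wave /e /c /= mulNr.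
have cE : c w = (cos (l * Re w))%:C + 'i%C * (sin (l * Re w))%:C.
  by rewrite {1}[c w]complexE.
rewrite wE !(rmorphB, rmorphD, rmorphM, rmorphXn, rmorphN, rmorph1) /=.
rewrite !(fmorphV, rmorph_nat) cE -/(e w) -/(x w) -/(y w) -/L.
set C := (cos _)%:C; set S := (sin _)%:C; set E := e w.
move: we; move: (x w) (y w) => X Y ->.
have jj : 'i%C * 'i%C + 1 = 0 :> R[i] by rewrite -expr2 sqr_i addNr.
rewrite -[RHS]addr0 -[X in _ = _ + X](mul0r ((1 - L * Y + (L * Y) ^+ 2 / 2) *
  (L ^+ 2 * X ^+ 2 / 2) + L * Y - L ^+ 2 * Y ^+ 2 / 2 - L ^+ 2 * X ^+ 2 / 2)) -jj.
by field.
Qed.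

Lemma jet2_wave l z : jet2 (wave l) z.
Proof.
exists (wave l z * ('i%C * l%:C)), (wave l z * (- (l ^+ 2 / 2))%:C).
apply: bigO_ext (bigOM (bigO_cst (wave l z)) (wave_expansion l)) => w.
by rewrite /shift (waveD l z (Re w, Im w)); ring.
Qed.

(** The difference quotient of [exp (i l w)] at [w = 0], extended there by its
    limit. *)
Definition wave_slope l z : R[i] :=
  let w := z.1 +i* z.2 in
  if w == 0 then 'i%C * l%:C else (wave l z - 1) / w.

Lemma wave_slopeE l z : wave l z = 1 + (z.1 +i* z.2) * wave_slope l z.
Proof.
rewrite /wave_slope; case: ifPn => [/eqP w0|w0]; last by rewrite mulrC divfK// addrC subrK.
rewrite w0 mul0r addr0; case: w0 => a0 b0.
rewrite /wave a0 b0 !mulr0 oppr0 expR0 cis0.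
by rewrite mulr1.
Qed.

Lemma ccont_bigO (G : R * R -> R[i]) (c : R[i]) : G (0, 0) = c ->
  bigO 1 (fun w => G (Re w, Im w) - c) -> ccont G (0, 0).
Proof.
move=> G0 [K K0 h].
have bnd e : 0 < e -> exists2 d, 0 < d & forall z : R * R, `|z.1 - 0| < d -> `|z.2 - 0| < d ->
    normc (G z - c) < e.
  move=> e0; exists (Num.min (1 / 2) (e / (2 * (K + 1)))).
    by rewrite lt_min divr_gt0//= divr_gt0// mulr_gt0// ltr_wpDl.
  move=> [x y] /=; rewrite !subr0 !lt_min => /andP[x1 x2] /andP[y1 y2].
  have n1 : normc (x +i* y) <= `|x| + `|y|.
    have -> : x +i* y = x%:C + 'i%C * y%:C by rewrite {1}[x +i* y]complexE.
    by rewrite (le_trans (le_normcD _ _))// normci !normc_real.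
  have := h (x +i* y) ltac:(lra); rewrite expr1 /= => hx.
  apply: le_lt_trans hx _; apply: le_lt_trans (_ : (K + 1) * (`|x| + `|y|) < e).
    by apply: ler_pM; rewrite ?normc_ge0 ?lerDl.
  have K1 : 0 < K + 1 by rewrite ltr_wpDl.
  have -> : e = (K + 1) * (e / (2 * (K + 1)) + e / (2 * (K + 1))).
    by field; rewrite gt_eqF.
  by rewrite ltr_pM2l// ltrD.
split; apply/contP => e /bnd[d' d'0 {}h']; exists d' => // z z1 z2;
  rewrite G0; apply: le_lt_trans (h' z z1 z2).
- by apply: le_trans (Re_le_normc _); rewrite ReD ReN.
- by apply: le_trans (Im_le_normc _); rewrite ImD ImN.
Qed.

Lemma ccont_wave_slope l : ccont (wave_slope l) (0, 0).
Proof.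
apply: (ccont_bigO (c := 'i%C * l%:C)); first by rewrite /wave_slope /= eqxx.
have [K K0 h] := wave_expansion l.
exists (K + normc (- (l ^+ 2 / 2))%:C) => [|w w1].
  by rewrite addr_ge0// normc_ge0.
rewrite /wave_slope /=; have -> : Re w +i* Im w = w by case: w {w1}.
case: ifPn => [_|w0].
  by rewrite subrr Normc.normc0 mulr_ge0 ?normc_ge0 ?addr_ge0 ?exprn_ge0 ?normc_ge0.
have n0 : 0 < normc w.
  rewrite lt_neqAle normc_ge0 andbT eq_sym; apply: contra w0 => /eqP/Normc.eq0_normc ->.
  exact: eqxx.
have -> : (wave l (Re w, Im w) - 1) / w - 'i%C * l%:C =
    (wave l (Re w, Im w) - (1 + 'i%C * l%:C * w + (- (l ^+ 2 / 2))%:C * w ^+ 2)) / w +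
    (- (l ^+ 2 / 2))%:C * w by field.
rewrite expr1 (le_trans (le_normcD _ _))// [leRHS]mulrDl lerD//; last by rewrite Normc.normcM.
rewrite Normc.normcM Normc.normcV ler_pdivrMr// (le_trans (h w w1))// -mulrA.
by rewrite ler_wpM2l// exprS ler_pM2l// expr2 ler_piMl// ltW.
Qed.
End Waves.

(** * The maximum principle in the upper half plane *)

Section MaximumPrinciple.
Variable R : realType.
Implicit Types (z p : R * R) (t e d : R) (v : R * R -> R).

Definition nsq z : R := z.1 ^+ 2 + z.2 ^+ 2.

Lemma nsq_ge0 z : 0 <= nsq z. Proof. by rewrite addr_ge0 ?sqr_ge0. Qed.

Lemma nsq_gt0 z : 0 < z.2 -> 0 < nsq z.
Proof. by move=> z0; rewrite ltr_wpDl ?sqr_ge0 ?exprn_gt0. Qed.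

(** A nonnegative harmonic function that is infinite at the origin and at
    infinity: it neutralizes these two points in [max_principle]. *)
Definition barrier z : R := 2 * ln (nsq (z.1, z.2 + 1)) - ln (nsq z).

Lemma sqmodE z (c : R[i]) : sqmod (z.1 +i* z.2 + c) = nsq (z.1 + Re c, z.2 + Im c).
Proof. by rewrite /sqmod /nsq ReD ImD. Qed.

Lemma flat_lnsq z (c : R[i]) : 0 < z.2 -> 0 <= Im c ->
  flat (fun z => ln (nsq (z.1 + Re c, z.2 + Im c))) z.
Proof.
move=> z0 c0; pose g z : R[i] := z.1 +i* z.2 + c.
apply: (flat_ext (v := fun z => ln (sqmod (g z)))).
  by move=> y; rewrite sqmodE.
have g0 : g z != 0 by rewrite -sqmod_gt0 sqmodE nsq_gt0//= ltr_pwDl.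
by apply: flat_ln => //; apply: jet2_cflat => //; exact: jet2_id.
Qed.

Lemma flat_barrier z : 0 < z.2 -> flat barrier z.
Proof.
move=> z0.
have f1 := flat_lnsq (c := 'i%C) z0 (ler01).
have f2 := flat_lnsq (c := 0) z0 (lexx _).
apply: flat_ext (flatB (flatZ 2 f1) f2) => y.
by rewrite /barrier /= !addr0; case: y.
Qed.

Lemma continuous_nsq p : {for p, continuous nsq}.
Proof.
have c1 : {for p, continuous (fun z : R * R => z.1)} by apply: cvg_fst.
have c2 : {for p, continuous (fun z : R * R => z.2)} by apply: cvg_snd.
by apply: continuousD; apply: continuousM.
Qed.

Lemma continuous_barrier p : 0 < p.2 -> {for p, continuous barrier}.
Proof.
move=> p0.
have c1 : {for p, continuous (fun z : R * R => z.1)} by apply: cvg_fst.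
have c2 : {for p, continuous (fun z : R * R => z.2)} by apply: cvg_snd.
have l1 : {for p, continuous (fun z => ln (nsq z))}.
  exact: (continuous_comp (@continuous_nsq p) (continuous_ln (nsq_gt0 p0))).
have n2 : {for p, continuous (fun z => nsq (z.1, z.2 + 1))}.
  have c3 : {for p, continuous (fun z : R * R => z.2 + 1)}.
    by apply: continuousD => //; exact: cvg_cst.
  by apply: continuousD; apply: continuousM.
have l2 : {for p, continuous (fun z => ln (nsq (z.1, z.2 + 1)))}.
  have n0 : 0 < nsq (p.1, p.2 + 1) by apply: nsq_gt0; rewrite /= addr_gt0.
  exact: (continuous_comp n2 (continuous_ln n0)).
apply: continuousD; last exact: continuousN.
by apply: continuousM => //; exact: cvg_cst.
Qed.

Lemma barrier_bounds z : 0 < z.2 ->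
  [/\ 0 <= barrier z, nsq z <= expR (barrier z) & expR (- barrier z) <= nsq z].
Proof.
move=> z0; have n0 := nsq_gt0 z0.
have n1 : 1 <= nsq (z.1, z.2 + 1).
  by rewrite /nsq /= sqrrD expr1n; have := sqr_ge0 z.1; have := sqr_ge0 z.2; nra.
have n2 : nsq z <= nsq (z.1, z.2 + 1).
  by rewrite /nsq /= sqrrD expr1n; nra.
have l1 : 0 <= ln (nsq (z.1, z.2 + 1)) by exact: ln_ge0.
have l2 : ln (nsq z) <= ln (nsq (z.1, z.2 + 1)) by rewrite ler_ln ?posrE// (lt_le_trans _ n2).
split.
- by rewrite /barrier; lra.
- rewrite -{1}[nsq z]lnK ?posrE// ler_expR /barrier; lra.
- rewrite -{1}[nsq z]lnK ?posrE// ler_expR /barrier; lra.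
Qed.

(** Subtracting a small multiple of [barrier] makes a positive value of [v] an
    interior one: the set where the difference is at least some [m > 0] stays
    away from the origin, from infinity and from the real line.  Adding a small
    multiple of the square of the distance to the origin makes the Laplacian
    positive, which is absurd at a maximum. *)
Lemma max_principle v (M : R) :
  (forall z, 0 < z.2 -> {for z, continuous v}) ->
  (forall z, 0 < z.2 -> flat v z) ->
  (forall z, 0 < z.2 -> v z <= M) ->
  (forall x : R, x != 0 -> forall e, 0 < e -> exists2 d : R, 0 < d & forall z,
     0 < z.2 -> `|z.1 - x| < d -> z.2 < d -> v z <= e) ->
  forall z, 0 < z.2 -> v z <= 0.
Proof.
move=> cv fv bv lv z1 z10; rewrite leNgt; apply/negP => v1.
pose e : R := v z1 / (2 * (barrier z1 + 1)).
have [b1 _ _] := barrier_bounds z10.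
have bp : 0 < barrier z1 + 1 by rewrite ltr_wpDl.
have e0 : 0 < e by rewrite divr_gt0// mulr_gt0.
pose w z := v z - e * barrier z.
pose m : R := v z1 / 4.
have m0 : 0 < m by rewrite divr_gt0.
have w1 : 2 * m <= w z1.
  have h : e * barrier z1 <= v z1 / 2.
    rewrite /e mulrAC ler_pdivrMr ?mulr_gt0//.
    by rewrite [leRHS](_ : _ = v z1 * (barrier z1 + 1)); [rewrite ler_pM2l// lerDl|field].
  rewrite /w /m; lra.
have cw z : 0 < z.2 -> {for z, continuous w}.
  move=> z0; apply: continuousB; first exact: cv.
  by apply: continuousM; [exact: cvg_cst|exact: continuous_barrier].
pose K : set (R * R) := [set z | 0 < z.2 /\ m <= w z].
have M0 : 0 < M by rewrite (lt_le_trans v1)// bv.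
pose B : R := M / e.
have KB z : K z -> nsq z <= expR B /\ expR (- B) <= nsq z.
  move=> [z0 mz]; have [b0 h1 h2] := barrier_bounds z0.
  have : barrier z <= B.
    rewrite /B ler_pdivlMr// mulrC; have := bv z z0; rewrite /w in mz; lra.
  by move=> bB; split; [apply: le_trans h1 _|apply: le_trans h2]; rewrite ler_expR ?lerN2.
pose a : R := expR B + 1.
have boxK : K `<=` `[- a, a] `*` `[- a, a].
  move=> z Kz; have [n1 _] := KB z Kz.
  have E0 := expR_gt0 B; have s1 := sqr_ge0 z.1; have s2 := sqr_ge0 z.2.
  rewrite /nsq in n1.
  by split => /=; rewrite in_itv/= /a; apply/andP; split; nra.
(* Limit points on the real line are excluded by the boundary values of v. *)
have closedK : closed K.
  move=> p; rewrite closureEnbhs => cp.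
  have meetK e' : 0 < e' -> exists2 z, K z & `|z.1 - p.1| < e' /\ `|z.2 - p.2| < e'.
    move=> e'0.
    have [z [Kz [h1 h2]]] := cp K (ball p e') (fun _ k => k) (nbhsx_ballx p e' e'0).
    by exists z => //; split; rewrite distrC.
  have p2 : 0 <= p.2.
    rewrite leNgt; apply/negP => p20.
    have [z [z0 _] [_]] := meetK (- p.2) ltac:(by rewrite oppr_gt0).
    by rewrite ltr_norml => /andP[]; lra.
  have np : expR (- B) <= nsq p.
    rewrite leNgt; apply/negP => np.
    have [d d0 hd] := (contP _ _).1 (@continuous_nsq p) (expR (- B) - nsq p) ltac:(by rewrite subr_gt0).
    have [z Kz [h1 h2]] := meetK d d0; have := hd z h1 h2.
    by rewrite ltr_norml => /andP[_]; have [_ ] := KB z Kz; lra.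
  have [p20|p20] := ltP 0 p.2.
    split => //; rewrite leNgt; apply/negP => wp.
    have [d d0 hd] := (contP _ _).1 (cw p p20) (m - w p) ltac:(by rewrite subr_gt0).
    have [z [_ mz] [h1 h2]] := meetK d d0; have := hd z h1 h2.
    by rewrite ltr_norml => /andP[_]; lra.
  have p2E : p.2 = 0 by apply/eqP; rewrite eq_le p20.
  have p1 : p.1 != 0.
    apply/eqP => p1; have := expR_gt0 (- B).
    by move: np; rewrite /nsq p1 p2E expr0n addr0 /= => ? ?; lra.
  have [d d0 hd] := lv p.1 p1 (m / 2) ltac:(by rewrite divr_gt0).
  have [z [z0 mz] [h1 h2]] := meetK d d0.
  rewrite p2E subr0 in h2; have := hd z z0 h1 (le_lt_trans (ler_norm _) h2).
  have [b0 _ _] := barrier_bounds z0.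
  by move: mz; rewrite /w; have := mulr_ge0 (ltW e0) b0; lra.
have compactK : compact K.
  apply: (subclosed_compact closedK _ boxK).
  by apply: compact_setX; exact: segment_compact.
have Kz1 : K z1 by split => //; apply: le_trans w1; lra.
pose eta : R := m / (2 * expR B).
have EB := expR_gt0 B.
have eta0 : 0 < eta by rewrite divr_gt0// mulr_gt0.
pose g z := w z + eta * nsq z.
have cg z : 0 < z.2 -> {for z, continuous g}.
  move=> z0; apply: continuousD; first exact: cw.
  by apply: continuousM; [exact: cvg_cst|exact: continuous_nsq].
have [|z2 /set_mem [z20 mz2] maxg] := compact_EVT_max (ex_intro K z1 Kz1) compactK (f := g).
  apply: continuous_in_subspaceT => z /set_mem [z0 _]; exact: cg.
have w2 : m < w z2.
  have := maxg z1; rewrite inE => /(_ Kz1); rewrite /g => h.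
  have [n2 _] := KB z2 (conj z20 mz2).
  have h1 : eta * nsq z2 <= m / 2.
    rewrite (le_trans (ler_wpM2l (ltW eta0) n2))// /eta.
    by rewrite [leLHS](_ : _ = m / 2)//; field; rewrite gt_eqF.
  have := mulr_ge0 (ltW eta0) (nsq_ge0 z1).
  lra.
have [d1 d10 h1] := (contP _ _).1 (cw z2 z20) (w z2 - m) ltac:(by rewrite subr_gt0).
have f2 : flat w z2.
  by apply: flatB; [exact: fv|apply: flatZ; exact: flat_barrier].
have [d2 d20 h2] := f2 eta eta0.
pose t : R := Num.min (z2.2 / 2) (Num.min (d1 / 2) (d2 / 2)).
have t0 : 0 < t by rewrite !lt_min !divr_gt0.
have tz : t < z2.2.
  by rewrite gt_min; apply/orP; left; rewrite ltr_pdivrMr// ltr_pMr// ltr1n.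
have t1 : t < d1.
  rewrite !gt_min; apply/orP; right; apply/orP; left.
  by rewrite ltr_pdivrMr// ltr_pMr// ltr1n.
have t2 : t < d2.
  rewrite !gt_min; apply/orP; right; apply/orP; right.
  by rewrite ltr_pdivrMr// ltr_pMr// ltr1n.
have := h2 t t0 t2; rewrite ler_norml => /andP[hl _].
have inK z : 0 < z.2 -> `|z.1 - z2.1| <= t -> `|z.2 - z2.2| <= t -> g z <= g z2.
  move=> z0 zt1 zt2; apply: maxg; rewrite inE; split => //.
  have := h1 z (le_lt_trans zt1 t1) (le_lt_trans zt2 t1).
  by rewrite ltr_norml => /andP[]; lra.
have nt : `|t| = t by rewrite gtr0_norm.
have g1 := inK (z2.1 + t, z2.2) z20.
have g2 := inK (z2.1 - t, z2.2) z20.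
have g3 := inK (z2.1, z2.2 + t) ltac:(by rewrite addr_gt0).
have g4 := inK (z2.1, z2.2 - t) ltac:(by rewrite subr_gt0).
rewrite /= addrAC subrr add0r nt lexx subrr normr0 in g1.
rewrite /= addrAC subrr add0r normrN nt lexx subrr normr0 in g2.
rewrite /= subrr normr0 addrAC subrr add0r nt lexx in g3.
rewrite /= subrr normr0 addrAC subrr add0r normrN nt lexx in g4.
have {}g1 := g1 isT (ltW t0). have {}g2 := g2 isT (ltW t0).
have {}g3 := g3 (ltW t0) isT. have {}g4 := g4 (ltW t0) isT.
have tt : 0 < eta * t ^+ 2 by rewrite mulr_gt0 ?exprn_gt0.
have : lap4 w z2 t + eta * (4 * t ^+ 2) <= 0.
  have -> : lap4 w z2 t + eta * (4 * t ^+ 2) = lap4 g z2 t.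
    by rewrite /lap4 /g /nsq /=; ring.
  by rewrite /lap4; lra.
by lra.
Qed.
End MaximumPrinciple.

(** * Secular determinants *)

Section DetExpansion.
Variables (F : comNzRingType) (n : nat) (K : 'M[F]_n).

Definition principal_coef (A : {set 'I_n}) : F :=
  \det (\matrix_(i, j) if i \in A then - K i j else (i == j)%:R).

(** Each row is the sum of a row of the identity and a multiple of a row of [K];
    [A] is the set of rows where the latter is chosen. *)
Lemma det_expansion (x : 'I_n -> F) :
  \det (\matrix_(i, j) ((i == j)%:R - x i * K i j)) =
  \sum_(A : {set 'I_n}) principal_coef A * \prod_(i in A) x i.
Proof.
rewrite /determinant.
transitivity (\sum_(s : 'S_n) \sum_(A : {set 'I_n}) (-1) ^+ s *
    \prod_i (if i \in A then - K i (s i) else (i == s i)%:R) * \prod_(i in A) x i).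
  apply: eq_bigr => s _.
  under eq_bigr => i _ do rewrite mxE addrC.
  rewrite bigA_distr big_distrr /=; apply: eq_bigr => A _.
  rewrite -mulrA; congr (_ * _).
  rewrite [X in _ * X]big_mkcond -big_split /=; apply: eq_bigr => i _.
  by case: ifP => _; rewrite ?mulr1// mulNr [in RHS]mulrC.
rewrite exchange_big /=; apply: eq_bigr => A _.
rewrite -big_distrl /=; congr (_ * _); apply: eq_bigr => s _.
by congr (_ * _); apply: eq_bigr => i _; rewrite mxE.
Qed.

Lemma principal_coef0 : principal_coef finset.set0 = 1.
Proof.
transitivity (\det (1%:M : 'M[F]_n)); last exact: det1.
by congr (\det _); apply/matrixP => i j; rewrite !mxE finset.in_set0.
Qed.
End DetExpansion.

Lemma rank_diag (F : fieldType) n (d : 'rV[F]_n) :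
  \rank (diag_mx d) = #|[set j | d 0 j != 0]%SET|.
Proof.
set S := [set j | d 0 j != 0]%SET.
have vS (k : 'I_#|S|) : d 0 (enum_val k) != 0 by have := enum_valP k; rewrite inE.
apply/eqP; rewrite eqn_leq; apply/andP; split.
  have -> : diag_mx d = (\matrix_(i < n, k < #|S|) (d 0 i * (i == enum_val k)%:R)) *m
      (\matrix_(k < #|S|, j < n) (enum_val k == j)%:R).
    apply/matrixP => i j; rewrite !mxE.
    have [iS|iS] := boolP (i \in S).
      rewrite (bigD1 (enum_rank_in iS i)) //= big1 => [|k ki].
        by rewrite !mxE enum_rankK_in// eqxx mulr1 addr0 mulr_natr.
      rewrite !mxE; case: eqP => [ik|_]; last by rewrite mulr0 mul0r.
      by case/eqP: ki; apply: enum_val_inj; rewrite enum_rankK_in.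
    rewrite big1 => [|k _]; last first.
      rewrite !mxE; case: eqP => [ik|_]; last by rewrite mulr0 mul0r.
      by move: iS; rewrite ik enum_valP.
    by move: iS; rewrite inE negbK => /eqP ->; rewrite mul0rn.
  exact: mulmx_max_rank.
apply: (@mulmx1_min_rank _ _ _ _ _ (\matrix_(k < #|S|, j < n) (enum_val k == j)%:R)
  (\matrix_(i < n, k < #|S|) ((d 0 i)^-1 * (i == enum_val k)%:R))).
rewrite mul_mx_diag; apply/matrixP => k k'; rewrite !mxE.
rewrite (bigD1 (enum_val k)) //= big1 => [|j jk].
  rewrite !mxE eqxx addr0 mul1r mulrA mulfV ?vS// mul1r.
  by rewrite (inj_eq enum_val_inj).
by rewrite !mxE eq_sym (negbTE jk) !mul0r.
Qed.

Section Secular.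
Variables (R : realType) (n : nat).
Local Notation normc := Normc.normc.
Implicit Types (z : R * R) (l : 'I_n -> R) (U : 'M[R[i]]_n).
Local Open Scope sesquilinear_scope.

(** Propagation along bonds of lengths [l] with wave number [z], after the
    scattering [U]. *)
Definition bondmx l U z : 'M[R[i]]_n := \matrix_(i, j) (wave (l i) z * U i j).
Definition secular l U z : R[i] :=
  \det (\matrix_(i, j) ((i == j)%:R - wave (l i) z * U i j)).

Lemma secularE l U z : secular l U z = \det (1%:M - bondmx l U z).
Proof. by congr (\det _); apply/matrixP => i j; rewrite !mxE. Qed.

Lemma bondmxD l U z z' :
  bondmx l U (z.1 + z'.1, z.2 + z'.2) = bondmx l (bondmx l U z') z.
Proof. by apply/matrixP => i j; rewrite !mxE waveD mulrA. Qed.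

Lemma wave_real (a : R) (x : R) : wave a (x, 0) = cis (a * x).
Proof. by rewrite /wave /= mulr0 oppr0 expR0 mul1r. Qed.

Lemma bondmx_unitary l U (x : R) : U \is unitarymx ->
  bondmx l U (x, 0) \is unitarymx.
Proof.
move=> /unitarymxP UU; apply/unitarymxP.
have -> : bondmx l U (x, 0) = diag_mx (\row_i cis (l i * x)) *m U.
  by apply/matrixP => i j; rewrite mul_diag_mx !mxE wave_real.
apply/unitarymxP/mul_unitarymx; last exact/unitarymxP.
apply/unitarymxP; rewrite tr_diag_mx map_diag_mx mulmx_diag.
apply/matrixP => i j; rewrite !mxE; case: eqP => [->|//].
by rewrite -[RHS](cisVN (l j * x)) cisN.
Qed.

(** In a basis of eigenvectors of [U], the columns of [1 - bondmx l U z] for the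
    eigenvalue 1 are divisible by [z].  The quotient at 0 is invertible because
    the derivative of the phases is the positive definite matrix of the lengths. *)
Lemma secular_vanishing l U : U \is unitarymx -> (forall i, 0 < l i) ->
  exists q : R * R -> R[i], [/\ ccont q (0, 0), q (0, 0) != 0 &
    forall z, secular l U z = (z.1 +i* z.2) ^+ (n - \rank (1%:M - U)) * q z].
Proof.
move=> uU l0.
have /orthomx_spectralP : U \is normalmx.
  by apply/normalmxP; rewrite (unitarymxP uU); apply/esym/mulmx1C/unitarymxP.
set P := spectralmx U; set d := spectral_diag U => Ud.
have Pu : P \in unitmx by exact: spectral_unit.
have PP : P \is unitarymx by exact: spectral_unitarymx.
pose X z : 'M[R[i]]_n := P *m diag_mx (\row_i wave_slope (l i) z) *m invmx P.
pose w z : R[i] := z.1 +i* z.2.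
pose Q z : 'M[R[i]]_n := \matrix_(i, j)
  if d 0 j == 1 then - X z i j else (i == j)%:R * (1 - d 0 j) - w z * X z i j * d 0 j.
have cX i j : ccont (fun z => X z i j) (0, 0).
  rewrite /X; apply: (ccont_ext (f := fun z => \sum_k P i k * wave_slope (l k) z * invmx P k j)).
    move=> z; rewrite !mxE; apply: eq_bigr => k _.
    by rewrite mul_mx_diag !mxE.
  apply: ccont_sum => k _; apply: ccontM; last exact: ccont_cst.
  by apply: ccontM; [exact: ccont_cst|exact: ccont_wave_slope].
have cw : ccont w (0, 0) by split; [exact: cvg_fst|exact: cvg_snd].
have cQ i j : ccont (fun z => Q z i j) (0, 0).
  apply: (ccont_ext (f := fun z => if d 0 j == 1 then - X z i j else
     (i == j)%:R * (1 - d 0 j) - w z * X z i j * d 0 j)) => [z|]; first by rewrite [RHS]mxE.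
  case: (d 0 j == 1); first exact: ccontN.
  apply: ccontD; first exact: ccont_cst.
  by apply: ccontN; apply: ccontM; [exact: ccontM|exact: ccont_cst].
(* Q is the matrix after this division, in the basis of eigenvectors. *)
exists (fun z => \det (Q z)); split.
- exact: ccont_det.
- apply/det0P => -[v v0 vQ].
  have vd j : d 0 j != 1 -> v 0 j = 0.
    move=> dj; have := congr1 (fun A : 'rV_n => A 0 j) vQ.
    rewrite !mxE (bigD1 j) //= big1 => [|i ij].
      rewrite mxE (negbTE dj) eqxx mul1r /w /=.
      rewrite -[0 +i* 0]/(0 : R[i]) !mul0r subr0 addr0 => /eqP; rewrite mulf_eq0 subr_eq0.
      by rewrite [1 == _]eq_sym (negbTE dj) orbF => /eqP.
    by rewrite mxE (negbTE dj) (negbTE ij) /w /= -[0 +i* 0]/(0 : R[i]) !mul0r subr0 mulr0.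
  have vX j : d 0 j == 1 -> (v *m X (0, 0)) 0 j = 0.
    move=> dj; have := congr1 (fun A : 'rV_n => A 0 j) vQ.
    rewrite mxE [RHS]mxE => h; transitivity (- \sum_i v 0 i * Q (0, 0) i j); last by rewrite h oppr0.
    rewrite mxE -sumrN; apply: eq_bigr => i _.
    by rewrite [Q _ _ _]mxE dj mulrN opprK.
  pose u := v *m P.
  have : (v *m X (0, 0) *m v ^t*) 0 0 = 0.
    rewrite mxE big1 // => j _; have [dj|dj] := boolP (d 0 j == 1).
      by rewrite vX// mul0r.
    by rewrite !mxE vd// conjC0 mulr0.
  have -> : v *m X (0, 0) *m v ^t* = u *m diag_mx (\row_i ('i%C * (l i)%:C)) *m u ^t*.
    have DE : diag_mx (\row_i wave_slope (l i) (0, 0)) = diag_mx (\row_i ('i%C * (l i)%:C)).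
      by congr diag_mx; apply/rowP => i; rewrite !mxE /wave_slope /= eqxx.
    rewrite /X invmx_unitary// DE /u trmx_mul map_mxM; move: (diag_mx _) => D.
    by rewrite !mulmxA.
  have vu : v = u *m invmx P by rewrite mulmxK.
  clearbody u.
  have -> : (u *m diag_mx (\row_i ('i%C * (l i)%:C)) *m u ^t*) 0 0 =
     'i%C * (\sum_i l i * sqmod (u 0 i))%:C.
    rewrite mxE rmorph_sum /= mulr_sumr; apply: eq_bigr => i _.
    rewrite mul_mx_diag !mxE mulrAC [u 0 i * _]mulrC.
    by apply: complexP; rewrite /sqmod; case: (u 0 i) => a b; rewrite /=; ring.
  (* A kernel vector of Q at 0 has length zero in the norm weighted by l. *)
  move/(congr1 (@complex.Im R)) => /=; rewrite mul0r mul1r add0r => s0.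
  have u0 : u = 0.
    apply/rowP => i; rewrite mxE; apply/eqP; rewrite -sqmod_eq0.
    have := s0 => /eqP; rewrite psumr_eq0 => [/allP/(_ i)|j _].
      by rewrite mem_index_enum mulf_eq0 gt_eqF// => /(_ isT).
    by rewrite mulr_ge0 ?(ltW (l0 j))// addr_ge0 ?sqr_ge0.
  by move/eqP: v0; apply; rewrite vu u0 mul0mx.
- move=> z; rewrite secularE.
  have EU : bondmx l U z = (1%:M + w z *: diag_mx (\row_i wave_slope (l i) z)) *m U.
    apply/matrixP => i j; rewrite mulmxDl mul1mx -scalemxAl mul_diag_mx !mxE.
    by rewrite wave_slopeE mulrDl mul1r mulrA.
  have QE : P *m (1%:M - bondmx l U z) *m invmx P =
      Q z *m diag_mx (\row_j (if d 0 j == 1 then w z else 1)).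
    have PUP : P *m U *m invmx P = diag_mx d.
      by rewrite [X in P *m X]Ud !mulmxA mulmxV// mul1mx -mulmxA mulmxV// mulmx1.
    have PSUP : P *m (diag_mx (\row_i wave_slope (l i) z) *m U) *m invmx P =
        X z *m diag_mx d.
      by rewrite -PUP /X !mulmxA mulmxKV.
    rewrite mulmxBr mulmxBl mulmx1 mulmxV// EU mulmxDl mul1mx mulmxDr mulmxDl PUP.
    rewrite -scalemxAl -scalemxAr -scalemxAl PSUP !mul_mx_diag.
    rewrite /Q; move: (X z) => Y; apply/matrixP => i j; rewrite !mxE.
    case: (i =P j) => [->|_]; case: (d 0 j =P 1) => [->|_];
      rewrite ?mulr1n ?mulr0n; ring.
  have -> : \det (1%:M - bondmx l U z) = \det (P *m (1%:M - bondmx l U z) *m invmx P).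
    by rewrite !det_mulmx det_inv mulrAC mulfV ?mul1r// -unitfE -unitmxE.
  rewrite QE det_mulmx det_diag mulrC; congr (_ * _).
  under eq_bigr => j _ do rewrite mxE.
  rewrite -big_mkcond /= prodr_const; congr (_ ^+ _).
  have -> : \rank (1%:M - U) = #|[set j | d 0 j != 1]%SET|.
    have -> : 1%:M - U = invmx P *m diag_mx (\row_j (1 - d 0 j)) *m P.
      have -> : diag_mx (\row_j (1 - d 0 j)) = 1%:M - diag_mx d.
        by apply/matrixP => i j; rewrite !mxE -mulrnBl.
      by rewrite mulmxBr mulmxBl mulmx1 mulVmx// -Ud.
    rewrite mxrankMfree ?row_free_unit// -mxrank_tr trmx_mul mxrankMfree; last first.
      by rewrite row_free_unit unitmx_tr unitmx_inv.
    rewrite mxrank_tr rank_diag; congr #|pred_of_set _|; apply/setP => j.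
    by rewrite !inE mxE subr_eq0 eq_sym.
  pose J : pred 'I_n := [pred j : 'I_n | d 0 j == 1].
  set J' := [set j | d 0 j != 1]%SET.
  have c : (#|J| + #|J'|)%N = n.
    rewrite -[RHS](card_ord n) -(cardC J); congr addn.
    by apply: eq_card => j; rewrite !inE.
  by rewrite -[X in (X - _)%N]c addnK; apply: eq_card => j; rewrite !inE.
Qed.
End Secular.

(** * Secular functions in the upper half plane *)

Section SecularBasics.
Variables (R : realType) (n : nat).
Local Notation normc := Normc.normc.
Implicit Types (z : R * R) (l : 'I_n -> R) (U : 'M[R[i]]_n).
Local Open Scope sesquilinear_scope.

Lemma sum_sqmod (v : 'cV[R[i]]_n) :
  (v ^t* *m v) 0 0 = (\sum_i sqmod (v i 0))%:C.
Proof.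
rewrite mxE rmorph_sum /=; apply: eq_bigr => i _; rewrite !mxE.
by apply: complexP; rewrite /sqmod; case: (v i 0) => a b; rewrite /=; ring.
Qed.

Lemma unitary_sum_sqmod U (v : 'cV[R[i]]_n) : U \is unitarymx ->
  \sum_i sqmod ((U *m v) i 0) = \sum_i sqmod (v i 0).
Proof.
move=> /unitarymxP/mulmx1C UU; apply: (@complexI R).
by rewrite -!sum_sqmod trmx_mul map_mxM -mulmxA (mulmxA (U ^t*)) UU mul1mx.
Qed.

Lemma sqmod_wave (a : R) z : sqmod (wave a z) = expR (- (a * z.2)) ^+ 2.
Proof.
rewrite /wave sqmodM -[RHS]mulr1; congr (_ * _); rewrite /sqmod /=.
  by rewrite expr0n addr0.
exact: cos2Dsin2.
Qed.

(** For [Im z > 0] the propagation is a strict contraction. *)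
Lemma secular_accretive l U z : U \is unitarymx -> (forall i, 0 < l i) ->
  0 < z.2 -> accretive (1%:M - bondmx l U z).
Proof.
move=> uU l0 z0 v v0; pose y := U *m v.
have UU : U ^t* *m U = 1%:M by apply: mulmx1C; apply/unitarymxP.
have yE := unitary_sum_sqmod v uU.
have By i : (bondmx l U z *m v) i 0 = wave (l i) z * y i 0.
  by rewrite !mxE mulr_sumr; apply: eq_bigr => j _; rewrite mxE mulrA.
have w1 i : sqmod (wave (l i) z) < 1.
  rewrite sqmod_wave expr_lt1 ?expR_ge0// -expR0 ltr_expR oppr_lt0.
  exact: mulr_gt0.
have pos : 0 < \sum_i (1 - sqmod (wave (l i) z)) * sqmod (y i 0).
  rewrite lt_neqAle; apply/andP; split; last first.
    by apply: sumr_ge0 => i _; rewrite mulr_ge0 ?subr_ge0 ?sqmod_ge0 ?ltW.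
  apply: contra v0; rewrite eq_sym psumr_eq0 => [/allP h|i _]; last first.
    by rewrite mulr_ge0 ?sqmod_ge0 ?subr_ge0 ?(ltW (w1 _)).
  apply/eqP; rewrite -[v]mul1mx -UU -mulmxA -/y.
  suff -> : y = 0 by rewrite mulmx0.
  apply/colP => i; rewrite [RHS]mxE; apply/eqP; rewrite -sqmod_eq0.
  have := h i; rewrite mem_index_enum => /(_ isT).
  by rewrite mulf_eq0 subr_eq0 eq_sym lt_eqF.
rewrite Re_sum.
have -> : \sum_i Re ((v i 0)^* * ((1%:M - bondmx l U z) *m v) i 0) =
    \sum_i (sqmod (v i 0) - Re ((v i 0)^* * (wave (l i) z * y i 0))).
  apply: eq_bigr => i _; rewrite mulmxBl mul1mx 2!mxE By mulrBr ReD ReN; congr (_ - _).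
  by rewrite /sqmod; case: (v i 0) => a b /=; ring.
apply: lt_le_trans (_ : 1 / 2 * (\sum_i (1 - sqmod (wave (l i) z)) * sqmod (y i 0)) <= _).
  by rewrite mulr_gt0// divr_gt0.
have -> : \sum_i (1 - sqmod (wave (l i) z)) * sqmod (y i 0) =
    \sum_i (sqmod (v i 0) - sqmod (wave (l i) z * y i 0)).
  rewrite sumrB -yE -sumrB; apply: eq_bigr => i _.
  by rewrite sqmodM mulrBl mul1r.
rewrite mulr_sumr; apply: ler_sum => i _.
move: (v i 0) (wave _ _ * _) => [a b] [c d]; rewrite /sqmod /=.
by have := sqr_ge0 (a - c); have := sqr_ge0 (b - d); rewrite !expr2; lra.
Qed.

Lemma secular_neq0 l U z : U \is unitarymx -> (forall i, 0 < l i) ->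
  0 < z.2 -> secular l U z != 0.
Proof.
by move=> uU l0 z0; rewrite secularE accretive_det_neq0//; exact: secular_accretive.
Qed.

Lemma ccont_secular l U z : ccont (secular l U) z.
Proof.
apply: ccont_det => i j.
apply: (ccont_ext (f := fun z => (i == j)%:R - wave (l i) z * U i j)) => [y|].
  by rewrite mxE.
apply: ccontD; first exact: ccont_cst.
by apply: ccontN; apply: ccontM; [exact: ccont_wave|exact: ccont_cst].
Qed.

Lemma jet2_secular l U z : jet2 (secular l U) z.
Proof.
apply: jet2_det => i j.
apply: (jet2_ext (G := fun z => (i == j)%:R + wave (l i) z * (- U i j))) => [y|].
  by rewrite mxE mulrN.
apply: jet2D; first exact: jet2_cst.
by apply: jet2M; [exact: jet2_wave|exact: jet2_cst].
Qed.

(** The bound is uniform over the half plane; it is what makes the maximum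
    principle applicable to differences of arguments. *)
Lemma secular_arg l U : U \is unitarymx -> (forall i, 0 < l i) ->
  exists u : R * R -> R, forall z, 0 < z.2 ->
    [/\ {for z, continuous u}, `|u z| <= n%:R * pi, ray (secular l U z) (u z) & flat u z].
Proof.
move=> uU l0.
have [|z z0|u hu] := @arg_of_accretive R (R * R)%type [set z | 0 < z.2] n
    (fun z => 1%:M - bondmx l U z).
- move=> z _ i j.
  apply: (ccont_ext (f := fun z => (i == j)%:R - wave (l i) z * U i j)) => [y|].
    by rewrite !mxE.
  apply: ccontD; first exact: ccont_cst.
  by apply: ccontN; apply: ccontM; [exact: ccont_wave|exact: ccont_cst].
- exact: secular_accretive.
exists u => z z0; have [cu bu ru] := hu z z0; split => //; first by rewrite secularE.
apply: (flat_ray (g := secular l U)) => //.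
  by apply: jet2_cflat; [exact: secular_neq0|exact: jet2_secular].
exists z.2 => // y _ y2; rewrite secularE; have [//|_ _ //] := hu y.
by move: y2; rewrite ltr_norml /= => /andP[]; lra.
Qed.

Lemma det_bondmx_real l U (x : R) :
  \det (- bondmx l U (x, 0)) = \det (- U) * cis ((\sum_i l i) * x).
Proof.
have -> : - bondmx l U (x, 0) = diag_mx (\row_i cis (l i * x)) *m (- U).
  by apply/matrixP => i j; rewrite mul_diag_mx !mxE wave_real mulrN.
rewrite det_mulmx det_diag mulrC; congr (_ * _).
by rewrite mulr_suml cis_sum; apply: eq_bigr => i _; rewrite mxE.
Qed.

(** The functional equation: [det (1 - B)] is [det (- B)] times the determinant
    of the adjoint of [1 - B] when [B] is unitary. *)
Lemma secular_real l U (x : R) : U \is unitarymx ->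
  secular l U (x, 0) =
  \det (- U) * cis ((\sum_i l i) * x) * conjc (secular l U (x, 0)).
Proof.
move=> uU; rewrite -det_bondmx_real secularE; set B := bondmx l U (x, 0).
have uB : B \is unitarymx by exact: bondmx_unitary.
have BB : B ^t* *m B = 1%:M by apply: mulmx1C; apply/unitarymxP.
rewrite -[RHS]mulrC.
have -> : conjc (\det (1%:M - B)) = \det ((1%:M - B) ^t*).
  rewrite -det_tr -[LHS]/(Num.conj _) -det_map_mx; congr (\det _).
by rewrite -det_mulmx; congr (\det _);
  rewrite linearB map_mxB /= trmx1 map_mx1 mulmxN mulmxBl mul1mx
   BB opprB.
Qed.

(** In [det_expansion] all terms but the one of the empty set decay. *)
Lemma secular_infty l U : U \is unitarymx -> (forall i, 0 < l i) ->
  forall e : R, 0 < e -> exists2 k : R, 0 < k & forall z, k < z.2 ->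
    normc (secular l U z - 1) <= e.
Proof.
move=> uU l0 e e0.
pose d : R := \big[Num.min/1]_i l i.
have d0 : 0 < d by apply: lt_bigmin.
have dl i : d <= l i by apply: bigmin_le_cond.
pose C : R := \sum_(A : {set 'I_n}) normc (principal_coef U A).
have C0 : 0 <= C by apply: sumr_ge0 => A _; exact: normc_ge0.
exists (C / (e * d) + 1) => [|z zk].
  by rewrite ltr_wpDl// divr_ge0// mulr_ge0// ltW.
have z0 : 0 < z.2 by apply: lt_trans zk; rewrite ltr_wpDl// divr_ge0// mulr_ge0// ltW.
rewrite /secular det_expansion (bigD1 finset.set0) //= principal_coef0 big_set0.
rewrite mul1r addrAC subrr add0r.
have nsum (I : Type) (r : seq I) (P : pred I) (F : I -> R[i]) :
    normc (\sum_(i <- r | P i) F i) <= \sum_(i <- r | P i) normc (F i).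
  elim/big_rec2: _ => [|i y1 y2 _ h]; first by rewrite Normc.normc0.
  by rewrite (le_trans (le_normcD _ _))// lerD2l.
have nw (a : R) : normc (wave a z) = expR (- (a * z.2)).
  rewrite /wave Normc.normcM normc_real ger0_norm ?expR_ge0//.
  by rewrite /= cos2Dsin2 sqrtr1 mulr1.
have nwle i : normc (wave (l i) z) <= expR (- (d * z.2)).
  by rewrite nw ler_expR lerN2 ler_pM2r.
have nw1 i : normc (wave (l i) z) <= 1.
  by rewrite (le_trans (nwle i))// -expR0 ler_expR oppr_le0 mulr_ge0// ltW.
have nprod (A : {set 'I_n}) : A != finset.set0 ->
    normc (\prod_(i in A) wave (l i) z) <= expR (- (d * z.2)).
  case/set0Pn => i iA; rewrite (bigD1 i) //= Normc.normcM -[leRHS]mulr1.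
  apply: ler_pM; rewrite ?normc_ge0//.
  elim/big_rec: _ => [|j y _ h]; first by rewrite Normc.normc1.
  by rewrite Normc.normcM mulr_ile1 ?normc_ge0.
rewrite (le_trans (nsum _ _ _ _))//.
apply: le_trans (_ : \sum_(A : {set 'I_n}) normc (principal_coef U A) * expR (- (d * z.2)) <= _).
  rewrite [leRHS](bigD1 finset.set0) //= ler_wpDl ?mulr_ge0 ?normc_ge0 ?expR_ge0//.
  by apply: ler_sum => A A0; rewrite Normc.normcM ler_wpM2l ?normc_ge0 ?nprod.
rewrite -mulr_suml -/C expRN ler_pdivrMr ?expR_gt0//.
have h : C <= e * (d * z.2).
  have : C / (e * d) <= z.2 by lra.
  by rewrite ler_pdivrMr ?mulr_gt0// mulrC mulrA.
apply: (le_trans h); rewrite ler_pM2l//.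
by have := expR_ge1Dx (d * z.2); lra.
Qed.
End SecularBasics.

(** * Continuous arguments and their boundary values *)

Section RatioBoundary.
Variable R : realType.
Implicit Types (z p : R * R) (S : set (R * R)).

(** By the intermediate value theorem, a variation of [f] along the segment would
    entail a nonzero variation by less than 2 pi. *)
Lemma cis_const_segment (f : R * R -> R) S z z' :
  (forall t : R, 0 <= t <= 1 ->
     S (z.1 + t * (z'.1 - z.1), z.2 + t * (z'.2 - z.2))) ->
  (forall p, S p -> {for p, continuous f}) ->
  (forall p p', S p -> S p' -> cis (f p) = cis (f p')) ->
  f z = f z'.
Proof.
move=> Sz cf ce.
pose g (t : R) : R * R := (z.1 + t * (z'.1 - z.1), z.2 + t * (z'.2 - z.2)).
have g0 : g 0 = z by rewrite [RHS]surjective_pairing /g; congr (_, _); ring.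
have g1 : g 1 = z' by rewrite [RHS]surjective_pairing /g; congr (_, _); ring.
have cg t : {for t, continuous g}.
  apply/cvgrPdist_lt => e e0.
  pose K : R := `|z'.1 - z.1| + `|z'.2 - z.2| + 1.
  have K0 : 0 < K by rewrite ltr_wpDl ?addr_ge0.
  near=> s.
  have st : `|t - s| < e / K.
    by near: s; apply: cvgr_dist_lt; rewrite ?divr_gt0//; exact: cvg_id.
  have bnd (a b : R) : `|b| < K -> `|a + t * b - (a + s * b)| < e.
    move=> bK; have -> : a + t * b - (a + s * b) = (t - s) * b by ring.
    rewrite normrM; have [->|b0] := eqVneq b 0; first by rewrite normr0 mulr0.
    rewrite (lt_le_trans (_ : _ < e / K * `|b|))// ?ltr_pM2r ?normr_gt0//.
    by rewrite mulrAC ler_pdivrMr// ler_pM2l// ltW.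
  rewrite prod_normE /= gt_max; apply/andP; split; apply: bnd; rewrite /K.
    by have := normr_ge0 (z'.2 - z.2); lra.
  by have := normr_ge0 (z'.1 - z.1); lra.
apply/eqP/negPn/negP => fne.
wlog lt : f cf ce fne / f z < f z'.
  move=> W; move: fne; rewrite neq_lt => /orP[lt|lt].
    by apply: (W f) => //; rewrite lt_eqF.
  apply: (W (fun p => - f p)).
  - by move=> p Sp; apply: continuousN; exact: cf.
  - by move=> p p' Sp Sp'; rewrite !cisN (ce p p').
  - by rewrite eqr_opp eq_sym lt_eqF.
  - by rewrite ltrN2.
pose d : R := Num.min (f z' - f z) pi.
have d0 : 0 < d by rewrite lt_min subr_gt0 lt pi_gt0.
have cfg : {within `[0, 1], continuous (f \o g)}.
  apply: continuous_in_subspaceT => t; rewrite inE /= in_itv /= => t01.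
  by apply: (continuous_comp (cg t)); apply: cf; exact: Sz.
have v01 : Num.min ((f \o g) 0) ((f \o g) 1) <= f z + d <=
    Num.max ((f \o g) 0) ((f \o g) 1).
  rewrite /= g0 g1 (min_idPl (ltW lt)) (max_idPr (ltW lt)) lerDl (ltW d0) /=.
  by rewrite -lerBrDl ge_min lexx.
have [t] := IVT ler01 cfg v01.
rewrite in_itv /= => t01 ft.
have := ce _ _ (Sz t t01) (Sz 0 ltac:(by rewrite lexx ler01)).
rewrite -/(g t) -/(g 0) g0 ft cisD => /eqP.
rewrite -[X in _ == X]mulr1 (inj_eq (mulfI (cis_neq0 _))) => /eqP cd.
have := @cis_eq1 R d; rewrite cd gtr0_norm// => h.
move: d0; rewrite h ?ltxx//.
have := pi_gt0 R => pi0; rewrite (@le_lt_trans _ _ pi)//; first by rewrite ge_min lexx orbT.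
by lra.
Unshelve. all: by end_near.
Qed.

(** The argument in the open upper half plane. *)
Definition argz z : R := pi / 2 + atan (- z.1 / z.2).

Lemma ray_argz z : 0 < z.2 -> ray (z.1 +i* z.2) (argz z).
Proof.
move=> z0; have ri : ray ('i%C : R[i]) (pi / 2).
  exists 1 => //; apply: complexP; rewrite ?ReM ?ImM /= ?cos_pihalf ?sin_pihalf; ring.
have := rayM ri (@ray_atan R (z.2 -i* z.1) z0); congr ray.
by apply: complexP; rewrite ?ReM ?ImM /=; ring.
Qed.

Lemma argz_bounds z : 0 < argz z < pi.
Proof.
have := atan_gtNpi2 (- z.1 / z.2); have := atan_ltpi2 (- z.1 / z.2); rewrite /argz.
by move=> *; apply/andP; split; lra.
Qed.

Lemma continuous_argz z : 0 < z.2 -> {for z, continuous argz}.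
Proof.
move=> z0; apply: continuousD; first exact: cvg_cst.
have c : {for z, continuous (fun z : R * R => - z.1 / z.2)}.
  apply: continuousM; first by apply: continuousN; exact: cvg_fst.
  by apply: continuousV; [rewrite gt_eqF|exact: cvg_snd].
exact: (continuous_comp c (@continuous_atan R _)).
Qed.

Lemma flat_argz z : 0 < z.2 -> flat argz z.
Proof.
move=> z0; apply: (flat_ray (g := fun z => z.1 +i* z.2 + 0)).
- apply: jet2_cflat; last exact: jet2_id.
  by rewrite addr0; exact: (ray_neq0 (ray_argz z0)).
- exact: continuous_argz.
exists z.2 => // y _; rewrite ltr_norml => /andP[? _].
by rewrite addr0; apply: ray_argz; lra.
Qed.

Lemma argz_right z : 0 < z.1 -> 0 < z.2 -> argz z = atan (z.2 / z.1).
Proof.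
move=> x0 y0; have r1 := ray_argz y0; have r2 := @ray_atan R (z.1 +i* z.2) x0.
apply/eqP; rewrite -subr_eq0; apply/eqP/cis_eq1; last first.
  by rewrite cisD (ray_uniq r1 r2) cisVN.
have /andP[? ?] := argz_bounds z; have := pi_gt0 R.
have := atan_gtNpi2 (z.2 / z.1); have := atan_ltpi2 (z.2 / z.1).
by move=> *; rewrite /= ltr_norml; apply/andP; split; lra.
Qed.

Lemma argz_left z : z.1 < 0 -> 0 < z.2 -> argz z = pi + atan (z.2 / z.1).
Proof.
move=> x0 y0; have r1 := ray_argz y0.
have := @ray_atan R (- (z.1 +i* z.2)); rewrite /= oppr_gt0 => /(_ x0).
rewrite mulNr invrN mulrN opprK => r2.
have rpi : ray (-1 : R[i]) pi.
  by exists 1 => //; apply: complexP; rewrite ?ReM ?ImM /= ?cospi ?sinpi; ring.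
have r3 := rayM rpi r2; rewrite mulN1r opprK in r3.
apply/eqP; rewrite -subr_eq0; apply/eqP/cis_eq1; last first.
  by rewrite cisD (ray_uniq r1 r3) cisVN.
have /andP[? ?] := argz_bounds z; have := pi_gt0 R.
have := atan_gtNpi2 (z.2 / z.1); have := atan_ltpi2 (z.2 / z.1).
by move=> *; rewrite /= ltr_norml; apply/andP; split; lra.
Qed.

Lemma argz_boundary (x : R) : x != 0 -> forall e : R, 0 < e ->
  exists2 d : R, 0 < d & forall z, 0 < z.2 -> `|z.1 - x| < d -> z.2 < d ->
    `|argz z - (if 0 < x then 0 else pi)| <= e.
Proof.
move=> x0 e e0; have nx : 0 < `|x| by rewrite normr_gt0.
pose d : R := Num.min (`|x| / 2) (Num.min 1 e * (`|x| / 2)).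
have m0 : 0 < Num.min 1 e by rewrite lt_min ltr01.
have d0 : 0 < d by rewrite lt_min ?mulr_gt0 ?divr_gt0.
exists d => // z z20 z1 z2.
have dx : d <= `|x| / 2 by rewrite ge_min lexx.
have de : d <= Num.min 1 e * (`|x| / 2) by rewrite ge_min lexx orbT.
have zx : `|x| / 2 <= `|z.1|.
  have := ler_normB z.1 (z.1 - x); rewrite subKr; lra.
have q : `|z.2 / z.1| <= Num.min 1 e.
  rewrite normrM normfV ler_pdivrMr; last by lra.
  rewrite gtr0_norm//; apply: (le_trans (ltW z2)); apply: (le_trans de).
  by rewrite ler_pM2l.
have aq : `|atan (z.2 / z.1)| <= e.
  by rewrite (le_trans (atan_bound _))// (le_trans q)// ge_min lexx// orbT.
case: ltP => [xp|xn].
  rewrite subr0 argz_right//.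
  by move: z1; rewrite ltr_norml (gtr0_norm xp) in dx *; move=> /andP[? ?]; lra.
have xn' : x < 0 by rewrite lt_neqAle x0.
have z1n : z.1 < 0.
  by move: z1; rewrite ltr_norml (ltr0_norm xn') in dx *; move=> /andP[? ?]; lra.
by rewrite argz_left// addrAC subrr add0r.
Qed.

End RatioBoundary.

(** * Secular functions with the same real zeros *)

(** Here c + i si is, up to a positive factor, the quotient of X + iY by p + is,
    and both of these are close to 1. *)
Lemma polar_close (R : realType) (r p s c si X Y e : R) :
  0 < r -> 0 < e -> e <= 1 / 4 -> c <= 1 ->
  c * (r * (p ^+ 2 + s ^+ 2)) = X * p + Y * s ->
  si * (r * (p ^+ 2 + s ^+ 2)) = Y * p - X * s ->
  `|p - 1| <= e -> `|s| <= e -> `|X - 1| <= e -> `|Y| <= e ->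
  `|si| <= 8 * e /\ 0 < c.
Proof.
move=> r0 e0 e1 c1; set T := r * _ => F1 F2.
have le (x : R) : `|x - 1| <= e -> 3 / 4 <= x /\ `|x| <= 5 / 4.
  by rewrite !ler_norml => /andP[? ?]; split; [|apply/andP; split]; lra.
move=> /le[p1 p2] s1 /le[X1 X2] Y1.
have T0 : 0 < T by rewrite mulr_gt0// ltr_pwDl ?sqr_ge0// exprn_gt0//; lra.
have Xp : 9 / 16 <= X * p.
  have : 0 <= (X - 3 / 4) * (p - 3 / 4) by rewrite mulr_ge0// subr_ge0.
  clear -p1 X1; lra.
have Ys : `|Y * s| <= e * (1 / 4) by rewrite normrM ler_pM// (le_trans s1).
have cT : 1 / 2 <= c * T.
  rewrite F1; move: Ys; rewrite ler_norml => /andP[? _]; lra.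
have cp : 0 < c by rewrite -(pmulr_lgt0 _ T0); lra.
split => //.
have T2 : 1 / 2 <= T by apply: (le_trans cT); rewrite ler_piMl// ltW.
have b1 : `|Y * p| <= e * (5 / 4) by rewrite normrM ler_pM.
have b2 : `|X * s| <= (5 / 4) * e by rewrite normrM ler_pM.
have b3 : `|si| * T <= 5 / 2 * e.
  rewrite -[T in X in X <= _]gtr0_norm// -normrM F2 (le_trans (ler_normB _ _))//.
  clear -b1 b2; lra.
have : `|si| * (1 / 2) <= `|si| * T by rewrite ler_wpM2l.
by clear -b3 e0; lra.
Qed.

Section RatioPositive.
Variable R : realType.
Local Notation normc := Normc.normc.
Implicit Types (z : R * R).

Lemma ccont_zero_limit (f : R * R -> R[i]) : ccont f (0, 0) ->
  (forall x : R, x != 0 -> f (x, 0) = 0) -> f (0, 0) = 0.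
Proof.
move=> [c1 c2] f0.
suff h (g : R * R -> R) : {for (0, 0), continuous g} ->
    (forall x : R, x != 0 -> g (x, 0) = 0) -> g (0, 0) = 0.
  by apply: complexP; [apply: (h (fun z => Re (f z)))|apply: (h (fun z => Im (f z)))] => // x x0;
     rewrite f0.
move=> cg g0; apply/eqP; rewrite -normr_eq0; apply/eqP/le_anti.
rewrite normr_ge0 andbT leNgt; apply/negP => p0.
have [d d0 h] := (contP _ _).1 cg _ p0.
have d2 : 0 < d / 2 by rewrite divr_gt0.
have := h (d / 2, 0); rewrite /= !subr0 normr0 (gtr0_norm d2) g0 ?gt_eqF// sub0r normrN ltxx.
have dd : d / 2 < d by rewrite ltr_pdivrMr// ltr_pMr// ltr1n.
by move=> /(_ dd d0).
Qed.

(** Near a real point [x], translating [z] by [x] changes the scattering matrix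
    only, so that [secular_vanishing] describes the zero at [x].  The functional
    equation determines the argument of the leading coefficient modulo pi. *)
Lemma secular_germ n (l : 'I_n -> R) (U : 'M[R[i]]_n) (x : R) :
  U \is unitarymx -> (forall i, 0 < l i) ->
  exists q : R * R -> R[i], [/\ ccont q (0, 0), q (0, 0) != 0,
    q (0, 0) = \det (- U) * cis ((\sum_i l i) * x) * conjc (q (0, 0)) &
    forall z, secular l U z = ((z.1 - x) +i* z.2) ^+
      (n - \rank (1%:M - bondmx l U (x, 0))) * q (z.1 - x, z.2)].
Proof.
move=> uU l0; set B := bondmx l U (x, 0).
have uB : B \is unitarymx by exact: bondmx_unitary.
have [q [cq q0 qE]] := secular_vanishing uB l0.
set m := (n - _)%N in qE *; exists q; split => //.
- apply/eqP; rewrite -subr_eq0; apply/eqP.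
  pose L := \sum_i l i.
  pose g z := q z - \det (- B) * cis (L * z.1) * conjc (q z).
  have : g (0, 0) = 0.
    apply: ccont_zero_limit => [|y y0].
      apply: (ccontD cq); apply: ccontN; apply: ccontM; last exact: ccont_conj.
      apply: ccontM; first exact: ccont_cst.
      by apply: ccont_cis; apply: continuousM; [exact: cvg_cst|exact: cvg_fst].
    apply/eqP; rewrite /g subr_eq0; apply/eqP => /=.
    have ym : (y%:C : R[i]) ^+ m != 0.
      by rewrite expf_neq0//; apply/eqP => -[] /eqP; rewrite (negbTE y0).
    have cY : conjc ((y%:C : R[i]) ^+ m) = y%:C ^+ m.
      by rewrite rmorphXn; congr (_ ^+ m); exact: conjc_real.
    have := secular_real l y uB; rewrite qE -/L -[(y, 0).1]/y -[(y, 0).2]/0.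
    have cM (c d : R[i]) : conjc (c * d) = conjc c * conjc d by exact: rmorphM.
    by rewrite -[y +i* 0]/(y%:C) cM cY mulrCA => /(mulfI ym).
  by rewrite /g /= mulr0 cis0 mulr1 /B det_bondmx_real.
- move=> z; rewrite -(qE (z.1 - x, z.2)) !secularE -bondmxD /= subrK addr0.
  by case: z.
Qed.

Section TwoSystems.
Variables (n n' : nat) (l : 'I_n -> R) (l' : 'I_n' -> R).
Variables (U : 'M[R[i]]_n) (U' : 'M[R[i]]_n').
Hypotheses (uU : U \is unitarymx) (uU' : U' \is unitarymx).
Hypotheses (l0 : forall i, 0 < l i) (l'0 : forall i, 0 < l' i).
Hypothesis same_zeros : forall x : R, x != 0 ->
  (n - \rank (1%:M - bondmx l U (x, 0))%R)%N =
  (n' - \rank (1%:M - bondmx l' U' (x, 0))%R)%N.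

Let Q z := secular l U z / secular l' U' z.
Let dL := \sum_i l i - \sum_i l' i.
Let c0 := \det (- U) / \det (- U').

Let ccontQ z : 0 < z.2 -> ccont Q z.
Proof.
move=> z0; apply: ccontM; first exact: ccont_secular.
by apply: ccontV; [exact: secular_neq0|exact: ccont_secular].
Qed.

Let detU' : \det (- U') != 0.
Proof.
rewrite -[- U']scaleN1r detZ mulf_neq0 ?expf_neq0 ?oppr_eq0 ?oner_eq0//.
by rewrite -unitfE -unitmxE unitarymx_unit.
Qed.

(** The zeros of the two secular functions at [x] have the same order, so that
    their ratio has a nonzero limit there, whose argument is known modulo pi
    from the functional equations. *)
Lemma ratio_boundary (u : R * R -> R) (x : R) :
  (forall z, 0 < z.2 -> {for z, continuous u}) ->
  (forall z, 0 < z.2 -> ray (Q z) (u z)) -> x != 0 ->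
  exists A : R, ray c0 (2 * A - dL * x) /\
    forall e : R, 0 < e -> exists2 d : R, 0 < d & forall z, 0 < z.2 ->
      `|z.1 - x| < d -> z.2 < d -> `|u z - A| < e.
Proof.
move=> cu ru x0.
have [q [cq q0 qf qE]] := secular_germ x uU l0.
have [q' [cq' q'0 qf' qE']] := secular_germ x uU' l'0.
pose Q0 := q (0, 0) / q' (0, 0).
have Q00 : Q0 != 0 by rewrite mulf_neq0// invr_eq0.
pose h z := q z / q' z / Q0.
have ch : ccont h (0, 0).
  by apply: ccontM; [apply: (ccontM cq); exact: ccontV|exact: ccont_cst].
have h0 : h (0, 0) = 1 by rewrite /h mulfV.
have hQ z : 0 < z.2 -> Q z / Q0 = h (z.1 - x, z.2).
  move=> z0; rewrite /h; congr (_ / _).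
  rewrite /Q qE qE' (same_zeros x0) -mulf_div mulfV ?mul1r//.
  apply: expf_neq0; apply/eqP => -[] _ /eqP; by rewrite gt_eqF.
have near1 e : 0 < e -> exists2 d : R, 0 < d & forall z, 0 < z.2 ->
    `|z.1 - x| < d -> z.2 < d -> `|Re (Q z / Q0) - 1| < e /\ `|Im (Q z / Q0)| < e.
  move=> e0; case: ch => c1 c2.
  have [d1 d10 h1] := (contP _ _).1 c1 e e0; have [d2 d20 h2] := (contP _ _).1 c2 e e0.
  exists (Num.min d1 d2) => [|z z0]; first by rewrite lt_min d10.
  rewrite !lt_min => /andP[a1 a2] /andP[b1 b2].
  have := h1 (z.1 - x, z.2); have := h2 (z.1 - x, z.2).
  rewrite /= !subr0 (gtr0_norm z0) -hQ// h0 /= subr0.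
  by move=> /(_ a2 b2) ? /(_ a1 b1).
have [d d0 hd] := near1 (1 / 2) ltac:(by rewrite divr_gt0).
(* On the half-box S the ratio is close to Q0, and an argument of Q z / Q0 is
   given by an arctangent; u differs from it by a constant. *)
pose S := [set z : R * R | [/\ 0 < z.2, `|z.1 - x| < d & z.2 < d]].
pose th z := atan (Im (Q z / Q0) / Re (Q z / Q0)).
have Re0 z : S z -> 0 < Re (Q z / Q0).
  by case=> z0 z1 z2; have [] := hd z z0 z1 z2; rewrite ltr_norml => /andP[]; lra.
have rQ0 z : S z -> ray Q0 (u z - th z).
  move=> Sz; have [z0 _ _] := Sz.
  have := rayM (ru z z0) (rayV (ray_atan (Re0 z Sz))); congr ray.
  by rewrite invfM invrK mulrA mulfV ?mul1r// (ray_neq0 (ru z z0)).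
have cf z : S z -> {for z, continuous (fun z => u z - th z)}.
  move=> Sz; have [z0 _ _] := Sz; apply: continuousB; first exact: cu.
  have [c1 c2] : ccont (fun z => Q z / Q0) z.
    by apply: ccontM; [exact: ccontQ|exact: ccont_cst].
  have c3 : {for z, continuous (fun z => Im (Q z / Q0) / Re (Q z / Q0))}.
    by apply: continuousM => //; apply: continuousV => //; rewrite gt_eqF ?Re0.
  exact: (continuous_comp c3 (@continuous_atan R _)).
pose z0 : R * R := (x, d / 2).
have d2 : 0 < d / 2 by rewrite divr_gt0.
have Sz0 : S z0.
  by split; rewrite /= ?subrr ?normr0// ltr_pdivrMr// ltr_pMr// ltr1n.
pose A := u z0 - th z0.
have fA z : S z -> u z - th z = A.
  move=> Sz; apply: (@cis_const_segment R (fun z => u z - th z) S).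
  - move=> t /andP[t0 t1]; case: Sz Sz0 => [a1 a2 a3] [b1 b2 b3].
    split; rewrite /=.
    + have -> : z.2 + t * (z0.2 - z.2) = (1 - t) * z.2 + t * z0.2 by ring.
      by have := mulr_ge0 t0 (ltW b1); nra.
    + move: a2 b2; rewrite !ltr_norml => /andP[? ?] /andP[? ?].
      by apply/andP; split; nra.
    + by nra.
  - exact: cf.
  - by move=> p p' Sp Sp'; exact: (ray_uniq (rQ0 p Sp) (rQ0 p' Sp')).
exists A; split.
  have rA : ray Q0 A := rQ0 z0 Sz0.
  have E : Q0 / conjc Q0 = c0 * cis (dL * x).
    have cQ0 : conjc Q0 != 0 by rewrite conjc_eq0.
    suff E0 : Q0 = c0 * cis (dL * x) * conjc Q0 by rewrite {1}E0 mulfK.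
    have -> : conjc Q0 = conjc (q (0, 0)) / conjc (q' (0, 0)).
      by rewrite -fmorphV; exact: rmorphM.
    rewrite {1}/Q0 {1}qf {1}qf' /c0 /dL mulrBl cisD cisNV.
    have cn := cis_neq0 ((\sum_i l' i) * x).
    have cq'0 : conjc (q' (0, 0)) != 0 by rewrite conjc_eq0.
    by field; rewrite cn detU' cq'0.
  have rc : ray (cis (- (dL * x)) : R[i]) (- (dL * x)) by exists 1; rewrite ?mul1r.
  have := rayM (rayM rA (rayV (ray_conj rA))) rc; rewrite E -mulrA cisVN mulr1.
  by congr ray; ring.
move=> e e0; pose e1 : R := Num.min e 1 / 4.
have e10 : 0 < e1 by rewrite divr_gt0// lt_min e0 ltr01.
have e1e : 2 * e1 < e.
  have : Num.min e 1 <= e by rewrite ge_min lexx.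
  rewrite /e1; lra.
have e11 : 2 * e1 <= 1.
  have : Num.min e 1 <= 1 by rewrite ge_min lexx orbT.
  rewrite /e1; lra.
have [d1 d10 hd1] := near1 e1 e10.
exists (Num.min d d1) => [|z z20]; first by rewrite lt_min d0.
rewrite !lt_min => /andP[a1 a2] /andP[b1 b2].
have Sz : S z by [].
have -> : u z - A = th z by rewrite -(fA z Sz); ring.
have [r1 i1] := hd1 z z20 a2 b2.
have Rz : 1 / 2 <= Re (Q z / Q0) by move: r1; rewrite ltr_norml => /andP[? _]; lra.
have q1 : `|Im (Q z / Q0) / Re (Q z / Q0)| <= 2 * e1.
  rewrite normrM normfV (gtr0_norm (Re0 z Sz)) ler_pdivrMr ?Re0//.
  by nra.
by rewrite (le_lt_trans (atan_bound (le_trans q1 e11)))// (le_lt_trans q1).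
Qed.

(** The argument [u] of the ratio is bounded and harmonic.  Twice its boundary
    value at [x] is affine in [x] modulo 2 pi, hence affine on each half-line by
    continuity, and constant there by boundedness.  A bounded harmonic function
    with such boundary values is [a + k arg z], and its values on a ray are all
    equal to the limit at infinity, where the ratio tends to 1. *)
Lemma ratio_positive : forall z, 0 < z.2 -> ray (Q z) 0.
Proof.
have [u1 h1] := secular_arg uU l0; have [u2 h2] := secular_arg uU' l'0.
pose u z := u1 z - u2 z.
have cu z : 0 < z.2 -> {for z, continuous u}.
  by move=> z0; apply: continuousB; [case: (h1 z z0)|case: (h2 z z0)].
have fu z : 0 < z.2 -> flat u z.
  by move=> z0; apply: flatB; [case: (h1 z z0)|case: (h2 z z0)].
have ru z : 0 < z.2 -> ray (Q z) (u z).
  by move=> z0; apply: rayM; [|apply: rayV]; [case: (h1 z z0)|case: (h2 z z0)].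
pose M : R := n%:R * pi + n'%:R * pi.
have bu z : 0 < z.2 -> `|u z| <= M.
  move=> z0; rewrite (le_trans (ler_normB _ _))// lerD//; first by case: (h1 z z0).
  by case: (h2 z z0).
pose P (x a : R) := x != 0 -> ray c0 (2 * a - dL * x) /\
    forall e : R, 0 < e -> exists2 d : R, 0 < d & forall z, 0 < z.2 ->
      `|z.1 - x| < d -> z.2 < d -> `|u z - a| < e.
have [A AP] : {A : R -> R & forall x, P x (A x)}.
  apply: boolp.choice => x; have [->|x0] := eqVneq x 0; first by exists 0; rewrite /P eqxx.
  by have [a aP] := ratio_boundary cu ru x0; exists a.
have bA x : x != 0 -> `|A x| <= M.
  move=> x0; apply/ler_addgt0Pr => e e0; have [_ /(_ e e0)[d d0 hd]] := AP x x0.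
  have d2 : 0 < d / 2 by rewrite divr_gt0.
  have dd : d / 2 < d by rewrite ltr_pdivrMr// ltr_pMr// ltr1n.
  have := hd (x, d / 2) d2; rewrite /= subrr normr0 => /(_ d0 dd) h.
  have := bu (x, d / 2) d2; have := ler_distD (u (x, d / 2)) (A x) 0.
  by rewrite !subr0 [`|A x - _|]distrC => *; lra.
pose B x : R := 2 * A x - dL * x.
have cA x : x != 0 -> forall e : R, 0 < e -> exists2 d : R, 0 < d & forall y : R,
    y != 0 -> `|y - x| < d -> `|A y - A x| < e.
  move=> x0 e e0; have e2 : 0 < e / 2 by rewrite divr_gt0.
  have [_ /(_ _ e2)[d d0 hd]] := AP x x0; exists d => // y y0 yx.
  have [_ /(_ _ e2)[d' d'0 hd']] := AP y y0.
  pose t : R := Num.min d d' / 2.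
  have m0 : 0 < Num.min d d' by rewrite lt_min d0.
  have t0 : 0 < t by rewrite divr_gt0.
  have td : t < d.
    have : Num.min d d' <= d by rewrite ge_min lexx.
    by rewrite /t; lra.
  have td' : t < d'.
    have : Num.min d d' <= d' by rewrite ge_min lexx orbT.
    by rewrite /t; lra.
  have a1 := hd (y, t) t0 yx td.
  have a2 := hd' (y, t) t0 ltac:(by rewrite /= subrr normr0) td'.
  have := ler_distD (u (y, t)) (A y) (A x); rewrite [`|A y - u _|]distrC.
  by move=> *; lra.
(* B is constant modulo 2 pi and continuous off the origin. *)
have cB x y : 0 < x * y -> B x = B y.
  move=> xy.
  have x0 : x != 0 by apply: contraTneq xy => ->; rewrite mul0r ltxx.
  have := @cis_const_segment R (fun z => B z.1) [set z | 0 < z.1 * x] (x, 0) (y, 0).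
  apply=> [t /andP[t0 t1] /=|p /= px|p p' /= px p'x].
  - have -> : (x + t * (y - x)) * x = (1 - t) * (x * x) + t * (x * y) by ring.
    have x2 : 0 < x * x by rewrite -expr2 exprn_even_gt0.
    have [->|tn] := eqVneq t 0; first by rewrite mul0r addr0 subr0 mul1r.
    have tp : 0 < t by rewrite lt_neqAle eq_sym tn.
    apply: ltr_wpDl; last exact: mulr_gt0.
    by rewrite mulr_ge0 ?subr_ge0// ltW.
  - have p0 : p.1 != 0 by apply: contraTneq px => ->; rewrite mul0r ltxx.
    have cf : {for p, continuous (fun z : R * R => z.1)} by apply: cvg_fst.
    apply: continuousB; last by apply: continuousM => //; exact: cvg_cst.
    apply: continuousM; first exact: cvg_cst.
    apply/contP => e e0; have [d d0 hd] := cA p.1 p0 e e0.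
    have p10 : 0 < `|p.1| by rewrite normr_gt0.
    exists (Num.min d `|p.1|) => [|z]; first by rewrite lt_min d0.
    rewrite lt_min => /andP[z1 z1'] _; apply: hd => //.
    by apply: contraTneq z1' => ->; rewrite sub0r normrN ltxx.
  - have p0 : p.1 != 0 by apply: contraTneq px => ->; rewrite mul0r ltxx.
    have p'0 : p'.1 != 0 by apply: contraTneq p'x => ->; rewrite mul0r ltxx.
    exact: (ray_uniq (AP p.1 p0).1 (AP p'.1 p'0).1).
have M0 : 0 <= M by rewrite (le_trans _ (bA 1 _))// oner_neq0.
(* A is bounded, hence the slope of 2 A = B + dL x vanishes. *)
have dL0 : dL = 0.
  apply/eqP/negPn/negP => dL0.
  have nd : 0 < `|dL| by rewrite normr_gt0.
  pose K : R := 2 * M + `|B 1| + 1.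
  have K0 : 0 < K by rewrite ltr_wpDl// addr_ge0// mulr_ge0.
  pose x : R := K / `|dL|.
  have xp : 0 < x by rewrite divr_gt0.
  have := cB x 1; rewrite mulr1 => /(_ xp) Bx.
  have e : dL * x = 2 * A x - B 1 by rewrite -Bx /B; ring.
  have : `|dL * x| = K by rewrite normrM (gtr0_norm xp) /x mulrC divfK// gt_eqF.
  rewrite e => h; have := ler_normB (2 * A x) (B 1); rewrite h /K normrM.
  have -> : `|2 : R| = 2 by rewrite ger0_norm.
  by have := bA x ltac:(by rewrite gt_eqF); lra.
pose a : R := A 1; pose b : R := A (-1).
have Ax x : x != 0 -> A x = if 0 < x then a else b.
  move=> x0; case: ltP => [xp|xn].
    by have := cB x 1; rewrite mulr1 /B dL0 !mul0r !subr0 => /(_ xp) h; rewrite /a; lra.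
  have xn' : x < 0 by rewrite lt_neqAle x0.
  have := cB x (-1); rewrite mulrN1 oppr_gt0 /B dL0 !mul0r !subr0 => /(_ xn') h.
  by rewrite /b; lra.
pose k : R := (b - a) / pi.
have pi0 := pi_gt0 R.
pose v z : R := u z - (a + k * argz z).
have fv z : 0 < z.2 -> flat v z.
  move=> z0; apply: flatB; first exact: fu.
  by apply: flatD; [exact: flat_cst|apply: flatZ; exact: flat_argz].
have cv z : 0 < z.2 -> {for z, continuous v}.
  move=> z0; apply: continuousB; first exact: cu.
  apply: continuousD; first exact: cvg_cst.
  by apply: continuousM; [exact: cvg_cst|exact: continuous_argz].
have bv z : 0 < z.2 -> `|v z| <= M + (`|a| + `|k| * pi).
  move=> z0; rewrite (le_trans (ler_normB _ _))// lerD ?bu//.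
  rewrite (le_trans (ler_normD _ _))// lerD2l normrM ler_wpM2l//.
  by have /andP[? ?] := argz_bounds z; rewrite gtr0_norm// ltW.
have lv (x : R) : x != 0 -> forall e : R, 0 < e -> exists2 d : R, 0 < d & forall z,
    0 < z.2 -> `|z.1 - x| < d -> z.2 < d -> `|v z| <= e.
  move=> x0 e e0; have e2 : 0 < e / 2 by rewrite divr_gt0.
  have [_ /(_ _ e2)[d d0 hd]] := AP x x0.
  have k0 : 0 < `|k| + 1 by rewrite ltr_wpDl.
  have [d' d'0 hd'] := argz_boundary x0 (divr_gt0 e2 k0).
  exists (Num.min d d') => [|z z0]; first by rewrite lt_min d0.
  rewrite !lt_min => /andP[a1 a2] /andP[b1 b2].
  have g1 := hd z z0 a1 b1; have g2 := hd' z z0 a2 b2.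
  have -> : v z = (u z - A x) - k * (argz z - (if 0 < x then 0 else pi)).
    rewrite (Ax x x0) /v /k; case: ifP => _; first by ring.
    by move: (gt_eqF pi0); move: (pi : R) => p /negbT pn; field.
  rewrite (le_trans (ler_normB _ _))// [e]splitr lerD ?(ltW g1)//.
  rewrite normrM (le_trans (ler_wpM2l (normr_ge0 k) g2))//.
  rewrite [leLHS](_ : _ = (`|k| / (`|k| + 1)) * (e / 2)); last by ring.
  apply: ler_piMl; first exact: ltW.
  by rewrite ler_pdivrMr// mul1r lerDl.
(* The maximum principle for v and for - v. *)
have v0 z : 0 < z.2 -> v z = 0.
  move=> z0; apply/eqP; rewrite eq_le; apply/andP; split.
    apply: (@max_principle R v _ cv fv (fun y y0 => le_trans (ler_norm _) (bv y y0))) => // x x0 e e0.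
    have [d d0 hd] := lv x x0 e e0; exists d => // y y0 y1 y2.
    by rewrite (le_trans (ler_norm _))// hd.
  rewrite -oppr_le0.
  apply: (@max_principle R (fun z => - v z) (M + (`|a| + `|k| * pi))) => // [y y0|y y0|y y0|x x0 e e0].
  - by apply: continuousN; exact: cv.
  - by apply: flat_ext (flatZ (-1) (fv y y0)) => w; rewrite mulN1r.
  - by rewrite (le_trans (ler_norm _))// normrN bv.
  - have [d d0 hd] := lv x x0 e e0; exists d => // y y0 y1 y2.
    by rewrite (le_trans (ler_norm _))// normrN hd.
move=> z z0; suff cu0 : cis (u z) = 1.
  have [r r0 rE] := ru z z0; exists r => //.
  by rewrite rE cu0 cis0.
(* Along the ray through z the argument is constant, and the ratio tends to 1. *)
have uc (t : R) : 0 < t -> u (t * z.1, t * z.2) = u z.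
  move=> t0; have := v0 (t * z.1, t * z.2) (mulr_gt0 t0 z0); have := v0 z z0.
  rewrite /v /argz /= -mulrN invfM mulrACA mulfV ?gt_eqF// mul1r; lra.
have close (e : R) : 0 < e -> e <= 1 / 4 -> `|sin (u z)| <= 8 * e /\ 0 < cos (u z).
  move=> e0 e1.
  have [k1 k10 hk1] := secular_infty uU l0 e0; have [k2 k20 hk2] := secular_infty uU' l'0 e0.
  pose t : R := (k1 + k2) / z.2 + 1.
  have t0 : 0 < t by rewrite ltr_wpDl// divr_ge0 ?addr_ge0// ltW.
  pose y : R * R := (t * z.1, t * z.2).
  have yE : y.2 = k1 + k2 + z.2 by rewrite /= /t; field; rewrite gt_eqF.
  have y0 : 0 < y.2 by rewrite mulr_gt0.
  have n1 := hk1 y ltac:(rewrite yE; lra).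
  have n2 := hk2 y ltac:(rewrite yE; lra).
  have [r r0 rE] := ru y y0; rewrite uc// in rE.
  have DE : secular l U y = r%:C * cis (u z) * secular l' U' y.
    by rewrite -rE /Q divfK// secular_neq0.
  move: n1 n2; rewrite DE; move: (secular l' U' y) => D' n1 n2.
  have a1 := le_trans (Re_le_normc _) n2; have a2 := le_trans (Im_le_normc _) n2.
  have a3 := le_trans (Re_le_normc _) n1; have a4 := le_trans (Im_le_normc _) n1.
  move: a1 a2 a3 a4; case: D' {n1 n2 DE} => p s; rewrite /=.
  set c := cos (u z); set si := sin (u z).
  rewrite !mul0r !subr0 !addr0.
  set X := _ - _ * s; set Y := _ * s + _.
  move=> p1 s1 q1 t1; apply: (@polar_close R r p s c si X Y e) => //; [exact: cos_le1|..].
    by rewrite /X /Y; ring.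
  by rewrite /X /Y; ring.
have s0 : sin (u z) = 0.
  apply/eqP; rewrite -normr_eq0; apply/eqP/le_anti; rewrite normr_ge0 andbT.
  apply/ler_addgt0Pr => e e0; rewrite add0r.
  have e8 : 0 < Num.min (e / 8) (1 / 4) by rewrite lt_min !divr_gt0.
  have [|h _] := close _ e8; first by rewrite ge_min lexx orbT.
  have : Num.min (e / 8) (1 / 4) <= e / 8 by rewrite ge_min lexx.
  by lra.
have [||_ c1] := close (1 / 4); [by rewrite divr_gt0|exact: lexx|].
have := cos2Dsin2 (u z); rewrite s0 expr0n addr0 => /eqP.
rewrite sqrf_eq1 => /orP[/eqP cE|/eqP cE]; first by rewrite /cis s0 cE.
by move: c1; rewrite cE oppr_gt0 ltNge ler01.
Qed.
End TwoSystems.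
End RatioPositive.

(** * Sobolev functions on an edge *)

Section Primitive.
Variable R : realType.
Local Notation mu := lebesgue_measure.
Implicit Types (f g : R -> R) (x l : R).

(** Starting the integral at [-1] makes the primitive differentiable at [0]. *)
Definition prim g x : R :=
  \int[mu]_(t in `[(-1), x]) g t - \int[mu]_(t in `[(-1), 0]) g t.

Lemma continuous_integrable g (a b : R) : continuous g ->
  mu.-integrable `[a, b] (EFin \o g).
Proof.
move=> cg; apply: continuous_compact_integrable; first exact: segment_compact.
exact: continuous_subspaceT.
Qed.

Lemma prim_derive g x : continuous g -> -1 < x -> is_derive x 1 (prim g) (g x).
Proof.
move=> cg x1.
have [] := @continuous_FTC1_closed R g (-1) x (x + 1) _ (continuous_integrable _ _ cg) x1 (cg x).
  by rewrite ltrDl.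
move=> dF F'.
have d : is_derive x 1 (fun y => \int[mu]_(t in `[(-1), y]) g t) (g x).
  by split; [exact: dF|rewrite -derive1E; exact: F'].
by apply: is_derive_eq; rewrite subr0.
Qed.

Lemma primE g x : continuous g -> 0 <= x -> prim g x = \int[mu]_(t in `[0, x]) g t.
Proof.
move=> cg x0; have x1 : (-1 : R) <= 0 by rewrite lerN10.
rewrite /prim (Rintegral_itvB (continuous_integrable (-1) x cg)) ?bnd_simp//.
by rewrite Rintegral_itv_obnd_cbnd//; apply: integrableS (continuous_integrable 0 x cg) => //; exact: subset_itv_oc_cc.
Qed.

Lemma sobolev1_C1 l f g : 0 < l -> (forall x, 0 <= x -> is_derive x 1 f (g x)) ->
  (forall x, 0 <= x -> {for x, continuous g}) -> sobolev1 l f g.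
Proof.
move=> l0 df cg.
have wg y : {within `[0, y], continuous g}.
  apply: continuous_in_subspaceT => t; rewrite inE /= in_itv /= => /andP[t0 _].
  exact: cg.
split.
- by apply: subspace_continuous_measurable_fun; [exact: measurable_itv|exact: wg].
- apply: continuous_compact_integrable; first exact: segment_compact.
  apply: continuous_in_subspaceT => t; rewrite inE /= in_itv /= => /andP[t0 _].
  by apply: continuousM; exact: cg.
move=> x; rewrite in_itv /= => /andP[x0 xl].
move: x0; rewrite le_eqVlt => /orP[/eqP <-|x0].
  by rewrite set_itv1 Rintegral_set1 addr0.
have cf y : 0 <= y -> {for y, continuous f}.
  by move=> y0; apply/differentiable_continuous/derivable1_diffP; case: (df y y0).
rewrite /Rintegral (continuous_FTC2 (F := f) x0 (wg x)).
- by rewrite -EFinB /= addrC subrK.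
- split.
  + move=> y; rewrite in_itv /= => /andP[y0 _].
    by case: (df y (ltW y0)).
  + by apply: cvg_at_right_filter; exact: cf.
  + by apply: cvg_at_left_filter; apply: cf; exact: ltW.
- move=> y; rewrite in_itv /= => /andP[y0 _]; rewrite derive1E.
  by case: (df y (ltW y0)).
Qed.

Lemma sobolev1_integrable l f g : 0 < l -> sobolev1 l f g ->
  mu.-integrable `[0, l] (EFin \o g).
Proof.
move=> l0 [mg ig _].
have i1 : mu.-integrable `[0, l] (EFin \o (fun=> 1 : R)).
  by apply: continuous_integrable; exact: cst_continuous.
have i2 : mu.-integrable `[0, l] (fun x => (g x ^+ 2)%:E + 1%:E)%E.
  by apply: integrableD => //; exact: measurable_itv.
apply: le_integrable i2.
- exact: measurable_itv.
- exact/measurable_EFinP.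
- move=> x _ /=; rewrite lee_fin [leRHS]ger0_norm ?addr_ge0 ?sqr_ge0//.
  rewrite -[g x ^+ 2]real_normK ?num_real//.
  by have := sqr_ge0 (`|g x| - 1); have := normr_ge0 (g x); rewrite !expr2; lra.
Qed.

(** Continuity on the whole line spares one-sided limits at the ends of the
    edge. *)
Lemma sobolev1_extension l f g : 0 < l -> sobolev1 l f g ->
  exists F, continuous F /\ forall x, x \in `[0, l] -> F x = f x.
Proof.
move=> l0 sf; have ig := sobolev1_integrable l0 sf; case: sf => mg _ fE.
have cI : {within `[0, l], continuous (fun x => \int[mu]_(t in `[0, x]) g t)}.
  exact: (parameterized_integral_continuous (ltW l0) ig).
have cf : {within `[0, l], continuous f}.
  apply: (subspace_eq_continuous (f := fun x => f 0 + \int[mu]_(t in `[0, x]) g t)).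
    by move=> x; rewrite inE => /= xl; rewrite -fE.
  move=> x; apply: cvgD; first exact: cvg_cst.
  exact: cI.
have [M M0 Mf] : exists2 M : R, 0 < M & forall x, x \in `[0, l] -> `|f x| <= M.
  have /compact_bounded [M [_ hM]] : compact (f @` `[0, l]).
    by apply: continuous_compact => //; exact: segment_compact.
  exists (`|M| + 1) => [|x xl]; first by rewrite ltr_wpDl.
  apply: hM; last by exists x.
  by rewrite (le_lt_trans (ler_norm _))// ltrDl.
have [] := continuous_bounded_extension _ _ M0 cf.
- exact: pseudometric_normal.
- exact: itv_closed.
- by move=> x /=; exact: Mf.
move=> F [FE cF _].
by exists F; split => // x xl; rewrite -FE// inE.
Qed.

(** The integrals of two almost everywhere equal functions agree. *)
Lemma sobolev1_derive l f g G : 0 < l -> sobolev1 l f g -> continuous G ->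
  {ae mu, forall x, x \in `[0, l] -> g x = G x} ->
  forall x, x \in `[0, l] -> f x = f 0 + prim G x.
Proof.
move=> l0 sf cG gG x xl; have ig := sobolev1_integrable l0 sf; case: sf => mg _ fE.
have /andP[x0 xl'] : 0 <= x <= l by [].
rewrite fE// primE//; congr (_ + _); rewrite /Rintegral; congr fine.
have sx : `[0, x] `<=` `[0, l] by apply: subset_itvl; rewrite bnd_simp.
apply: ae_eq_integral.
- exact: measurable_itv.
- by apply/measurable_EFinP; apply: measurable_funS mg => //; exact: measurable_itv.
- apply/measurable_EFinP; apply: subspace_continuous_measurable_fun.
    exact: measurable_itv.
  exact: continuous_subspaceT.
move: gG; apply: filterS; first exact: (ae_filter_ringOfSetsType mu).
by move=> y yG y0x /=; rewrite yG//; exact: sx.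
Qed.
End Primitive.

(** * The eigenvalue equation on an edge *)

Section ComplexDerivative.
Variable R : realType.
Implicit Types (f g : R -> R[i]) (x : R).

Definition cder f x (d : R[i]) :=
  is_derive x 1 (fun t => Re (f t)) (Re d) /\ is_derive x 1 (fun t => Im (f t)) (Im d).

Lemma cder_eq f x d d' : cder f x d -> d = d' -> cder f x d'.
Proof. by move=> h <-. Qed.
Lemma cder_ext f g x d : f =1 g -> cder f x d -> cder g x d.
Proof. by move=> /funext ->. Qed.
Lemma cder_cst (c : R[i]) x : cder (fun=> c) x 0.
Proof. by split; exact: is_derive_cst. Qed.
Lemma cderD f g x d e : cder f x d -> cder g x e -> cder (fun t => f t + g t) x (d + e).
Proof.
move=> [f1 f2] [g1 g2]; split.
  have -> : (fun t => Re (f t + g t)) = (fun t => Re (f t)) \+ (fun t => Re (g t)).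
    by apply/funext => t; rewrite ReD.
  by rewrite ReD; exact: is_deriveD.
have -> : (fun t => Im (f t + g t)) = (fun t => Im (f t)) \+ (fun t => Im (g t)).
  by apply/funext => t; rewrite ImD.
by rewrite ImD; exact: is_deriveD.
Qed.
Lemma cderM f g x d e : cder f x d -> cder g x e ->
  cder (fun t => f t * g t) x (d * g x + f x * e).
Proof.
move=> [f1 f2] [g1 g2]; split.
  have -> : (fun t => Re (f t * g t)) =
      (fun t => Re (f t)) * (fun t => Re (g t)) - (fun t => Im (f t)) * (fun t => Im (g t)).
    by apply/funext => t; rewrite ReM.
  apply: is_derive_eq; rewrite /GRing.scale /= ReD !ReM; ring.
have -> : (fun t => Im (f t * g t)) =
    (fun t => Re (f t)) * (fun t => Im (g t)) + (fun t => Im (f t)) * (fun t => Re (g t)).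
  by apply/funext => t; rewrite ImM.
apply: (is_derive_eq (is_deriveD (is_deriveM f1 g2) (is_deriveM f2 g1))).
by rewrite /GRing.scale /= ImD !ImM; ring.
Qed.
Lemma cder_cis (u : R -> R) x d : is_derive x 1 u d ->
  cder (fun t => cis (u t)) x ('i%C * d%:C * cis (u x)).
Proof.
move=> du; split.
  have -> : (fun t => Re (cis (u t))) = @cos R \o u by [].
  apply: is_derive_eq; rewrite ?ReM /= /GRing.scale /= ?ReM ?ImM /=; ring.
have -> : (fun t => Im (cis (u t))) = @sin R \o u by [].
apply: is_derive_eq; rewrite ?ImM /= /GRing.scale /= ?ReM ?ImM /=; ring.
Qed.

Lemma cder_ccont f x d : cder f x d -> ccont f x.
Proof.
move=> [f1 f2]; split; apply/differentiable_continuous/derivable1_diffP.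
  by case: f1.
by case: f2.
Qed.

Lemma cder0_cst f (l : R) : (forall x, x \in `[0, l] -> cder f x 0) ->
  forall x, x \in `[0, l] -> f x = f 0.
Proof.
move=> df x xl; have /andP[x0 xl'] : 0 <= x <= l by [].
have key (g : R -> R) : (forall y, y \in `[0, l] -> is_derive y 1 g 0) -> g x = g 0.
  move=> dg; have sub y : y \in `[0, x] -> y \in `[0, l].
    by rewrite !in_itv /= => /andP[-> yx] /=; exact: le_trans xl'.
  have dg' y : y \in `]0, x[ -> is_derive y 1 g 0.
    by move=> yx; apply: dg; apply: sub; exact: subset_itv_oo_cc yx.
  have cg : {within `[0, x], continuous g}.
    apply: continuous_in_subspaceT => y; rewrite inE => /= /sub /dg [d _].
    exact/differentiable_continuous/derivable1_diffP.
  by have [c _] := MVT_segment x0 dg' cg; rewrite mul0r => /subr0_eq.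
apply: complexP.
  by apply: (key (fun t => Re (f t))) => y /df [].
by apply: (key (fun t => Im (f t))) => y /df [].
Qed.

Lemma sobolev2_C2 (l : R) f f1 f2 : 0 < l ->
  (forall x, 0 <= x -> cder f x (f1 x)) -> (forall x, 0 <= x -> cder f1 x (f2 x)) ->
  (forall x, 0 <= x -> ccont f2 x) -> sobolev2 l f f1 f2.
Proof.
move=> l0 d1 d2 c2.
have c1 x : 0 <= x -> ccont f1 x by move=> /d2; exact: cder_ccont.
by split; split; apply: (sobolev1_C1 l0) => x x0;
  [case: (d1 x x0)|case: (c1 x x0)|case: (d1 x x0)|case: (c1 x x0)|
   case: (d2 x x0)|case: (c2 x x0)|case: (d2 x x0)|case: (c2 x x0)].
Qed.
End ComplexDerivative.

Section EdgeEquation.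
Variables (R : realType) (a : R -> R) (k : R).
Hypothesis sa : smooth a.
Implicit Types (x l : R) (al be : R[i]).

Let p x : R[i] := 0 +i* (2 * pi * a x).
Let p1 x : R[i] := 0 +i* (2 * pi * derive1 a x).

(** Multiplication by [cis (- gauge)] conjugates d/dx into d/dx + 2 pi i a. *)
Definition gauge x : R := 2 * pi * prim a x.
(** The plane waves [al] and [be] in the two directions, in the gauge of [a]. *)
Definition edge_wave al be x : R[i] :=
  cis (- gauge x) * (al * cis (k * x) + be * cis (- (k * x))).
(** The derivative d/dx + 2 pi i a of [edge_wave]. *)
Definition edge_wave_current al be x : R[i] :=
  'i%C * k%:C * (cis (- gauge x) * (al * cis (k * x) - be * cis (- (k * x)))).
Definition edge_wave1 al be x : R[i] :=
  edge_wave_current al be x - p x * edge_wave al be x.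
Let edge_wave2 al be x : R[i] :=
  (- p x * edge_wave_current al be x - (k ^+ 2)%:C * edge_wave al be x)
  - (p1 x * edge_wave al be x + p x * edge_wave1 al be x).

Let da x : is_derive x 1 a (derive1 a x).
Proof. by split; [exact: (@sa 0%N x)|rewrite derive1E]. Qed.

Let ca : continuous a.
Proof. by move=> x; apply/differentiable_continuous/derivable1_diffP; exact: (@sa 0%N x). Qed.

Let ca1 : continuous (derive1 a).
Proof. by move=> x; apply/differentiable_continuous/derivable1_diffP; exact: (@sa 1%N x). Qed.

Let dgauge x : 0 <= x -> is_derive x 1 gauge (2 * pi * a x).
Proof.
move=> x0; have d : is_derive x 1 (prim a) (a x) by apply: prim_derive => //; lra.
have -> : gauge = (2 * pi) *: (prim a) by [].
exact: is_derive_eq.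
Qed.

Let dN (u : R -> R) x d : is_derive x 1 u d -> is_derive x 1 (fun t => - u t) (- d).
Proof. by move=> du; have -> : (fun t => - u t) = - u by []; exact: is_deriveN. Qed.

Let dk (c x : R) : is_derive x 1 (fun t => c * t) c.
Proof.
have -> : (fun t => c * t) = c *: (@id R) by [].
by apply: is_derive_eq; rewrite /GRing.scale /= mulr1.
Qed.

Let pE x : p x = 'i%C * (2 * pi * a x)%:C.
Proof. by apply: complexP; rewrite ?ReM ?ImM /=; ring. Qed.

Let dg x : 0 <= x -> cder (fun t => cis (- gauge t)) x (- p x * cis (- gauge x)).
Proof.
move=> x0; apply: cder_eq (cder_cis (dN (dgauge x0))) _.
by rewrite pE rmorphN; ring.
Qed.

Let dwave al be x : cder (fun t => al * cis (k * t) + be * cis (- (k * t))) x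
  ('i%C * k%:C * (al * cis (k * x) - be * cis (- (k * x)))).
Proof.
apply: cder_eq (cderD (cderM (cder_cst al x) (cder_cis (dk k x)))
   (cderM (cder_cst be x) (cder_cis (dN (dk k x))))) _.
by rewrite rmorphN; ring.
Qed.

Let dew al be x : 0 <= x -> cder (edge_wave al be) x (edge_wave1 al be x).
Proof.
move=> x0; apply: cder_eq (cderM (dg x0) (dwave al be x)) _.
by rewrite /edge_wave1 /edge_wave_current /edge_wave; ring.
Qed.

Let dcur al be x : 0 <= x -> cder (edge_wave_current al be) x
  (- p x * edge_wave_current al be x - (k ^+ 2)%:C * edge_wave al be x).
Proof.
move=> x0.
have h := cderM (cder_cst ('i%C * k%:C) x) (cderM (dg x0) (dwave al (- be) x)).
apply: cder_ext (cder_eq h _) => [t|].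
  by rewrite /edge_wave_current; ring.
have ii : 'i%C * 'i%C = -1 :> R[i] by rewrite -expr2 sqr_i.
rewrite rmorphXn /edge_wave_current /edge_wave expr2.
transitivity (- p x * ('i%C * k%:C * (cis (- gauge x) * (al * cis (k * x) - be * cis (- (k * x)))))
  + ('i%C * 'i%C) * (k%:C * k%:C * (cis (- gauge x) * (al * cis (k * x) + be * cis (- (k * x)))))).
  ring.
by rewrite ii; ring.
Qed.

Let dp x : cder p x (p1 x).
Proof.
split; first exact: is_derive_cst.
have -> : (fun t => Im (p t)) = (2 * pi) *: a by [].
by have d := da x; exact: is_derive_eq.
Qed.

Let dew1 al be x : 0 <= x -> cder (edge_wave1 al be) x (edge_wave2 al be x).
Proof.
move=> x0; apply: cder_ext (cder_eq (cderD (dcur al be x0)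
  (cderM (cder_cst (-1) x) (cderM (dp x) (dew al be x0)))) _) => [t|].
  by rewrite /edge_wave1; ring.
by rewrite /edge_wave2; ring.
Qed.

Lemma edge_wave_solution l al be : 0 < l -> exists f2 : R -> R[i],
  sobolev2 l (edge_wave al be) (edge_wave1 al be) f2 /\
  forall x, magnetic_laplacian a (edge_wave al be) (edge_wave1 al be) f2 x =
    (k ^+ 2)%:C * edge_wave al be x.
Proof.
move=> l0; exists (edge_wave2 al be); split.
  apply: (sobolev2_C2 l0) => [x x0|x x0|x x0]; [exact: dew|exact: dew1|].
  have cp := cder_ccont (dp x).
  have cp1 : ccont p1 x.
    split; first exact: cst_continuous.
    by apply: continuousM; [exact: cst_continuous|exact: ca1].
  have c0 := cder_ccont (dew al be x0); have c1 := cder_ccont (dew1 al be x0).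
  have c2 := cder_ccont (dcur al be x0).
  apply: ccontD; last first.
    by apply: ccontN; apply: ccontD; apply: ccontM.
  apply: ccontD; first by apply: ccontM; [exact: ccontN|exact: c2].
  by apply: ccontN; apply: ccontM; [exact: ccont_cst|exact: c0].
by move=> x; rewrite /magnetic_laplacian -/(p x) -/(p1 x) /edge_wave2 /edge_wave1; ring.
Qed.

(** A weak solution is twice continuously differentiable since the equation
    expresses its second derivative by continuous functions; then the wave
    amplitudes can be computed from the value and the derivative, and they are
    constant. *)
Lemma edge_solution_wave l (f f1 f2 : R -> R[i]) : 0 < l -> k != 0 ->
  sobolev2 l f f1 f2 ->
  {ae lebesgue_measure, forall x : R, x \in `[0, l] ->
     magnetic_laplacian a f f1 f2 x = (k ^+ 2)%:C * f x} ->
  exists al be, forall x, x \in `[0, l] ->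
    f x = edge_wave al be x /\ f1 x = edge_wave1 al be x.
Proof.
move=> l0 k0 [[sr si] [sr1 si1]] eqf.
have [fr [cfr frE]] := sobolev1_extension l0 sr.
have [fi [cfi fiE]] := sobolev1_extension l0 si.
have [gr [cgr grE]] := sobolev1_extension l0 sr1.
have [gi [cgi giE]] := sobolev1_extension l0 si1.
pose F x : R[i] := fr x +i* fi x; pose F1 x : R[i] := gr x +i* gi x.
have FE x : x \in `[0, l] -> F x = f x.
  by move=> xl; apply: complexP; rewrite /= ?frE ?fiE.
have F1E x : x \in `[0, l] -> F1 x = f1 x.
  by move=> xl; apply: complexP; rewrite /= ?grE ?giE.
pose G x := - ((k ^+ 2)%:C * F x) - (p1 x * F x + p x * F1 x) - p x * (F1 x + p x * F x).
have cG x : ccont G x.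
  have cp := cder_ccont (dp x).
  have cp1 : ccont p1 x.
    split; first exact: cst_continuous.
    by apply: continuousM; [exact: cst_continuous|exact: ca1].
  have cF : ccont F x by split; [exact: cfr|exact: cfi].
  have cF1 : ccont F1 x by split; [exact: cgr|exact: cgi].
  have ck : ccont (fun _ : R => (k ^+ 2)%:C : R[i]) x by exact: ccont_cst.
  apply: ccontD; last by apply: ccontN; apply: (ccontM cp); apply: (ccontD cF1); exact: ccontM.
  apply: ccontD; last by apply: ccontN; apply: ccontD; apply: ccontM.
  by apply: ccontN; apply: ccontM.
have aeG : {ae lebesgue_measure, forall x : R, x \in `[0, l] -> f2 x = G x}.
  move: eqf; apply: filterS; first exact: (ae_filter_ringOfSetsType lebesgue_measure).
  move=> x h xl; have := h xl; rewrite /magnetic_laplacian -/(p x) -/(p1 x) /G FE// F1E//.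
  by move=> <-; ring.
have ae1 : {ae lebesgue_measure, forall x : R, x \in `[0, l] -> (@complex.Re R \o f1) x = gr x}.
  by apply: (aeW lebesgue_measure) => x xl; rewrite grE.
have ae2 : {ae lebesgue_measure, forall x : R, x \in `[0, l] -> (@complex.Im R \o f1) x = gi x}.
  by apply: (aeW lebesgue_measure) => x xl; rewrite giE.
have ae3 : {ae lebesgue_measure, forall x : R, x \in `[0, l] -> (@complex.Re R \o f2) x = Re (G x)}.
  move: aeG; apply: filterS; first exact: (ae_filter_ringOfSetsType lebesgue_measure).
  by move=> x h xl; rewrite /= h.
have ae4 : {ae lebesgue_measure, forall x : R, x \in `[0, l] -> (@complex.Im R \o f2) x = Im (G x)}.
  move: aeG; apply: filterS; first exact: (ae_filter_ringOfSetsType lebesgue_measure).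
  by move=> x h xl; rewrite /= h.
have cGr : continuous (fun x => Re (G x)) by move=> x; case: (cG x).
have cGi : continuous (fun x => Im (G x)) by move=> x; case: (cG x).
have e1 := sobolev1_derive l0 sr cgr ae1.
have e2 := sobolev1_derive l0 si cgi ae2.
have e3 := sobolev1_derive l0 sr1 cGr ae3.
have e4 := sobolev1_derive l0 si1 cGi ae4.
pose Phi x : R[i] := f 0 + (prim gr x +i* prim gi x).
pose Psi x : R[i] := f1 0 + (prim (fun x => Re (G x)) x +i* prim (fun x => Im (G x)) x).
have PhiE x : x \in `[0, l] -> Phi x = f x.
  by move=> xl; apply: complexP; rewrite ?ReD ?ImD /=; [have := e1 x xl|have := e2 x xl].
have PsiE x : x \in `[0, l] -> Psi x = f1 x.
  by move=> xl; apply: complexP; rewrite ?ReD ?ImD /=; [have := e3 x xl|have := e4 x xl].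
have dprim (u v : R -> R) (c : R[i]) x : continuous u -> continuous v -> 0 <= x ->
    cder (fun x => c + (prim u x +i* prim v x)) x (u x +i* v x).
  move=> cu cv x0; apply: cder_eq (cderD (cder_cst c x) _) (add0r _).
  by split; apply: prim_derive => //; lra.
have x0l x : x \in `[0, l] -> 0 <= x by rewrite in_itv /= => /andP[].
have dPhi x : x \in `[0, l] -> cder Phi x (Psi x).
  move=> xl; apply: cder_eq (dprim _ _ _ _ cgr cgi (x0l x xl)) _.
  by rewrite PsiE// -F1E.
have dPsi x : x \in `[0, l] -> cder Psi x
    (- ((k ^+ 2)%:C * Phi x) - (p1 x * Phi x + p x * Psi x) - p x * (Psi x + p x * Phi x)).
  move=> xl; apply: cder_eq (dprim _ _ _ _ cGr cGi (x0l x xl)) _.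
  transitivity (G x); first by case: (G x).
  by rewrite /G PsiE// PhiE// FE// F1E.
(* For s = 1 and s = -1: up to a constant factor, the two amplitudes. *)
pose E (s : R) x : R[i] :=
  (Psi x + p x * Phi x + s%:C * ('i%C * k%:C) * Phi x) * (cis (gauge x) * cis (- (s * (k * x)))).
have dE s x : s ^+ 2 = 1 -> x \in `[0, l] -> cder (E s) x 0.
  move=> s1 xl; have x0 := x0l x xl.
  have dk' : is_derive x 1 (fun t => - (s * (k * t))) (- (s * k)).
    apply: dN; have -> : (fun t => s * (k * t)) = (fun t => (s * k) * t).
      by apply/funext => t; rewrite mulrA.
    exact: dk.
  have d1 := cderM (cder_cis (dgauge x0)) (cder_cis dk').
  have d2 := cderD (cderD (dPsi x xl) (cderM (dp x) (dPhi x xl)))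
    (cderM (cder_cst (s%:C * ('i%C * k%:C)) x) (dPhi x xl)).
  apply: cder_eq (cderM d2 d1) _.
  have ii : 'i%C * 'i%C = -1 :> R[i] by rewrite -expr2 sqr_i.
  have ss : s%:C * s%:C = 1 :> R[i] by rewrite -rmorphM -expr2 s1.
  have ce1 : (- (s * k))%:C = - (s%:C * k%:C) :> R[i] by rewrite rmorphN rmorphM.
  have ce2 : (k ^+ 2)%:C = k%:C ^+ 2 :> R[i] by rewrite rmorphXn.
  rewrite ce1 ce2 -pE.
  set X := Psi x; set Y := Phi x; set q := p x; set c := cis (gauge x); set c' := cis _.
  transitivity (- (k%:C ^+ 2) * Y * c * c' * (1 + ('i%C * 'i%C) * (s%:C * s%:C))).
    by ring.
  by rewrite ii ss; ring.
have Ec s x : s ^+ 2 = 1 -> x \in `[0, l] -> E s x = E s 0.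
  by move=> s1 xl; apply: (cder0_cst (l := l)) => // y; exact: dE.
have kc0 : k%:C != 0 :> R[i] by apply/eqP => -[] /eqP; rewrite (negbTE k0).
have i0 : 'i%C != 0 :> R[i] by apply/eqP => -[] /eqP; rewrite oner_eq0.
exists (E 1 0 / (2 * ('i%C * k%:C))), (- E (-1) 0 / (2 * ('i%C * k%:C))) => x xl.
have m1 : (-1 : R) ^+ 2 = 1 by rewrite sqrrN expr1n.
rewrite -(Ec 1 x (expr1n _ _) xl) -(Ec (-1) x m1 xl) -(PhiE x xl) -(PsiE x xl) /E.
have -> : (-1)%:C = -1 :> R[i] by rewrite rmorphN rmorph1.
have -> : - (-1 * (k * x)) = k * x by ring.
have -> : - (1 * (k * x)) = - (k * x) by ring.
rewrite (rmorph1 (real_complex R)) mul1r !cisNV.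
have w0 := cis_neq0 (gauge x); have c0 := cis_neq0 (k * x).
set al := _ / _; set be := _ / _.
have waveE : edge_wave al be x = Phi x.
  by rewrite /edge_wave /al /be !cisNV; field; rewrite ?w0 ?c0 ?kc0 ?i0.
split; first by [].
rewrite /edge_wave1 waveE /edge_wave_current /al /be !cisNV.
by field; rewrite ?w0 ?c0 ?kc0 ?i0.
Qed.
End EdgeEquation.

(** * Scattering at the vertices *)

Section Scattering.
Variables (R : realType) (G : quantum_graph R).
(* A bond is an edge with a direction of travel: h arrives at vtx h and starts
   from origin h. *)
Local Notation bond := (edge G * bool)%type.
Local Notation nb := #|{: edge G * bool}|.
Local Notation mu := lebesgue_measure.
Implicit Types (h g : bond) (v : vertex G) (a : Lambda1 G) (k : R).
Local Open Scope sesquilinear_scope.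

Definition rev h : bond := (h.1, ~~ h.2).

Lemma revK : involutive rev. Proof. by case=> e b; rewrite /rev /= negbK. Qed.
Lemma origin_rev h : origin (rev h) = vtx h.
Proof. by case: h => e b; rewrite /origin /rev /= negbK. Qed.
Lemma vtx_rev h : vtx (rev h) = origin h. Proof. by []. Qed.

Definition sgn h : R := (-1) ^+ (~~ h.2).
Definition deg v : R := #|[pred h | vtx h == v]|%:R.

Lemma deg_neq0 v : deg v != 0.
Proof. by rewrite pnatr_eq0 no_isolated. Qed.


(** Amplitude with which a wave arriving along [g] leaves along [h], under the
    Kirchhoff conditions. *)
Definition scat h g : R :=
  if origin h == vtx g then 2 / deg (origin h) - (g == rev h)%:R else 0.

(** At each vertex the matrix is minus a reflection in a hyperplane, followed by
    the reversal of bonds. *)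
Lemma scat_orthonormal h h' : \sum_g scat h g * scat h' g = (h == h')%:R.
Proof.
have [oE|oE] := eqVneq (origin h) (origin h'); last first.
  rewrite big1 => [|g _]; first by case: eqP => // hh; rewrite hh eqxx in oE.
  rewrite /scat; case: (origin h =P vtx g) => [e1|_]; last by rewrite mul0r.
  by case: (origin h' =P vtx g) => [e2|_]; [rewrite e1 e2 eqxx in oE|rewrite mulr0].
set w := origin h; pose d := deg w; have d0 : d != 0 by exact: deg_neq0.
transitivity (\sum_(g | vtx g == w) ((4 / d ^+ 2 - (g == rev h)%:R * (2 / d)) -
     ((g == rev h')%:R * (2 / d) - (g == rev h)%:R * (g == rev h')%:R))).
  rewrite [RHS]big_mkcond; apply: eq_bigr => g _.
  rewrite /scat -oE -/w eq_sym; case: ifP => _; last by rewrite mul0r.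
  by rewrite -/d; field.
have one g0 (c : bond -> R) : vtx g0 == w -> \sum_(g | vtx g == w) (g == g0)%:R * c g = c g0.
  move=> g0w; rewrite (bigD1 g0) //= eqxx mul1r big1 ?addr0// => g /andP[_ /negbTE ->].
  by rewrite mul0r.
have w1 : vtx (rev h) == w by rewrite vtx_rev.
have w2 : vtx (rev h') == w by rewrite vtx_rev -oE.
rewrite !sumrB (one (rev h))// (one (rev h'))// (one (rev h) (fun g => (g == rev h')%:R))//.
rewrite sumr_const -[_ *+ _]mulr_natr -/(deg w) -/d (inj_eq (inv_inj revK)).
by field.
Qed.

Definition theta a e : R := \int[mu]_(x in `[0, len e]) a e x.
(** The holonomy of the connection along [h]. *)
Definition phase a h : R := - (sgn h * (2 * pi * theta a h.1)).

Definition bond_len (i : 'I_nb) : R := len (enum_val i).1.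
Definition bond_scat a : 'M[R[i]]_nb :=
  \matrix_(i, j) (cis (phase a (enum_val i)) * (scat (enum_val i) (enum_val j))%:C).

Lemma bond_len_gt0 i : 0 < bond_len i.
Proof. exact: len_gt0. Qed.

Lemma bond_scat_unitary a : bond_scat a \is unitarymx.
Proof.
apply/unitarymxP/matrixP => i j; rewrite !mxE.
transitivity (cis (phase a (enum_val i)) * cis (- phase a (enum_val j)) *
   (\sum_g scat (enum_val i) g * scat (enum_val j) g)%:C).
  rewrite rmorph_sum mulr_sumr (reindex_onto (@enum_val bond predT) enum_rank) /=; last first.
    by move=> g _; rewrite enum_rankK.
  under [RHS]eq_bigl => k do rewrite enum_valK eqxx.
  apply: eq_bigr => k _; rewrite !mxE.
  transitivity (cis (phase a (enum_val i)) * (scat (enum_val i) (enum_val k))%:C *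
     (conjc (cis (phase a (enum_val j))) * conjc (scat (enum_val j) (enum_val k))%:C)).
    by congr (_ * _); exact: rmorphM.
  by rewrite conjc_real cisN rmorphM; ring.
rewrite scat_orthonormal (inj_eq enum_val_inj); case: eqP => [->|_]; last by rewrite mulr0.
by rewrite cisVN mul1r.
Qed.

Section Waves.
Variables (a : Lambda1 G) (k : R).
Hypothesis k0 : k != 0.
Local Notation B := (bondmx bond_len (bond_scat a) (k, 0)).
Implicit Types u : 'rV[R[i]]_nb.

Let chi h : R[i] := cis (k * len h.1 + phase a h).
(** [amp u h] is the amplitude, at the end of [h], of the wave that arrives there
    along [h], and [out u h] is that of the wave that leaves it along the
    reversal of [h]. *)
Definition amp u h : R[i] := u 0 (enum_rank h).
Definition out u h : R[i] := amp u (rev h) * (chi (rev h))^-1.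

(** Being fixed by propagation and scattering means that at each vertex the
    outgoing waves are the scattered incoming ones. *)
Lemma stationaryP u : reflect
  (forall h, out u h = (2 / deg (vtx h))%:C * (\sum_(g | vtx g == vtx h) amp u g) - amp u h)
  (u *m (1%:M - B)^T == 0).
Proof.
have E h : (u *m (1%:M - B)^T) 0 (enum_rank h) =
    amp u h - chi h * \sum_g (scat h g)%:C * amp u g.
  rewrite raddfB /= trmx1 mulmxBr mulmx1 !mxE; congr (_ - _).
  rewrite mulr_sumr (reindex (@enum_val bond predT)) /=; last first.
    by exists enum_rank => i _; rewrite ?enum_valK ?enum_rankK.
  apply: eq_bigr => j _; rewrite !mxE wave_real /bond_len enum_rankK /chi cisD /amp enum_valK.
  by rewrite [k * _]mulrC; ring.
have S h : \sum_g (scat h g)%:C * amp u g =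
    (2 / deg (origin h))%:C * (\sum_(g | vtx g == origin h) amp u g) - amp u (rev h).
  transitivity (\sum_(g | vtx g == origin h) ((2 / deg (origin h))%:C * amp u g - (g == rev h)%:R * amp u g)).
    rewrite [RHS]big_mkcond; apply: eq_bigr => g _; rewrite /scat eq_sym.
    case: ifP => _; last by rewrite mul0r.
    by rewrite rmorphB rmorph_nat mulrBl.
  rewrite sumrB -mulr_sumr; congr (_ - _).
  rewrite (bigD1 (rev h)) ?vtx_rev//= eqxx mul1r big1 ?addr0// => g /andP[_ /negbTE ->].
  by rewrite mul0r.
have c0 h : chi h != 0 by exact: cis_neq0.
apply: (iffP eqP) => [u0 h|uE].
  have := E (rev h); rewrite u0 mxE => /esym/eqP; rewrite subr_eq0 => /eqP e.
  by rewrite /out e mulrAC mulfV// mul1r S revK origin_rev.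
apply/rowP => i; rewrite [RHS]mxE -(enum_valK i) E S.
have := uE (rev (enum_val i)); rewrite vtx_rev => <-; rewrite /out revK.
by rewrite mulrCA mulfV// mulr1 subrr.
Qed.

(** The function on the graph with wave amplitudes [u], and its derivative. *)
Definition synth u (e : edge G) : R -> R[i] :=
  edge_wave (a e) k (out u (e, false)) (amp u (e, false)).
Definition synth1 u (e : edge G) : R -> R[i] :=
  edge_wave1 (a e) k (out u (e, false)) (amp u (e, false)).

Let sa e : smooth (a e).
Proof. by have /asboolP[sm _] := valP a; exact: sm. Qed.

Let ca e : continuous (a e).
Proof. by move=> x; apply/differentiable_continuous/derivable1_diffP; exact: (sa (n := 0%N)). Qed.

Let prim0 e : prim (a e) 0 = 0.
Proof. by rewrite /prim subrr. Qed.

Let gaugeL e : gauge (a e) (len e) = 2 * pi * theta a e.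
Proof. by rewrite /gauge primE//; exact/ltW/len_gt0. Qed.

Lemma synth_end u h : synth u h.1 (position h) = amp u h + out u h.
Proof.
case: h => e [] /=; rewrite /synth /edge_wave /position /=; last first.
  by rewrite /gauge prim0 !mulr0 !oppr0 cis0; ring.
have chi_t : chi (e, true) = cis (k * len e) * cis (- gauge (a e) (len e)).
  by rewrite /chi /phase /sgn /= expr0 mul1r gaugeL cisD.
have chi_f : chi (e, false) = cis (k * len e) * cis (gauge (a e) (len e)).
  by rewrite /chi /phase /sgn /= expr1 mulN1r opprK gaugeL cisD.
rewrite /out /rev /= chi_t chi_f !cisNV.
have := cis_neq0 (k * len e); have := cis_neq0 (gauge (a e) (len e)) => c1 c2.
by field; rewrite c1 c2.
Qed.


Lemma synth1_end u h : (-1) ^+ (~~ h.2) * synth1 u h.1 (position h) =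
  'i%C * k%:C * (amp u h - out u h) -
  'i%C * (2 * pi)%:C * ((sgn h * a h.1 (position h))%:C * synth u h.1 (position h)).
Proof.
have pE x e : 0 +i* (2 * pi * a e x) = 'i%C * (2 * pi)%:C * (a e x)%:C :> R[i].
  by apply: complexP; rewrite ?ReM ?ImM /= ?ReM ?ImM /=; ring.
rewrite /synth1 /edge_wave1 pE -/(synth u h.1 (position h)).
have -> (x : R) : (sgn h * x)%:C = (-1) ^+ (~~ h.2) * x%:C :> R[i].
  by rewrite rmorphM /sgn rmorphXn rmorphN rmorph1.
rewrite mulrBr; congr (_ - _); last by ring.
case: h => e [] /=; rewrite /edge_wave_current /position /=; last first.
  by rewrite expr1 /gauge prim0 !mulr0 !oppr0 cis0; ring.
have chi_t : chi (e, true) = cis (k * len e) * cis (- gauge (a e) (len e)).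
  by rewrite /chi /phase /sgn /= expr0 mul1r gaugeL cisD.
have chi_f : chi (e, false) = cis (k * len e) * cis (gauge (a e) (len e)).
  by rewrite /chi /phase /sgn /= expr1 mulN1r opprK gaugeL cisD.
rewrite /out /rev /= chi_t chi_f !cisNV.
have := cis_neq0 (k * len e); have := cis_neq0 (gauge (a e) (len e)) => c1 c2.
by field; rewrite c1 c2.
Qed.
End Waves.
End Scattering.

(** * Multiplicities of eigenvalues *)

Section Multiplicity.
Variables (R : realType) (G : quantum_graph R) (a : Lambda1 G) (k : R).
Hypothesis k0 : k != 0.
Local Notation bond := (edge G * bool)%type.
Local Notation nb := #|{: edge G * bool}|.
Local Notation B := (bondmx (@bond_len R G) (bond_scat a) (k, 0)).
Local Notation N := ((1%:M - B)^T).
Implicit Types (u : 'rV[R[i]]_nb) (h g : bond).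

Lemma position_itv h : position h \in `[0, len h.1].
Proof.
by case: h => e [] /=; rewrite /position in_itv /= lexx ?andbT ltW ?len_gt0.
Qed.

Lemma flux_coef v : flux (fun h => a h.1 (position h)) v = 0.
Proof. by have /asboolP[_ fa] := valP a; exact: fa. Qed.

(** The part of the derivative that involves the form drops out of the flux,
    because the form itself satisfies the Kirchhoff condition. *)
Lemma flux_synth1 u v (c : R[i]) :
  (forall h, vtx h = v -> synth a k u h.1 (position h) = c) ->
  flux (fun h => synth1 a k u h.1 (position h)) v =
  'i%C * k%:C * \sum_(h | vtx h == v) (amp u h - out a k u h).
Proof.
move=> uc; rewrite /flux.
transitivity (\sum_(h | vtx h == v) ('i%C * k%:C * (amp u h - out a k u h) -
    'i%C * (2 * pi)%:C * c * (sgn h * a h.1 (position h))%:C)).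
  by apply: eq_bigr => h /eqP hv; rewrite synth1_end uc//; ring.
rewrite sumrB -!mulr_sumr -rmorph_sum.
by have := flux_coef v; rewrite /flux /= => ->; rewrite mulr0 subr0.
Qed.

Lemma stationary_eigenspace u : u *m N = 0 ->
  eigenspace a (k ^+ 2)%:C (synth a k u).
Proof.
move=> /eqP/stationaryP uS.
have sol e : exists f2 : R -> R[i],
    sobolev2 (len e) (synth a k u e) (synth1 a k u e) f2 /\
    forall x, magnetic_laplacian (a e) (synth a k u e) (synth1 a k u e) f2 x =
      (k ^+ 2)%:C * synth a k u e x.
  apply: edge_wave_solution; last exact: len_gt0.
  by have /asboolP[sm _] := valP a; exact: sm.
have [f2 f2P] := boolp.choice sol.
have val h : synth a k u h.1 (position h) =
    (2 / deg (vtx h))%:C * (\sum_(g | vtx g == vtx h) amp u g).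
  by rewrite synth_end uS addrC subrK.
exists (synth1 a k u), f2; split.
- by move=> e; case: (f2P e).
- by move=> h h' hh; rewrite !val hh.
- move=> v; rewrite (flux_synth1 (c := (2 / deg v)%:C * (\sum_(g | vtx g == v) amp u g))).
    rewrite (_ : \sum_(h | _) _ = 0) ?mulr0//.
    set S := \sum_(g | vtx g == v) amp u g.
    transitivity (2 * S - (deg v)%:C * ((2 / deg v)%:C * S)); last first.
      have d2 : deg v * (2 / deg v) = 2 by rewrite mulrC divfK ?deg_neq0.
      by rewrite mulrA -rmorphM /= d2 rmorph_nat subrr.
    transitivity (\sum_(h | vtx h == v) (2 * amp u h - (2 / deg v)%:C * S)).
      by apply: eq_bigr => h /eqP hv; rewrite uS hv -/S; ring.
    rewrite sumrB -mulr_sumr sumr_const -[X in _ - X]mulr_natl.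
    by congr (_ - _ * _); rewrite [RHS]rmorph_nat.
  by move=> h <-; exact: val.
- move=> e; apply: (aeW lebesgue_measure) => x _; exact: (f2P e).2.
Qed.

Lemma eigenspace_stationary f : eigenspace a (k ^+ 2)%:C f ->
  exists2 u, u *m N = 0 & forall e x, x \in `[0, len e] -> f e x = synth a k u e x.
Proof.
move=> [f1 [f2 [sf cf ff ef]]].
have sol e : exists ab : R[i] * R[i], forall x, x \in `[0, len e] ->
    f e x = edge_wave (a e) k ab.1 ab.2 x /\
    f1 e x = edge_wave1 (a e) k ab.1 ab.2 x.
  have sm : smooth (a e) by have /asboolP[sm _] := valP a; exact: sm.
  have [al [be h]] := edge_solution_wave sm (len_gt0 e) k0 (sf e) (ef e).
  by exists (al, be).
have [ab abP] := boolp.choice sol.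
pose chi h : R[i] := cis (k * len h.1 + phase a h).
pose u : 'rV[R[i]]_nb := \row_i (let h := enum_val i in
  if h.2 then (ab h.1).1 * chi h else (ab h.1).2).
have ampE h : amp u h = if h.2 then (ab h.1).1 * chi h else (ab h.1).2.
  by rewrite /amp mxE enum_rankK.
have outE e : out a k u (e, false) = (ab e).1.
  by rewrite /out ampE /= mulfK// cis_neq0.
have fE e x : x \in `[0, len e] -> f e x = synth a k u e x.
  by move=> xe; rewrite /synth outE ampE /=; case: (abP e x xe).
have f1E e x : x \in `[0, len e] -> f1 e x = synth1 a k u e x.
  by move=> xe; rewrite /synth1 outE ampE /=; case: (abP e x xe).
exists u => //; apply/eqP/stationaryP => h.
pose c := f h.1 (position h).
have uc g : vtx g = vtx h -> synth a k u g.1 (position g) = c.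
  by move=> gh; rewrite -fE ?position_itv//; exact: cf.
have := ff (vtx h).
rewrite (_ : flux _ _ = flux (fun h => synth1 a k u h.1 (position h)) (vtx h)); last first.
  by apply: eq_bigr => g _; rewrite f1E// position_itv.
rewrite (flux_synth1 uc) => /eqP; rewrite !mulf_eq0.
have -> : ('i%C == 0 :> R[i]) = false by apply/eqP => -[] /eqP; rewrite oner_eq0.
have -> : (k%:C == 0 :> R[i]) = false by apply/eqP => -[] /eqP; rewrite (negbTE k0).
move=> /eqP s0; have oc g : vtx g = vtx h -> out a k u g = c - amp u g.
  by move=> gh; rewrite -(uc g gh) synth_end addrC addKr.
have : \sum_(g | vtx g == vtx h) (amp u g *+ 2 - c) = 0.
  rewrite -[RHS]s0; apply: eq_bigr => g /eqP gh; rewrite oc// mulr2n; ring.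
rewrite sumrB sumr_const sumrMnl => /eqP; rewrite subr_eq0 => /eqP e.
rewrite oc//; congr (_ - _).
have dE : (deg (vtx h))%:C = #|[pred g | vtx g == vtx h]|%:R :> R[i] by rewrite [LHS]rmorph_nat.
have d0 : (deg (vtx h))%:C != 0 :> R[i].
  by apply/eqP => -[] /eqP; rewrite (negbTE (deg_neq0 _)).
apply: (mulfI d0); rewrite mulrA -rmorphM /=.
have -> : deg (vtx h) * (2 / deg (vtx h)) = 2 by rewrite mulrC divfK ?deg_neq0.
by rewrite dE mulr_natl -e rmorph_nat mulr_natl.
Qed.

(** The two waves on an edge are independent: compare their values at 0 and at a
    point of the edge where the sine of [k x] does not vanish. *)
Lemma synth_eq0 u : (forall e x, x \in `[0, len e] -> synth a k u e x = 0) -> u = 0.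
Proof.
move=> u0.
have z e : out a k u (e, false) = 0 /\ amp u (e, false) = 0.
  set al := out _ _ _ _; set be := amp _ _.
  have w x : x \in `[0, len e] -> al * cis (k * x) + be * cis (- (k * x)) = 0.
    by move=> /u0 /eqP; rewrite /synth /edge_wave mulf_eq0 (negbTE (cis_neq0 _)) => /eqP.
  have L0 := len_gt0 e; have nk : 0 < `|k| by rewrite normr_gt0.
  have := w 0; rewrite in_itv /= lexx ltW// mulr0 oppr0 cis0 !mulr1 => /(_ isT) e0.
  have ebe : be = - al by apply/eqP; rewrite -addr_eq0 addrC e0.
  pose x : R := Num.min (len e) `|k|^-1.
  have x0 : 0 < x by rewrite lt_min L0 invr_gt0.
  have xL : x <= len e by rewrite ge_min lexx.
  have xk : `|k| * x <= 1.
    have : x <= `|k|^-1 by rewrite ge_min lexx orbT.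
    by rewrite -(ler_pM2l nk) mulfV// gt_eqF.
  have s0 : sin (k * x) != 0.
    have : sin (`|k| * x) != 0.
      rewrite gt_eqF// sin_gt0_pi// mulr_gt0//= (le_lt_trans xk)//.
      by have := pi_ge2 R; lra.
    case: (ger0P k) => // _; rewrite mulNr sinN oppr_eq0//.
  have := w x; rewrite in_itv /= (ltW x0) xL => /(_ isT); rewrite ebe mulNr -mulrBr.
  move/eqP; rewrite mulf_eq0 => /orP[/eqP al0|].
    by rewrite al0 oppr0.
  rewrite cisN => /eqP/(congr1 (@complex.Im R)) /=; rewrite opprK => h.
  by case/eqP: s0; lra.
apply/rowP => i; rewrite mxE -(enum_valK i); case: (enum_val i) => e [].
  have [+ _] := z e; rewrite /out => /eqP; rewrite mulf_eq0 invr_eq0 (negbTE (cis_neq0 _)) orbF.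
  by move=> /eqP.
by have [_] := z e.
Qed.

Lemma synth_lincomb m (c : 'rV[R[i]]_m) (M : 'M[R[i]]_(m, nb)) e x :
  synth a k (c *m M) e x = \sum_i c 0 i * synth a k (row i M) e x.
Proof.
have ampE h : amp (c *m M) h = \sum_i c 0 i * amp (row i M) h.
  by rewrite /amp mxE; apply: eq_bigr => i _; rewrite mxE.
have outE h : out a k (c *m M) h = \sum_i c 0 i * out a k (row i M) h.
  by rewrite /out ampE mulr_suml; apply: eq_bigr => i _; rewrite mulrA.
rewrite /synth /edge_wave ampE outE !mulr_suml -big_split mulr_sumr /=.
by apply: eq_bigr => i _; ring.
Qed.

Lemma synthB u u' e x : synth a k (u - u') e x = synth a k u e x - synth a k u' e x.
Proof.
rewrite /synth /edge_wave /out /amp !mxE; ring.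
Qed.

Lemma kernel_rank : \rank (kermx N) = (nb - \rank (1%:M - B)%R)%N.
Proof. by rewrite mxrank_ker mxrank_tr. Qed.

(** The waves of the fixed vectors are a basis of the eigenspace. *)
Lemma multiplicity_kernel : multiplicity a (k ^+ 2)%:C (nb - \rank (1%:M - B)%R)%N.
Proof.
rewrite -kernel_rank; set K := kermx N.
have Kr i : row i (row_base K) *m N = 0.
  by apply/sub_kermxP; apply: submx_trans (row_sub _ _) _; rewrite eq_row_base.
exists (fun i => synth a k (row i (row_base K))); split.
  by move=> i; exact: stationary_eigenspace.
move=> f /eigenspace_stationary[u uN fu].
have /submxP[c uc] : (u <= row_base K)%MS by rewrite eq_row_base; apply/sub_kermxP.
exists c; split.
  by move=> e x xe; rewrite fu// uc synth_lincomb.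
move=> c' c'E; apply: (row_free_inj (row_base_free K)); rewrite -uc.
apply/eqP; rewrite -subr_eq0; apply/eqP/synth_eq0 => e x xe.
by rewrite synthB -fu// c'E// synth_lincomb subrr.
Qed.

Lemma multiplicity_unique m :
  multiplicity a (k ^+ 2)%:C m -> m = (nb - \rank (1%:M - B)%R)%N.
Proof.
move=> [b [eb ub]]; rewrite -kernel_rank; set K := kermx N.
have sol i : exists u, u *m N = 0 /\
    forall e x, x \in `[0, len e] -> b i e x = synth a k u e x.
  by have [u uN bu] := eigenspace_stationary (eb i); exists u.
have [w wP] := boolp.choice sol.
pose V : 'M[R[i]]_(m, nb) := \matrix_i w i.
have VK : (V <= K)%MS by apply/row_subP => i; rewrite rowK; apply/sub_kermxP; case: (wP i).
have synthV c e x : x \in `[0, len e] ->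
    synth a k (c *m V) e x = \sum_i c 0 i * b i e x.
  move=> xe; rewrite synth_lincomb; apply: eq_bigr => i _.
  by rewrite rowK (wP i).2.
have KV : (K <= V)%MS.
  apply/row_subP => j; have := row_sub j K; move/sub_kermxP => uN.
  have [c [cE _]] := ub _ (stationary_eigenspace uN).
  apply/submxP; exists c; apply/eqP; rewrite -subr_eq0; apply/eqP/synth_eq0 => e x xe.
  by rewrite synthB synthV// cE// subrr.
have free : row_free V.
  rewrite -kermx_eq0; apply/rowV0P => c /sub_kermxP cV.
  have z : eigenspace a (k ^+ 2)%:C (synth a k 0) by apply: stationary_eigenspace; rewrite mul0mx.
  have [c0 [_ uniq]] := ub _ z.
  have z0 e x : synth a k 0 e x = 0.
    by rewrite /synth /edge_wave /out /amp !mxE; ring.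
  rewrite -(uniq c) ?(uniq 0)// => e x xe; last by rewrite z0 -synthV// cV z0.
  by rewrite z0 big1// => i _; rewrite mxE mul0r.
have -> : \rank K = \rank V by apply/eqP; rewrite eqn_leq !mxrankS.
by move: free; rewrite /row_free => /eqP ->.
Qed.
End Multiplicity.

(** A spectrum lists positive multiplicities only; multiplicity 0 is absence. *)
Lemma Spec_kernel (R : realType) (G G' : quantum_graph R)
    (a : Lambda1 G) (a' : Lambda1 G') (k : R) : k != 0 -> Spec a = Spec a' ->
  (#|{: edge G * bool}| -
     \rank (1%:M - bondmx (@bond_len R G) (bond_scat a) (k, 0))%R)%N =
  (#|{: edge G' * bool}| -
     \rank (1%:M - bondmx (@bond_len R G') (bond_scat a') (k, 0))%R)%N.
Proof.
move=> k0 SS; set m := (_ - _)%N; set m' := (_ - _)%N.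
have mm : multiplicity a (k ^+ 2)%:C m := multiplicity_kernel a k0.
have mm' : multiplicity a' (k ^+ 2)%:C m' := multiplicity_kernel a' k0.
case: (posnP m) => [m0|mp]; last first.
  have : Spec a ((k ^+ 2)%:C, m) by [].
  by rewrite SS => -[_ /(multiplicity_unique k0)].
case: (posnP m') => [m'0|mp']; first by rewrite m0.
have : Spec a' ((k ^+ 2)%:C, m') by [].
by rewrite -SS => -[_ /(multiplicity_unique k0)].
Qed.

(** * Cycles and closed walks *)

Section Cycles.
Variables (R : realType) (G : quantum_graph R).
Local Notation bond := (edge G * bool)%type.
Local Notation C1 := 'rV[R]_#|edge G|.
Implicit Types (h g : bond) (v : vertex G) (c d : C1) (w : seq bond) (e : edge G).

Lemma chain_coefP c d : (forall e, chain_coef c e = chain_coef d e) -> c = d.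
Proof. by move=> cd; apply/rowP => i; have := cd (enum_val i); rewrite /chain_coef enum_valK. Qed.

Lemma coefB c d e : chain_coef (c - d) e = chain_coef c e - chain_coef d e.
Proof. by rewrite /chain_coef !mxE. Qed.
Lemma coefD c d e : chain_coef (c + d) e = chain_coef c e + chain_coef d e.
Proof. by rewrite /chain_coef !mxE. Qed.
Lemma coef0 e : chain_coef (0 : C1) e = 0.
Proof. by rewrite /chain_coef !mxE. Qed.
Lemma coefZ (t : R) c e : chain_coef (t *: c) e = t * chain_coef c e.
Proof. by rewrite /chain_coef !mxE. Qed.
Lemma coef_sum I (r : seq I) (P : pred I) (F : I -> C1) e :
  chain_coef (\sum_(i <- r | P i) F i) e = \sum_(i <- r | P i) chain_coef (F i) e.
Proof. by rewrite /chain_coef summxE. Qed.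

Lemma boundaryD c d v : boundary (c + d) v = boundary c v + boundary d v.
Proof.
rewrite /boundary /flux -big_split; apply: eq_bigr => h _.
by rewrite coefD mulrDr.
Qed.
Lemma boundaryZ (t : R) c v : boundary (t *: c) v = t * boundary c v.
Proof.
rewrite /boundary /flux mulr_sumr; apply: eq_bigr => h _.
by rewrite coefZ mulrCA.
Qed.
Lemma boundary0 v : boundary (0 : C1) v = 0.
Proof. by rewrite -(scale0r (0 : C1)) boundaryZ mul0r. Qed.
Lemma boundaryB c d v : boundary (c - d) v = boundary c v - boundary d v.
Proof. by rewrite boundaryD -scaleN1r boundaryZ mulN1r. Qed.
Lemma boundary_sum I (r : seq I) (P : pred I) (F : I -> C1) v :
  boundary (\sum_(i <- r | P i) F i) v = \sum_(i <- r | P i) boundary (F i) v.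
Proof. by elim/big_rec2: _ => [|i y x _ <-]; rewrite ?boundary0// boundaryD. Qed.

Definition bond_chain h : C1 := sgn h *: delta_mx 0 (enum_rank h.1).

Lemma coef_bond h e : chain_coef (bond_chain h) e = sgn h * (h.1 == e)%:R.
Proof. by rewrite coefZ /chain_coef mxE eqxx /= eq_sym (inj_eq enum_rank_inj). Qed.

Lemma sgn_rev h : sgn (rev h) = - sgn h.
Proof. by case: h => e []; rewrite /sgn /= ?expr0 ?expr1 ?opprK. Qed.

Lemma sgn_sqr h : sgn h * sgn h = 1.
Proof. by rewrite /sgn -expr2 sqrr_sign. Qed.

Lemma sgnE h : sgn h = if h.2 then 1 else -1.
Proof. by case: h => e []; rewrite /sgn /= ?expr0 ?expr1. Qed.

Lemma boundary_bond h v : boundary (bond_chain h) v = (vtx h == v)%:R - (origin h == v)%:R.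
Proof.
rewrite /boundary /flux big_mkcond (bigD1 h) //= (bigD1 (rev h)) /=; last first.
  by case: h => e []; rewrite /rev; apply/eqP => -[].
rewrite big1 => [|g /andP[gh grh]].
  rewrite addr0 !coef_bond eqxx !mulr1 -[(-1) ^+ (~~ h.2)]/(sgn h) sgn_sqr.
  rewrite -[(-1) ^+ (~~ (rev h).2)]/(sgn (rev h)) sgn_rev mulNr sgn_sqr vtx_rev.
  by case: eqP => _; case: eqP => _; rewrite ?subr0 ?sub0r ?addr0 ?add0r.
case: ifP => // _; rewrite coef_bond; case: eqP => [hg|_]; last by rewrite !mulr0.
have : (g == h) || (g == rev h).
  by case: g h hg {gh grh} => e b [e' b'] /= ->; rewrite /rev !xpair_eqE eqxx /=; case: b b' => [] [].
by rewrite (negbTE gh) (negbTE grh).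
Qed.

Definition follows : rel bond := fun b b' => terminus b == origin b'.

Definition walk_chain w : C1 := \sum_(h <- w) bond_chain h.

Lemma boundary_walk w v : cycle follows w ->
  boundary (walk_chain w) v = 0.
Proof.
case: w => [|h w]; first by rewrite /walk_chain big_nil boundary0.
have pathB h0 w0 : path follows h0 w0 ->
    boundary (walk_chain w0) v = (vtx (last h0 w0) == v)%:R - (vtx h0 == v)%:R.
  elim: w0 h0 => [|h1 w0 IH] h0 /=; first by rewrite /walk_chain big_nil boundary0 subrr.
  move=> /andP[/eqP h01 p]; rewrite /walk_chain big_cons boundaryD -/(walk_chain w0).
  by rewrite (IH h1 p) boundary_bond -h01 /terminus; ring.
rewrite /cycle rcons_path => /andP[p /eqP e].
rewrite /walk_chain big_cons boundaryD -/(walk_chain w) (pathB h w p) boundary_bond -e.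
by rewrite /terminus; ring.
Qed.

Definition lattice c := (forall v, boundary c v = 0) /\ (forall e, chain_coef c e \is a Num.int).

Lemma latticeB c d : lattice c -> lattice d -> lattice (c - d).
Proof.
move=> [bc ic] [bd id]; split => [v|e]; first by rewrite boundaryB bc bd subrr.
by rewrite coefB rpredB.
Qed.
Lemma lattice0 : lattice 0.
Proof. by split=> [v|e]; rewrite ?boundary0 ?coef0. Qed.
Lemma latticeD c d : lattice c -> lattice d -> lattice (c + d).
Proof. by move=> lc ld; rewrite -[d]opprK -[- d]sub0r; apply: latticeB => //; apply: latticeB => //; exact: lattice0. Qed.

Lemma lattice_walk w : cycle follows w -> lattice (walk_chain w).
Proof.
move=> cw; split => [v|e]; first exact: boundary_walk.
rewrite coef_sum rpred_sum// => h _; rewrite coef_bond /sgn.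
by rewrite rpredM ?rpredX ?rpredN ?rpred1 ?rpred_nat.
Qed.

(** Every nonzero flow is positive along the bonds of a simple closed walk:
    conservation provides an outgoing bond at every vertex that is reached. *)
Lemma flow_cycle c : (forall v, boundary c v = 0) -> c != 0 ->
  exists w, [/\ w != [::], cycle follows w,
    {in w &, injective (@origin R G)}, uniq w &
    forall h, h \in w -> 0 < sgn h * chain_coef c h.1].
Proof.
move=> bc c0; pose P h := 0 < sgn h * chain_coef c h.1.
have nextP h : P h -> exists h', P h' && (origin h' == vtx h).
  move=> Ph; apply: contrapT => no.
  have := bc (vtx h); rewrite /boundary /flux (bigD1 h) //= => s0.
  have : 0 <= \sum_(i | (vtx i == vtx h) && (i != h)) (-1) ^+ (~~ i.2) * chain_coef c i.1.
    apply: sumr_ge0 => g /andP[/eqP gh _]; rewrite leNgt; apply/negP => g0.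
    apply: no; exists (rev g); rewrite origin_rev gh eqxx andbT /P sgn_rev mulNr oppr_gt0.
    exact: g0.
  by move: Ph s0; rewrite /P /sgn => Ph s0; lra.
pose nx h := odflt h [pick h' | P h' && (origin h' == vtx h)].
have nxP h : P h -> P (nx h) /\ origin (nx h) = vtx h.
  move=> Ph; rewrite /nx; case: pickP => [h' /andP[? /eqP]|no] //.
  by have [h'] := nextP h Ph; rewrite no.
have nxE h h' : P h -> P h' -> vtx h = vtx h' -> nx h = nx h'.
  move=> Ph Ph' hh; rewrite /nx hh; case: pickP => // no.
  by have [g] := nextP h' Ph'; rewrite no.
have [h0 Ph0] : exists h, P h.
  have /existsP[e e0] : [exists e, chain_coef c e != 0].
    apply: contraT => /existsPn z; case/eqP: c0; apply: chain_coefP => e.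
    by have := z e; rewrite negbK coef0 => /eqP.
  exists (e, 0 < chain_coef c e); rewrite /P sgnE /=.
  by case: (ltP 0 (chain_coef c e)) => [?|ce]; rewrite ?mul1r// mulN1r oppr_gt0 lt_neqAle e0.
have Pit n : P (iter n nx h0) by elim: n => //= n /nxP[].
have /trajectP[i io iE] : looping nx h0 (fingraph.order nx h0) by exact: looping_order.
pose y := iter i nx h0; pose p := (fingraph.order nx h0 - i).-1.
have pE : fingraph.order nx h0 = (i + p.+1)%N by rewrite /p prednK ?subn_gt0// subnKC// ltnW.
have yp : iter p.+1 nx y = y by rewrite /y -iterD addnC -pE iE.
have uy : uniq (traject nx y p.+1).
  have := orbit_uniq nx h0; rewrite /orbit pE trajectD cat_uniq => /and3P[_ _].
  by [].
have Pw h : h \in traject nx y p.+1 -> P h.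
  by move=> /trajectP[j _ ->]; rewrite /y -iterD.
exists (traject nx y p.+1); split => //.
- rewrite /= rcons_path.
  have pth n x : (forall j, P (iter j nx x)) ->
      path follows x (traject nx (nx x) n).
    elim: n x => //= n IH x Px; apply/andP; split.
      by rewrite /follows /terminus (nxP x (Px 0%N)).2.
    by apply: IH => j; rewrite -iterSr; exact: Px.
  apply/andP; split; first by apply: pth => j; rewrite /y -iterD.
  rewrite last_traject /follows /terminus -[X in origin X]yp iterS.
  by have /nxP[_ ->] : P (iter p nx y) by rewrite /y -iterD.
- move=> h h' /trajectP[j jp ->] /trajectP[j' j'p ->].
  have pred n : (n < p.+1)%N -> exists m, iter n nx y = nx (iter m nx y).
    case: n => [_|n _]; last by exists n.
    by exists p; rewrite -iterS yp.
  have [m ->] := pred j jp; have [m' ->] := pred j' j'p.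
  have Py n : P (iter n nx y) by rewrite /y -iterD.
  rewrite (nxP _ (Py m)).2 (nxP _ (Py m')).2; exact: nxE.
Qed.

Lemma coef_positive_walk c w e : uniq w ->
  (forall h, h \in w -> 0 < sgn h * chain_coef c h.1) ->
  chain_coef (walk_chain w) e =
    if (e, 0 < chain_coef c e) \in w then Num.sg (chain_coef c e) else 0.
Proof.
move=> uw Pw.
have own h : h \in w -> h = (h.1, 0 < chain_coef c h.1).
  case: h => e' [] /Pw; rewrite /sgn /= ?expr0 ?expr1 ?mul1r; first by move=> ->.
  by rewrite mulN1r oppr_gt0 => h; rewrite ltNge (ltW h).
rewrite coef_sum; case: ifP => [ew|ew].
  rewrite (bigD1_seq _ ew uw) /= big1_seq; last first.
    move=> h /andP[he hw]; rewrite coef_bond; case: (h.1 =P e) => [e1|_]; last by rewrite mulr0.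
    by move: he; rewrite {1}(own h hw) e1 eqxx.
  rewrite addr0 coef_bond eqxx mulr1; have := Pw _ ew; rewrite /sgn /=.
    case: (ltgtP (chain_coef c e) 0) => [n|n|->]; last by rewrite mulr0 ltxx.
      by rewrite ltr0_sg.
    by rewrite gtr0_sg.
rewrite big1_seq// => h /andP[_ hw]; rewrite coef_bond; case: (h.1 =P e) => [e1|_]; last by rewrite mulr0.
by move: (hw); rewrite (own h hw) e1 ew.
Qed.

(** The length of a cycle; unlike the inner product, it can be read off from
    the secular function. *)
Definition norm1 c : R := \sum_e len e * `|chain_coef c e|.


Lemma norm1D c d : norm1 (c + d) <= norm1 c + norm1 d.
Proof.
rewrite -big_split /=; apply: ler_sum => e _.
by rewrite coefD -mulrDr ler_wpM2l ?ler_normD// ltW ?len_gt0.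
Qed.

Lemma norm1_eq0 c : norm1 c = 0 -> c = 0.
Proof.
move=> /eqP; rewrite psumr_eq0 => [/allP z|e _]; last by rewrite mulr_ge0// ltW ?len_gt0.
apply: chain_coefP => e; have := z e; rewrite mem_index_enum => /(_ isT).
by rewrite mulf_eq0 gt_eqF ?len_gt0// normr_eq0 coef0 => /eqP.
Qed.

(** Equality in the triangle inequality holds for each edge separately. *)
Lemma norm1_additive c d : norm1 c = norm1 d + norm1 (c - d) ->
  forall e, `|chain_coef c e| = `|chain_coef d e| + `|chain_coef (c - d) e|.
Proof.
move=> /eqP; rewrite eq_sym -subr_eq0 -big_split -sumrB /= psumr_eq0 => [/allP z e|e _].
  have := z e; rewrite mem_index_enum => /(_ isT).
  rewrite -mulrDr -mulrBr mulf_eq0 gt_eqF ?len_gt0//= subr_eq0 => /eqP <-.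
  by [].
rewrite -mulrDr -mulrBr mulr_ge0 ?(ltW (len_gt0 _))// subr_ge0.
by rewrite -[X in `|X| <= _](subrK (chain_coef d e)) -coefB addrC ler_normD.
Qed.

(** A characterization of the simple cycles in terms of the lattice and its norm
    alone. *)
Definition indecomposable c := [/\ lattice c, c != 0 &
  forall d, lattice d -> norm1 c = norm1 d + norm1 (c - d) -> d = 0 \/ d = c].

(** The simple closed walk of [flow_cycle] splits off with additive norm. *)
Lemma indecomposable_walk c : indecomposable c ->
  exists w, [/\ cycle follows w,
    {in w &, injective (@origin R G)}, uniq w,
    forall h, h \in w -> 0 < sgn h * chain_coef c h.1 & c = walk_chain w].
Proof.
move=> [lc c0 ind]; have [w [w0 cw iw uw Pw]] := flow_cycle lc.1 c0.
exists w; split => //; have lw := lattice_walk cw.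
have coefw e := coef_positive_walk e uw Pw.
have [|h|//] := ind (walk_chain w) lw.
  rewrite /norm1 -big_split /=; apply: eq_bigr => e _; rewrite -mulrDr; congr (_ * _).
  rewrite coefB coefw; case: ifP => [ew|_]; last by rewrite normr0 subr0 add0r.
  have ce0 : chain_coef c e != 0.
    by apply/eqP => z; have := Pw _ ew; rewrite /= z mulr0 ltxx.
  have ce1 : 1 <= `|chain_coef c e|.
    by apply: norm_intr_ge1; [exact: lc.2|].
  rewrite normr_sg ce0 /=.
  have [n|n] := leP 0 (chain_coef c e).
    rewrite ger0_norm// in ce1 *; rewrite gtr0_sg ?lt_neqAle ?n ?andbT 1?eq_sym// ger0_norm ?subr_ge0//.
    idtac; ring.
  rewrite ltr0_norm// in ce1 *; rewrite ltr0_sg// opprK ler0_norm; first by ring.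
  lra.
case: w w0 {cw iw} uw Pw lw h coefw => // h w _ uw Pw _ h0 coefw.
have := coefw h.1; rewrite h0 coef0; have := Pw h; rewrite inE eqxx => /(_ isT) Ph.
have -> : (h.1, 0 < chain_coef c h.1) = h.
  case: h Ph {Pw uw h0 coefw} => e' []; rewrite /sgn /= ?expr0 ?expr1 ?mul1r; first by move=> ->.
  by rewrite mulN1r oppr_gt0 => h; rewrite ltNge (ltW h).
rewrite inE eqxx => /eqP; rewrite eq_sym sgr_eq0 => /eqP z.
by move: Ph; rewrite z mulr0 ltxx.
Qed.

Lemma indecomposable_coef c e : indecomposable c ->
  chain_coef c e = Num.sg (chain_coef c e).
Proof.
move=> ic; have [w [_ _ uw Pw cE]] := indecomposable_walk ic.
rewrite {1}cE (coef_positive_walk e uw Pw); case: ifP => // ew.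
have := coef_positive_walk e uw Pw; rewrite ew -cE => ->; by rewrite sgr0.
Qed.

(** Decompositions with additive norm terminate: the entries are integers, and
    the sum of their absolute values is additive too. *)
Lemma lattice_ind (P : C1 -> Prop) : P 0 -> (forall c, indecomposable c -> P c) ->
  (forall c d, lattice c -> lattice d -> norm1 (c + d) = norm1 c + norm1 d ->
     P c -> P d -> P (c + d)) ->
  forall c, lattice c -> P c.
Proof.
move=> P0 Pi PD c lc.
have [n cn] : exists n : nat, \sum_e `|chain_coef c e| <= n%:R.
  exists (Num.bound (\sum_e `|chain_coef c e|)).
  by apply/ltW/archi_boundP/sumr_ge0.
elim: n c lc cn => [|n IH] c lc cn.
  suff -> : c = 0 by [].
  apply: chain_coefP => e; rewrite coef0; apply/eqP; rewrite -normr_le0.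
  by apply: le_trans cn; rewrite (bigD1 e)//= lerDl sumr_ge0.
have [->//|c0] := eqVneq c 0.
have [ic|nic] := pselect (indecomposable c); first exact: Pi.
have [d [ld dE d0 dc]] : exists d, [/\ lattice d, norm1 c = norm1 d + norm1 (c - d), d != 0 & d != c].
  apply: contrapT => no; apply: nic; split => // d ld dE.
  have [->|d0] := eqVneq d 0; first by left.
  have [->|dc] := eqVneq d c; first by right.
  by exfalso; apply: no; exists d.
have lcd : lattice (c - d) by exact: latticeB.
have abs := norm1_additive dE.
have pos x : lattice x -> x != 0 -> 1 <= \sum_e `|chain_coef x e|.
  move=> lx x0; have /existsP[e e0] : [exists e, chain_coef x e != 0].
    apply: contraT => /existsPn z; case/eqP: x0; apply: chain_coefP => e.
    by have := z e; rewrite negbK coef0 => /eqP.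
  rewrite (bigD1 e)//= ler_wpDr ?sumr_ge0//.
  by apply: norm_intr_ge1; [exact: lx.2|].
have split : \sum_e `|chain_coef c e| = \sum_e `|chain_coef d e| + \sum_e `|chain_coef (c - d) e|.
  by rewrite -big_split /=; apply: eq_bigr => e _; exact: abs.
have p1 := pos d ld d0; have p2 := pos (c - d) lcd ltac:(by rewrite subr_eq0 eq_sym).
rewrite -natr1 in cn.
have -> : c = d + (c - d) by rewrite addrC subrK.
by apply: PD => //; [rewrite addrC subrK|apply: IH => //; lra|apply: IH => //; lra].
Qed.
End Cycles.

Section Inner.
Variables (R : realType) (G : quantum_graph R).
Implicit Types c d : 'rV[R]_#|edge G|.

Lemma innerDl c c' d : inner (c + c') d = inner c d + inner c' d.
Proof. by rewrite -big_split /=; apply: eq_bigr => e _; rewrite coefD; ring. Qed.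
Lemma innerC c d : inner c d = inner d c.
Proof. by apply: eq_bigr => e _; ring. Qed.
Lemma innerZl (t : R) c d : inner (t *: c) d = t * inner c d.
Proof. by rewrite mulr_sumr; apply: eq_bigr => e _; rewrite coefZ; ring. Qed.
Lemma inner0l d : inner 0 d = 0.
Proof. by rewrite -(scale0r (0 : 'rV_#|edge G|)) innerZl mul0r. Qed.
Lemma inner_suml I (r : seq I) (P : pred I) (F : I -> 'rV[R]_#|edge G|) d :
  inner (\sum_(i <- r | P i) F i) d = \sum_(i <- r | P i) inner (F i) d.
Proof. exact: (big_morph (fun c => inner c d) (fun x y => innerDl x y d) (inner0l d)). Qed.

Lemma inner_eq0 c : inner c c = 0 -> c = 0.
Proof.
move=> /eqP; rewrite psumr_eq0 => [/allP z|e _]; last first.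
  by rewrite -mulrA mulr_ge0 ?(ltW (len_gt0 _))// -expr2 sqr_ge0.
apply: chain_coefP => e; have := z e; rewrite mem_index_enum => /(_ isT).
by rewrite -mulrA mulf_eq0 gt_eqF ?len_gt0//= mulf_eq0 orbb coef0 => /eqP.
Qed.

(** For x and y among -1, 0 and 1, |x + y| - |x - y| = 2 x y. *)
Lemma inner_norm1 c d : indecomposable c -> indecomposable d ->
  inner c d = (norm1 (c + d) - norm1 (c - d)) / 2.
Proof.
move=> ic id; rewrite /norm1 -sumrB mulr_suml; apply: eq_bigr => e _.
rewrite coefB coefD (indecomposable_coef e ic) (indecomposable_coef e id).
set x := chain_coef c e; set y := chain_coef d e.
have n2 : `|2 : R| = 2 by rewrite ger0_norm.
have e2 : 1 + 1 = 2 :> R by [].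
have em : -1 - 1 = - 2 :> R by rewrite -opprD.
by case: (sgrP x) => _; case: (sgrP y) => _;
  rewrite ?addr0 ?add0r ?subr0 ?sub0r ?opprK ?subrr ?addNr ?normrN ?normr0 ?normr1 ?e2 ?em ?normrN ?n2; field.
Qed.
End Inner.

(** * Sets of bonds *)

Section BondSets.
Variables (R : realType) (G : quantum_graph R).
Local Notation bond := (edge G * bool)%type.
Local Notation C1 := 'rV[R]_#|edge G|.
Local Notation nb := #|{: edge G * bool}|.
Implicit Types (h g : bond) (v : vertex G) (c d : C1) (w : seq bond) (e : edge G).
Implicit Types (A : {set bond}) (a : Lambda1 G).

Definition hop : 'M[R]_nb := \matrix_(i, j) scat (enum_val i) (enum_val j).
Definition ranks A : {set 'I_nb} := [set i | enum_val i \in A]%SET.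
(** The coefficient of the term of [A] in the expansion of the secular function;
    [hop] is the scattering matrix without its phases. *)
Definition cycle_coef A : R := principal_coef hop (ranks A).
Definition total_len A : R := \sum_(h in A) len h.1.
Definition bond_sum A : C1 := \sum_(h in A) bond_chain h.

Lemma sum_ranks (V : nmodType) (F : bond -> V) A :
  \sum_(i in ranks A) F (enum_val i) = \sum_(h in A) F h.
Proof.
rewrite [RHS](reindex_onto (@enum_val bond predT) enum_rank) /=; last first.
  by move=> g _; rewrite enum_rankK.
by apply: eq_bigl => i; rewrite inE enum_valK eqxx andbT.
Qed.

Lemma ranksK (B : {set 'I_nb}) : ranks [set h | enum_rank h \in B]%SET = B.
Proof. by apply/setP => i; rewrite !inE enum_valK. Qed.

Lemma coef_bond_sum A e :
  chain_coef (bond_sum A) e = ((e, true) \in A)%:R - ((e, false) \in A)%:R.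
Proof.
rewrite coef_sum big_mkcond (bigD1 (e, true)) //= (bigD1 (e, false)) /=; last by rewrite xpair_eqE andbF.
rewrite big1.
  rewrite addr0 !coef_bond !sgnE /= !eqxx !mulr1.
  by case: ifP => _; case: ifP => _; rewrite /=; ring.
move=> [e' b] /andP[]; case: ifP => // _; rewrite coef_bond /=.
by case: (e' =P e) => [->|_]; rewrite ?mulr0//; case: b; rewrite eqxx.
Qed.

Lemma total_lenE A :
  total_len A = \sum_e len e * (((e, true) \in A)%:R + ((e, false) \in A)%:R).
Proof.
rewrite /total_len big_mkcond.
transitivity (\sum_p (fun e b => if (e, b) \in A then len e else 0) p.1 p.2).
  by apply: eq_bigr => -[e b].
rewrite -(pair_bigA _ (fun e b => if (e, b) \in A then len e else 0)) /=.
apply: eq_bigr => e _; rewrite big_bool /= mulrDr.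
by do 2 case: ifP => _; rewrite /= ?mulr1 ?mulr0.
Qed.


Lemma total_len_eq0 A : total_len A = 0 -> A = finset.set0.
Proof.
move=> /eqP; rewrite psumr_eq0 => [/allP z|h _]; last by rewrite ltW ?len_gt0.
apply/setP => h; rewrite finset.in_set0; apply/negP => hA.
by have := z h; rewrite mem_index_enum hA gt_eqF ?len_gt0// => /(_ isT).
Qed.

Lemma total_len0 : total_len finset.set0 = 0.
Proof. by rewrite /total_len big_set0. Qed.
Lemma bond_sum0 : bond_sum finset.set0 = 0.
Proof. by rewrite /bond_sum big_set0. Qed.
Lemma cycle_coef0 : cycle_coef finset.set0 = 1.
Proof.
rewrite /cycle_coef; have -> : ranks finset.set0 = finset.set0.
  by apply/setP => i; rewrite !inE.
exact: principal_coef0.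
Qed.

Lemma norm1_bond_sum A : norm1 (bond_sum A) <= total_len A.
Proof.
rewrite total_lenE; apply: ler_sum => e _; rewrite ler_wpM2l ?(ltW (len_gt0 _))//.
rewrite coef_bond_sum (le_trans (ler_normB _ _))// !ger0_norm//.
Qed.

Definition positive_bonds c : {set bond} := [set h | 0 < sgn h * chain_coef c h.1]%SET.

(** Equality of the lengths means that [A] uses no edge in both directions; the
    signs of the sum then determine [A]. *)
Lemma tight_bond_sum A : total_len A = norm1 (bond_sum A) ->
  A = positive_bonds (bond_sum A).
Proof.
rewrite total_lenE => /eqP; rewrite -subr_eq0 -sumrB psumr_eq0 => [/allP z|e _]; last first.
  rewrite -mulrBr mulr_ge0 ?(ltW (len_gt0 _))// subr_ge0.
  by rewrite coef_bond_sum (le_trans (ler_normB _ _))// !ger0_norm//.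
apply/setP => -[e b]; rewrite inE /= sgnE /= coef_bond_sum.
have := z e; rewrite mem_index_enum => /(_ isT).
rewrite -mulrBr mulf_eq0 gt_eqF ?len_gt0//= subr_eq0 coef_bond_sum.
case: ((e, true) \in A) / boolP => et; case: ((e, false) \in A) / boolP => ef; case: b;
  rewrite ?(negbTE et) ?(negbTE ef) ?et ?ef /= ?subrr ?subr0 ?sub0r ?mul1r ?mulr0 ?mulN1r ?opprK ?ltxx ?ltr01 ?oppr_gt0 ?ltr10 //=.
all: rewrite normr0 => /eqP h; exfalso; lra.
Qed.


Lemma hop_vtx i j : hop i j != 0 -> origin (enum_val i) = vtx (enum_val j).
Proof. by rewrite mxE /scat; case: (_ =P vtx _) => // _; rewrite eqxx. Qed.

(** A permutation that contributes to the minor on [A] matches the origins of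
    the bonds of [A] with their ends. *)
Lemma cycle_coef_lattice A : cycle_coef A != 0 -> lattice (bond_sum A).
Proof.
move=> A0; have [s sP] : exists s : 'S_nb, forall i, if i \in ranks A then hop i (s i) != 0 else s i == i.
  apply: contrapT => no; move: A0; rewrite /cycle_coef /principal_coef /determinant big1 ?eqxx// => s _.
  have [i iP] : exists i, ~ (if i \in ranks A then hop i (s i) != 0 else s i == i).
    by apply: contrapT => no'; apply: no; exists s => i; apply: contrapT => ?; apply: no'; exists i.
  rewrite (bigD1 i)//= mxE; move: iP; case: ifP => _.
    by move=> /negP; rewrite negbK => /eqP ->; rewrite oppr0 mul0r mulr0.
  by move=> /negP; rewrite eq_sym => /negbTE ->; rewrite mul0r mulr0.
split=> [v|e]; last by rewrite coef_bond_sum rpredB ?rpred_nat.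
rewrite boundary_sum -(sum_ranks (fun h => boundary (bond_chain h) v)).
transitivity (\sum_i ((vtx (enum_val i) == v)%:R - (vtx (enum_val (s i)) == v)%:R) : R).
  rewrite big_mkcond; apply: eq_bigr => i _; have := sP i; case: ifP => _.
    by move=> /hop_vtx o; rewrite boundary_bond o.
  by move=> /eqP ->; rewrite subrr.
rewrite sumrB; apply/eqP; rewrite subr_eq0; apply/eqP.
by rewrite [LHS](reindex_inj (@perm_inj _ s)).
Qed.

Lemma coef_positive_bonds c h : h \in positive_bonds c -> chain_coef c h.1 != 0.
Proof. by rewrite inE => P; apply/eqP => z; move: P; rewrite z mulr0 ltxx. Qed.

Lemma positive_bondsE c : (forall e, chain_coef c e = Num.sg (chain_coef c e)) ->
  bond_sum (positive_bonds c) = c /\ total_len (positive_bonds c) = norm1 c.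
Proof.
move=> c1; split.
  apply: chain_coefP => e; rewrite coef_bond_sum !inE /= !sgnE /= mul1r mulN1r oppr_gt0 [RHS]c1.
  by case: (ltgtP 0 (chain_coef c e)) => [n|n|<-];
    rewrite ?(gtr0_sg n) ?(ltr0_sg n) ?(lt_gtF n) ?n ?sgr0 ?ltxx /= ?subr0 ?sub0r.
rewrite total_lenE /norm1; apply: eq_bigr => e _; congr (_ * _).
rewrite !inE /= !sgnE /= mul1r mulN1r oppr_gt0 [X in `|X|]c1.
by case: (ltgtP 0 (chain_coef c e)) => [n|n|<-];
  rewrite ?(gtr0_sg n) ?(ltr0_sg n) ?(lt_gtF n) ?n ?sgr0 ?ltxx ?normrN ?normr1 ?normr0 /= ?addr0 ?add0r.
Qed.

(** In the minor on the bonds of a simple cycle only the cyclic permutation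
    contributes, and no back-scattering occurs. *)
Lemma cycle_coef_indecomposable c : indecomposable c ->
  cycle_coef (positive_bonds c) != 0.
Proof.
move=> ic; have [w [cw iw uw Pw cE]] := indecomposable_walk ic.
have wE h : (h \in positive_bonds c) = (h \in w).
  apply/idP/idP => [hc|/Pw]; last by rewrite inE.
  have := coef_positive_walk h.1 uw Pw; rewrite -cE.
  have -> : (h.1, 0 < chain_coef c h.1) = h.
    case: h hc => e []; rewrite inE sgnE /= ?mul1r ?mulN1r ?oppr_gt0; first by move=> ->.
    by move=> n; rewrite ltNge (ltW n).
  by case: ifP => // _ z; have := coef_positive_bonds hc; rewrite z eqxx.
have vw : {in w &, injective (@vtx R G)}.
  move=> x y xw yw xy; apply: (can_inj (prev_next uw)); apply: iw; rewrite ?mem_next//.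
  have /eqP <- := next_cycle cw xw; have /eqP <- := next_cycle cw yw; exact: xy.
set B := positive_bonds c in wE *.
pose f (i : 'I_nb) := if i \in ranks B then enum_rank (prev w (enum_val i)) else i.
have fB i : (f i \in ranks B) = (i \in ranks B).
  rewrite /f; case: ifP => // iB; rewrite inE enum_rankK wE mem_prev -wE.
  by move: iB; rewrite inE.
have f_inj : injective f.
  move=> i j fij; have := fB i; rewrite fij fB => ij; move: fij; rewrite /f ij; case: ifP => // iB.
  move=> /enum_rank_inj/(can_inj (next_prev uw)); exact: enum_val_inj.
pose s0 := perm f_inj.
rewrite /cycle_coef /principal_coef /determinant (bigD1 s0)//= [X in _ + X]big1 => [|s ss0].
  rewrite addr0 mulf_neq0 ?signr_eq0//; apply/prodf_neq0 => i _; rewrite mxE permE /f.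
  case: ifP => iB; rewrite ?iB; last by rewrite eqxx oner_eq0.
  rewrite mxE enum_rankK; set h := enum_val i; have hw : h \in w by rewrite -wE; move: iB; rewrite inE.
  have /eqP e := prev_cycle cw hw; rewrite /scat -e eqxx.
  case: (prev w h =P rev h) => [r|_]; last by rewrite subr0 oppr_eq0 mulf_neq0 ?invr_eq0 ?deg_neq0// pnatr_eq0.
  have p1 := Pw _ hw; have := Pw (prev w h); rewrite mem_prev => /(_ hw).
  by rewrite r sgn_rev /= mulNr oppr_gt0 ltNge (ltW p1).
apply/eqP; rewrite mulf_eq0 signr_eq0 /=; apply/negPn/negP => /prodf_neq0 nz.
case/eqP: ss0; apply/permP => i; rewrite permE /f.
have out j : j \notin ranks B -> s j = j.
  move=> jB; have := nz j isT; rewrite mxE (negbTE jB).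
  by case: (j =P s j) => [//|_]; rewrite eqxx.
case: ifP => iB; last by apply: out; rewrite iB.
have sB : s i \in ranks B.
  by apply: contraT => n; have := out _ n => /perm_inj e; move: n; rewrite e iB.
have := nz i isT; rewrite mxE iB oppr_eq0 => /hop_vtx o.
apply: enum_val_inj; rewrite enum_rankK; apply: vw.
- by rewrite -wE; move: sB; rewrite inE.
- by rewrite mem_prev -wE; move: iB; rewrite inE.
rewrite -o; have iw' : enum_val i \in w by rewrite -wE; move: iB; rewrite inE.
by have /eqP := prev_cycle cw iw'.
Qed.

Lemma walk_bond_sum w : uniq w -> walk_chain w = bond_sum [set h in w]%SET.
Proof.
move=> uw; rewrite /walk_chain /bond_sum big_uniq//.
by apply: eq_bigl => h; rewrite inE.
Qed.

(** Removing from a cycle the largest multiple of a simple closed walk along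
    it that keeps all signs shrinks its support. *)
Lemma lattice_frame : exists m (M : 'M[R]_(m, #|edge G|)),
  [/\ forall i, lattice (row i M),
      forall c, (forall v, boundary c v = 0) -> (c <= M)%MS &
      forall c, indecomposable c -> exists i, c = row i M].
Proof.
pose r (i : 'I_#|{: {set bond}}|) := let c := bond_sum (enum_val i) in
  if `[< lattice c >] then c else 0.
exists _, (\matrix_i r i); pose M := \matrix_i r i.
have rM B : lattice (bond_sum B) -> row (enum_rank B) M = bond_sum B.
  by move=> /asboolP lB; rewrite rowK /r enum_rankK lB.
split => [i|c bc|c ic]; last first.
- exists (enum_rank (positive_bonds c)); have [lc _ _] := ic.
  have [cB _] := positive_bondsE (fun e => indecomposable_coef e ic).
  by rewrite rM cB.
- have [n] : exists n, (#|[set e | chain_coef c e != 0%R]%SET| <= n)%N by exists #|edge G|; exact: max_card.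
  elim: n c bc => [|n IH] c bc.
    rewrite leqn0 cards_eq0 => /eqP z; suff -> : c = 0 by exact: sub0mx.
    apply: chain_coefP => e; apply/eqP; rewrite coef0; apply: contraT => e0.
    by have := finset.in_set0 e; rewrite -z inE e0.
  move=> cn; have [->|c0] := eqVneq c 0; first exact: sub0mx.
  have [w [w0 cw iw uw Pw]] := flow_cycle bc c0.
  have [h0 h0w h0min] : exists2 h0, h0 \in w & forall h, h \in w -> `|chain_coef c h0.1| <= `|chain_coef c h.1|.
    case: w w0 {cw iw uw Pw} => // h1 w _.
    have h1w : h1 \in h1 :: w by rewrite inE eqxx.
    case: (@arg_minP _ R _ h1 [in h1 :: w] (fun h => `|chain_coef c h.1|) h1w) => h0 ? ?.
    by exists h0.
  set t := `|chain_coef c h0.1|.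
  have lw := lattice_walk cw.
  rewrite -(subrK (t *: walk_chain w) c) addmx_sub//; last first.
    rewrite scalemx_sub// walk_bond_sum// -rM ?row_sub//.
    by rewrite -walk_bond_sum.
  have coefw e := coef_positive_walk e uw Pw.
  apply: IH => [v|]; first by rewrite boundaryB boundaryZ lw.1 mulr0 subr0.
  rewrite -ltnS (leq_trans _ cn)// proper_card//; apply/properP; split.
    apply/fintype.subsetP => e; rewrite !inE coefB coefZ coefw; apply: contraNneq => ->.
    by rewrite sgr0; case: ifP => _; rewrite mulr0 subr0.
  exists h0.1; rewrite !inE; first by apply/eqP => z; have := Pw _ h0w; rewrite z mulr0 ltxx.
  rewrite coefB coefZ coefw negbK.
  have -> : (h0.1, 0 < chain_coef c h0.1) = h0.
    case: h0 h0w {t h0min} => e [] /Pw; rewrite sgnE /= ?mul1r ?mulN1r ?oppr_gt0; first by move=> ->.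
    by move=> n1; rewrite ltNge (ltW n1).
  by rewrite h0w mulrC -numEsg subrr.
by rewrite rowK /r; case: asboolP => // _; exact: lattice0.
Qed.
End BondSets.

(** * Independence of characters *)

(** Dedekind's argument: translating the relation by a point that separates the
    character [X i0] from another one, and subtracting a multiple of the
    relation, eliminates the latter and keeps the former.  Indices with the same
    character as [i0] stay together. *)
Lemma characters_independent (F : fieldType) (V : zmodType) (S : V -> Prop)
    (I : finType) (P : pred I) (c : I -> F) (X : I -> V -> F) (i0 : I) :
  (forall s t, S s -> S t -> S (s + t)) ->
  (forall i s t, P i -> S s -> S t -> X i (s + t) = X i s * X i t) ->
  (exists2 s, S s & X i0 s != 0) ->
  (forall s, S s -> \sum_(i | P i) c i * X i s = 0) -> P i0 ->
  \sum_(i | P i && `[< forall s, S s -> X i s = X i0 s >]) c i = 0.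
Proof.
move=> SD XD [s0 Ss0 X0] rel Pi0.
pose same i := `[< forall s, S s -> X i s = X i0 s >].
have sep i : exists s, ~~ same i -> S s /\ X i s != X i0 s.
  have [si|/asboolPn/existsNP[s /not_implyP[Ss /eqP d]]] := boolP (same i); first by exists 0.
  by exists s.
have [p pP] := boolp.choice sep.
pose bad := [seq i <- enum I | ~~ same i].
have step r : {subset r <= bad} ->
    forall s, S s -> \sum_(i | P i) c i * (\prod_(j <- r) (X i (p j) - X j (p j))) * X i s = 0.
  elim: r => [|j r IH] sub s Ss.
    by under eq_bigr do rewrite big_nil mulr1; exact: rel.
  have jb : ~~ same j by have := sub j; rewrite inE eqxx mem_filter => /(_ isT) /andP[].
  have [Sj _] := pP j jb.
  have sub' : {subset r <= bad} by move=> i ir; apply: sub; rewrite inE ir orbT.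
  have e1 := IH sub' _ (SD _ _ Sj Ss); have e2 := IH sub' _ Ss.
  transitivity (0 - X j (p j) * (0 : F)); last by rewrite mulr0 subr0.
  rewrite -[X in _ = X - _]e1 -[X in _ = _ - _ * X]e2 mulr_sumr -sumrB; apply: eq_bigr => i Pi.
  by rewrite big_cons XD//; ring.
have := step bad (fun _ => id) s0 Ss0.
rewrite (bigID same) /= [X in _ + X]big1 => [|i /andP[Pi si]]; last first.
  have ib : i \in bad by rewrite mem_filter si mem_enum.
  by rewrite (bigD1_seq i ib (filter_uniq _ (enum_uniq _))) /= subrr mul0r mulr0 mul0r.
rewrite addr0.
rewrite (eq_bigr (fun i => c i * (\prod_(j <- bad) (X i0 (p j) - X j (p j))) * X i0 s0)); last first.
  move=> i /andP[_ /asboolP si]; rewrite si//; congr (_ * _ * _); apply: eq_big_seq => j.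
  by rewrite mem_filter => /andP[/pP[Sj _] _]; rewrite si.
rewrite -!mulr_suml => /eqP; rewrite mulf_eq0 (negbTE X0) orbF mulf_eq0 => /orP[/eqP//|/eqP z].
have : \prod_(j <- bad) (X i0 (p j) - X j (p j)) != 0.
  rewrite prodf_seq_neq0; apply/allP => j; rewrite mem_filter => /andP[/pP[_ d] _].
  by rewrite /= subr_eq0 eq_sym.
by rewrite z eqxx.
Qed.

(** * Periods of 1-forms *)

Local Open Scope quotient_scope.

Section Pairing.
Variables (R : realType) (G : quantum_graph R).
Local Notation bond := (edge G * bool)%type.
Local Notation C1 := 'rV[R]_#|edge G|.
Local Notation nb := #|{: edge G * bool}|.
Implicit Types (h g : bond) (v : vertex G) (c d : C1) (w : seq bond) (e : edge G).
Implicit Types (A : {set bond}) (a b : Lambda1 G).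

(** The integral of the form over the chain. *)
Definition pairing a c : R := \sum_e chain_coef c e * theta a e.

Lemma pairingDr a c d : pairing a (c + d) = pairing a c + pairing a d.
Proof. by rewrite -big_split /=; apply: eq_bigr => e _; rewrite coefD mulrDl. Qed.
Lemma pairingBr a c d : pairing a (c - d) = pairing a c - pairing a d.
Proof. by rewrite -sumrB; apply: eq_bigr => e _; rewrite coefB mulrBl. Qed.
Lemma pairing0 a : pairing a 0 = 0.
Proof. by rewrite /pairing big1// => e _; rewrite coef0 mul0r. Qed.
Lemma pairing_sum a I (r : seq I) (P : pred I) (F : I -> C1) :
  pairing a (\sum_(i <- r | P i) F i) = \sum_(i <- r | P i) pairing a (F i).
Proof. exact: (big_morph _ (pairingDr a) (pairing0 a)). Qed.

Lemma thetaB a b e : theta (a - b) e = theta a e - theta b e.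
Proof.
have /asboolP[sa _] := valP a; have /asboolP[sb _] := valP b.
by rewrite /theta -RintegralB //=; apply: smooth_integrable; [exact: sa|exact: sb].
Qed.
Lemma theta0 e : theta (0 : Lambda1 G) e = 0.
Proof. by rewrite -(subrr (0 : Lambda1 G)) thetaB subrr. Qed.
Lemma thetaD a b e : theta (a + b) e = theta a e + theta b e.
Proof. by rewrite -[b in LHS]opprK thetaB -[- b]sub0r thetaB theta0 sub0r opprK. Qed.

Lemma pairingBl a b c : pairing (a - b) c = pairing a c - pairing b c.
Proof. by rewrite -sumrB; apply: eq_bigr => e _; rewrite thetaB mulrBr. Qed.
Lemma pairingDl a b c : pairing (a + b) c = pairing a c + pairing b c.
Proof. by rewrite -big_split /=; apply: eq_bigr => e _; rewrite thetaD mulrDr. Qed.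

Lemma pairing_bond a h : pairing a (bond_chain h) = sgn h * theta a h.1.
Proof.
rewrite /pairing (bigD1 h.1)//= big1 => [|e eh]; first by rewrite coef_bond eqxx mulr1 addr0.
by rewrite coef_bond eq_sym (negbTE eh) mulr0 mul0r.
Qed.

Lemma pairing_walk a w : pairing a (walk_chain w) = integral_walk a w.
Proof. by rewrite pairing_sum; apply: eq_bigr => h _; rewrite pairing_bond. Qed.

Lemma pairing_periods a c : (forall w : closed_walk G, integral_walk a (sval w) \is a Num.int) ->
  lattice c -> pairing a c \is a Num.int.
Proof.
move=> ia; elim/lattice_ind => [|d /indecomposable_walk[w [cw _ _ _ ->]]|d d' _ _ _ id id'].
- by rewrite pairing0.
- by rewrite pairing_walk; exact: (ia (exist _ w cw)).
- by rewrite pairingDr rpredD.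
Qed.

(** The integral of df along a cycle is a sum over the vertices of the value
    of f against the boundary. *)
Lemma pairing_exact a c : exact_form a -> (forall v, boundary c v = 0) ->
  pairing a c = 0.
Proof.
move=> /asboolP[f [sf cf _] af] bc.
have fundamental e : theta a e = f e (len e) - f e 0.
  have d (x : R) : is_derive x 1 (f e) (derive1 (f e) x).
    by split; [exact: (@sf e 0%N x)|rewrite derive1E].
  have cd (x : R) : {for x, continuous (derive1 (f e))}.
    by apply/differentiable_continuous/derivable1_diffP; exact: (@sf e 1%N x).
  have [_ _ /(_ (len e))] := sobolev1_C1 (len_gt0 e) (fun x _ => d x) (fun x _ => cd x).
  rewrite in_itv /= lexx ltW ?len_gt0// => /(_ isT) ->; rewrite addrC addKr.
  by apply: eq_Rintegral => x; rewrite inE /=; exact: af.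
pose F v := if [pick h | vtx h == v] is Some h then f h.1 (position h) else 0.
have FE h : F (vtx h) = f h.1 (position h).
  rewrite /F; case: pickP => [g /eqP|/(_ h)]; last by rewrite eqxx.
  exact: cf.
transitivity (\sum_v F v * boundary c v); last first.
  by rewrite big1// => v _; rewrite bc mulr0.
transitivity (\sum_h sgn h * chain_coef c h.1 * f h.1 (position h)).
  transitivity (\sum_(p : bond) (fun e (s : bool) => sgn (e, s) * chain_coef c e * f e (position (e, s))) p.1 p.2); last by apply: eq_bigr => -[].
  rewrite -(pair_bigA _ (fun e (s : bool) => sgn (e, s) * chain_coef c e * f e (position (e, s)))) /=.
  apply: eq_bigr => e _; rewrite big_bool /= !sgnE /position /= fundamental; ring.
rewrite (partition_big (@vtx R G) predT)//=; apply: eq_bigr => v _.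
rewrite /boundary /flux mulr_sumr; apply: eq_bigr => h /eqP <-.
by rewrite FE mulrC.
Qed.

Lemma torus_class_pairing a b c : torus_class a = torus_class b -> lattice c ->
  pairing a c - pairing b c \is a Num.int.
Proof.
move=> ab lc; rewrite -pairingBl.
have /eqP := ab; rewrite -Quotient.idealrBE => /asboolP[d dE id].
have : \pi_(H1dR G) (a - b - d) = 0 by rewrite !raddfB dE subrr.
move=> z; have /eqP := z; rewrite -[X in _ == X](raddf0 (\pi_(H1dR G))) -Quotient.idealrBE subr0 => ex.
rewrite -[a - b](subrK d) pairingDl (pairing_exact ex lc.1) add0r.
exact: pairing_periods.
Qed.

(** The form with the constant coefficients of [c], suitably scaled, has integral
    1 / 2 over [c]. *)
Lemma pairing_separates c : (forall v, boundary c v = 0) ->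
  (forall a, cis (2 * pi * pairing a c) = 1) -> c = 0.
Proof.
move=> bc chi; apply: contrapT => /eqP c0.
pose q := inner c c.
have q0 : 0 < q.
  rewrite lt_neqAle eq_sym (contra_neq (@inner_eq0 _ _ c) c0)/=.
  by apply: sumr_ge0 => e _; rewrite -mulrA mulr_ge0 ?(ltW (len_gt0 _))// -expr2 sqr_ge0.
pose f e (x : R) := chain_coef c e / (2 * q).
have sm e : smooth (f e).
  have E n : derive1n n (f e) = if n is 0%N then f e else (fun=> 0).
    case: n => // n; elim: n => [|n IH]; rewrite derive1nS ?IH; apply/funext => x; exact: derive1_cst.
  by move=> n x; rewrite E; case: n => [|n]; exact: derivable_cst.
have fo : f \in @one_form R G.
  apply/asboolP; split=> // v; rewrite /f /flux.
  under eq_bigr do rewrite mulrA.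
  by rewrite -mulr_suml [X in X / _](bc v) mul0r.
have := chi (OneForm fo).
have -> : pairing (OneForm fo) c = 1 / 2.
  transitivity (\sum_e (len e * chain_coef c e * chain_coef c e) / (2 * q)).
    apply: eq_bigr => e _; rewrite /theta /= Rintegral_cst//= lebesgue_measure_itv /= lte_fin len_gt0 oppr0 adde0 /=.
    by ring.
  by rewrite -mulr_suml -/(inner c c) -/q; field; rewrite gt_eqF.
have -> : 2 * pi * (1 / 2) = pi :> R by field.
rewrite /cis cospi sinpi => -[] h.
have : (-1 : R) < 1 by lra.
by rewrite h ltxx.
Qed.
End Pairing.

(** * Transfer of simple cycles *)

Section Expansion.
Variables (R : realType) (G : quantum_graph R).
Local Notation bond := (edge G * bool)%type.
Implicit Types (a : Lambda1 G) (z : R * R) (A : {set bond}).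

Lemma prod_wave (I : finType) (P : pred I) (l : I -> R) z :
  \prod_(i | P i) wave (l i) z = wave (\sum_(i | P i) l i) z.
Proof.
apply/esym; apply: (big_morph (fun l => wave l z)) => [x y|].
  by rewrite /wave !mulrDl cisD opprD expRD rmorphM /= mulrACA.
by rewrite /wave !mul0r oppr0 expR0 cis0 mulr1.
Qed.

Lemma secular_expansion a z :
  secular (@bond_len R G) (bond_scat a) z =
  \sum_(A : {set bond}) (cycle_coef A)%:C *
    (wave (total_len A) z * cis (- (2 * pi * pairing a (bond_sum A)))).
Proof.
transitivity (\det (\matrix_(i, j) ((i == j)%:R -
    (wave (bond_len i) z * cis (phase a (enum_val i))) * (map_mx (real_complex R) (hop G)) i j))).
  by congr (\det _); apply/matrixP => i j; rewrite !mxE mulrA.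
rewrite det_expansion.
rewrite [LHS](reindex (@ranks R G)) /=; last first.
  by apply: onW_bij; exists (fun B : {set _} => [set h | enum_rank h \in B]%SET) => [A|B];
    [apply/setP => h; rewrite !inE enum_rankK|exact: ranksK].
apply: eq_bigr => A _; congr (_ * _).
  rewrite /cycle_coef /principal_coef -det_map_mx; congr (\det _).
  by apply/matrixP => i j; rewrite !mxE; case: ifP => _; rewrite ?rmorphN ?rmorph_nat ?mxE.
rewrite big_split; congr (_ * _).
  rewrite (prod_wave (mem (ranks A)) (@bond_len R G) z).
  by rewrite -[total_len A](sum_ranks (fun h : bond => len h.1)).
rewrite -(cis_sum _ (mem (ranks A)) (fun i => phase a (enum_val i))).
rewrite (sum_ranks (phase a)).
apply: (congr1 (@cis R)).
rewrite pairing_sum mulr_sumr -sumrN; apply: eq_bigr => h _.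
by rewrite pairing_bond /phase; ring.
Qed.
End Expansion.

(** The relation between 1-forms induced by an isomorphism of the Bloch tori;
    it makes the roles of the two graphs symmetric. *)
Record correspondence (R : realType) (G G' : quantum_graph R)
    (E : Lambda1 G -> Lambda1 G' -> Prop) : Prop := Correspondence {
  corrD : forall a b a' b', E a a' -> E b b' -> E (a + b) (a' + b');
  corr_total : forall a, exists a', E a a';
  corr_onto : forall a', exists a, E a a';
  corr_int : forall a a' b' c, E a a' -> E a b' -> lattice c ->
    pairing a' c - pairing b' c \is a Num.int;
  corr_int' : forall a b a' c, E a a' -> E b a' -> lattice c ->
    pairing a c - pairing b c \is a Num.int;
  corr_spec : forall a a', E a a' -> Spec a = Spec a'
}.

Lemma correspondence_flip (R : realType) (G G' : quantum_graph R)
    (E : Lambda1 G -> Lambda1 G' -> Prop) :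
  correspondence E -> correspondence (fun a' a => E a a').
Proof.
move=> [D T O I I' S]; split => //; do ?by [move=> *; exact: D].
- by move=> a' a b c; exact: I'.
- by move=> a' b' a c; exact: I.
- by move=> a' a /S ->.
Qed.

Lemma cis_int (R : realType) (x : R) : x \is a Num.int -> cis (2 * pi * x) = 1.
Proof.
have c2 : cis (2 * pi) = 1 :> R[i].
  have cpi : cis pi = -1 :> R[i] by apply: complexP; rewrite /= ?cospi ?sinpi ?oppr0.
  by rewrite mulr_natl mulr2n cisD cpi mulrN1 opprK.
have cn n : cis (2 * pi * n%:R) = 1 :> R[i].
  elim: n => [|n IH]; first by rewrite mulr0 cis0.
  by rewrite -(@natr1 R n) mulrDr cisD IH mul1r mulr1 c2.
move=> /intrP[[n|n] ->]; first exact: cn.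
by rewrite NegzE mulrNz mulrN cisNV cn invr1.
Qed.

Section Transfer.
Variables (R : realType) (G G' : quantum_graph R).
Variable E : Lambda1 G -> Lambda1 G' -> Prop.
Hypothesis corrE : correspondence E.
Local Notation bond := (edge G * bool)%type.
Local Notation bond' := (edge G' * bool)%type.
Local Notation C1 := 'rV[R]_#|edge G|.
Local Notation C1' := 'rV[R]_#|edge G'|.
Implicit Types (h g : C1) (c d : C1').

Definition character (H : quantum_graph R) (a : Lambda1 H) (c : 'rV[R]_#|edge H|) : R[i] :=
  cis (2 * pi * pairing a c).

(** A lattice vector is determined by its character on the torus, so that this is
    the graph of the isomorphism between the two lattices that is dual to the
    given one between the tori. *)
Definition dual h c := [/\ lattice h, lattice c &
  forall a a', E a a' -> character a h = character a' c].

Lemma secular_real_ratio a a' (z : R * R) : E a a' -> 0 < z.2 ->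
  secular (@bond_len R G) (bond_scat a) z * conjc (secular (@bond_len R G') (bond_scat a') z) =
  conjc (secular (@bond_len R G) (bond_scat a) z) * secular (@bond_len R G') (bond_scat a') z.
Proof.
move=> Ea z0; set D := secular _ _ z; set D' := secular (@bond_len R G') _ z.
have D'0 : D' != 0 by apply: secular_neq0 => //; [exact: bond_scat_unitary|exact: bond_len_gt0].
have [r r0] : ray (D / D') 0.
  apply: ratio_positive => //; first [exact: bond_scat_unitary|exact: bond_len_gt0|idtac].
  by move=> x x0; exact: Spec_kernel (corr_spec corrE Ea).
rewrite cis0 mulr1 => /(canRL (divfK D'0)) ->.
have -> : conjc (r%:C * D') = r%:C * conjc D' by rewrite -[X in _ = X * _]conjc_real; exact: rmorphM.
by ring.
Qed.


Lemma character_int (H : quantum_graph R) (a b : Lambda1 H) (c : 'rV[R]_#|edge H|) :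
  pairing a c - pairing b c \is a Num.int -> character a c = character b c.
Proof.
move=> iab; rewrite /character -[pairing a c](subrK (pairing b c)) mulrDr cisD.
by rewrite cis_int// mul1r.
Qed.

Lemma character_zero a' c : E 0 a' -> lattice c -> cis (2 * pi * pairing a' c) = 1.
Proof.
move=> E0 lc; apply: cis_int; rewrite -[pairing a' c](addrK (pairing a' c)) -pairingDl.
by have := corr_int corrE _ E0 lc; apply; rewrite -[X in E X _](addr0 (0 : Lambda1 G)); exact: corrD.
Qed.

Lemma lattice_character_inj c d : lattice c -> lattice d ->
  (forall a a', E a a' -> character a' c = character a' d) -> c = d.
Proof.
move=> lc ld cd; apply/eqP; rewrite -subr_eq0; apply/eqP.
have lcd : lattice (c - d) by exact: latticeB.
apply: pairing_separates lcd.1 _ => a'; have [a Ea] := corr_onto corrE a'.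
rewrite pairingBr mulrBr cisD cisNV -[cis _]/(character a' c) (cd _ _ Ea).
by rewrite mulfV// cis_neq0.
Qed.

(** Each indecomposable cycle of the second graph contributes a term to the
    secular function alone with its length and character; in the identity
    between the two secular functions it can only cancel against a set of
    bonds of the first graph with the same length and character. *)
Lemma indecomposable_dual c : indecomposable c ->
  exists2 h, dual h c & norm1 h <= norm1 c.
Proof.
move=> ic.
have [f fE] := boolp.choice (corr_total corrE).
pose B0 := positive_bonds c.
have [B0c B0l] : bond_sum B0 = c /\ total_len B0 = norm1 c.
  by apply: positive_bondsE => e; exact: indecomposable_coef.
have B00 : cycle_coef B0 != 0 by exact: cycle_coef_indecomposable.
have [lc c0 _] := ic.
pose V : zmodType := ((R * R) * Lambda1 G)%type.
pose S (s : V) : Prop := 0 < s.1.2.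
pose I := (bool * ({set bond} * {set bond'}))%type.
pose P (i : I) := (cycle_coef i.2.1 != 0) && (cycle_coef i.2.2 != 0).
pose k (i : I) : R[i] := (-1) ^+ i.1 * ((cycle_coef i.2.1)%:C * (cycle_coef i.2.2)%:C).
pose y (A : {set bond}) (s : V) := wave (total_len A) s.1 * cis (- (2 * pi * pairing s.2 (bond_sum A))).
pose y' (B : {set bond'}) (s : V) :=
  wave (total_len B) s.1 * cis (- (2 * pi * pairing (f s.2) (bond_sum B))).
(* The product of the two secular functions, one of them conjugated, is real:
   the relation has the terms of the product and those of its conjugate. *)
pose X (i : I) (s : V) : R[i] :=
  if i.1 then conjc (y i.2.1 s) * y' i.2.2 s else y i.2.1 s * conjc (y' i.2.2 s).
have cM (u v : R[i]) : conjc (u * v) = conjc u * conjc v by exact: rmorphM.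
have SD s t : S s -> S t -> S (s + t) by exact: addr_gt0.
have yD A s t : y A (s + t) = y A s * y A t.
  rewrite /y pairingDl mulrDr opprD cisD.
  have -> : wave (total_len A) (s + t).1 = wave (total_len A) s.1 * wave (total_len A) t.1 by rewrite -waveD.
  by ring.
have y'D B s t : lattice (bond_sum B) -> y' B (s + t) = y' B s * y' B t.
  move=> lB; rewrite /y' !cisNV.
  have -> : wave (total_len B) (s + t).1 = wave (total_len B) s.1 * wave (total_len B) t.1 by rewrite -waveD.
  have -> : cis (2 * pi * pairing (f (s + t).2) (bond_sum B)) =
      cis (2 * pi * pairing (f s.2) (bond_sum B)) * cis (2 * pi * pairing (f t.2) (bond_sum B)).
    rewrite -cisD -mulrDr -pairingDl; apply: character_int.
    by apply: (corr_int corrE (fE _)) => //; exact: corrD.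
  by rewrite invfM; ring.
have XD i s t : P i -> S s -> S t -> X i (s + t) = X i s * X i t.
  move=> /andP[_ /cycle_coef_lattice l2] _ _; rewrite /X yD y'D//.
  by case: ifP => _; rewrite !cM; ring.
have rel s : S s -> \sum_(i | P i) k i * X i s = 0.
  move=> Ss; transitivity (\sum_i k i * X i s).
    rewrite [RHS](bigID P) /= [X in _ = _ + X]big1 ?addr0// => i; rewrite /P negb_and !negbK.
    by rewrite /k => /orP[]/eqP ->; rewrite ?mul0r ?mulr0 mul0r.
  transitivity (\sum_(b : bool) \sum_(p : {set bond} * {set bond'}) k (b, p) * X (b, p) s).
    by rewrite (pair_bigA _ (fun b p => k (b, p) * X (b, p) s)); apply: eq_bigr => -[].
  pose z A := (cycle_coef A)%:C * y A s; pose z' B := (cycle_coef B)%:C * y' B s.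
  have zC A : conjc (z A) = (cycle_coef A)%:C * conjc (y A s) by rewrite ?/z ?/z' cM conjc_real.
  have z'C B : conjc (z' B) = (cycle_coef B)%:C * conjc (y' B s) by rewrite ?/z ?/z' cM conjc_real.
  have ratio := secular_real_ratio (fE s.2) Ss.
  rewrite !secular_expansion -/y -/y' in ratio.
  have prodE (F : {set bond} -> R[i]) (F' : {set bond'} -> R[i]) :
      (\sum_A F A) * (\sum_B F' B) = \sum_(p : {set bond} * {set bond'}) F p.1 * F' p.2.
    by rewrite big_distrlr /= (pair_bigA _ (fun A B => F A * F' B)).
  have sC (T : finType) (F : T -> R[i]) : conjc (\sum_i F i) = \sum_i conjc (F i) by exact: rmorph_sum.
  rewrite big_bool /=.
  transitivity ((\sum_A z A) * conjc (\sum_B z' B) - conjc (\sum_A z A) * (\sum_B z' B)).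
    rewrite !sC !prodE addrC; congr (_ + _).
      apply: eq_bigr => p _; rewrite z'C /k /X /= expr0 /z; ring.
    rewrite -sumrN; apply: eq_bigr => p _; rewrite zC /k /X /= expr1 /z'; ring.
  by apply/eqP; rewrite subr_eq0; apply/eqP.
have XE i x t a : X i ((x, t), a) =
    (expR (- ((total_len i.2.1 + total_len i.2.2) * t)))%:C *
    cis ((-1) ^+ i.1 * (total_len i.2.1 - total_len i.2.2) * x) *
    cis ((-1) ^+ i.1 * (2 * pi * pairing (f a) (bond_sum i.2.2) - 2 * pi * pairing a (bond_sum i.2.1))).
  have rC (r : R) : conjc r%:C = r%:C := conjc_real r.
  have yE A : y A ((x, t), a) = (expR (- (total_len A * t)))%:C * cis (total_len A * x) *
    cis (- (2 * pi * pairing a (bond_sum A))) by [].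
  have y'E B : y' B ((x, t), a) = (expR (- (total_len B * t)))%:C * cis (total_len B * x) *
    cis (- (2 * pi * pairing (f a) (bond_sum B))) by [].
  case: i => -[] [A B]; cbn [fst snd]; rewrite ?expr1 ?expr0 ?mulN1r ?mul1r.
    have -> : X (true, (A, B)) (x, t, a) = conjc (y A ((x, t), a)) * y' B ((x, t), a) by [].
    rewrite yE y'E !cM rC -!cisN !opprK.
    rewrite [RHS](_ : _ = (expR (- (total_len A * t)))%:C * (expR (- (total_len B * t)))%:C *
      (cis (- (total_len A * x)) * cis (total_len B * x)) *
      (cis (2 * pi * pairing a (bond_sum A)) * cis (- (2 * pi * pairing (f a) (bond_sum B))))); first by ring.
    rewrite -rmorphM -expRD -!cisD; congr (_%:C * cis _ * cis _); [congr expR| |]; ring.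
  have -> : X (false, (A, B)) (x, t, a) = y A ((x, t), a) * conjc (y' B ((x, t), a)) by [].
  rewrite yE y'E !cM rC -!cisN !opprK.
  rewrite [RHS](_ : _ = (expR (- (total_len A * t)))%:C * (expR (- (total_len B * t)))%:C *
      (cis (total_len A * x) * cis (- (total_len B * x))) *
      (cis (- (2 * pi * pairing a (bond_sum A))) * cis (2 * pi * pairing (f a) (bond_sum B)))); first by ring.
  rewrite -rmorphM -expRD -!cisD; congr (_%:C * cis _ * cis _); [congr expR| |]; ring.
(* The term of the empty set in G and of the bonds of c in G'. *)
pose i0 : I := (true, (finset.set0, B0)).
have Pi0 : P i0 by rewrite /P /= cycle_coef0 oner_eq0.
have Xi0 s : X i0 s != 0.
  case: s => -[x t] a; rewrite XE !mulf_neq0 ?cis_neq0//.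
  by apply/eqP => -[] /eqP; rewrite gt_eqF// expR_gt0.
have S1 (x : R) a : S ((x, 1), a) by exact: ltr01.
apply: contrapT => no.
have := characters_independent SD XD (ex_intro2 _ _ _ (S1 0 0) (Xi0 _)) rel Pi0.
rewrite (big_pred1 i0) => [|i].
  by move=> /eqP; rewrite /k /= expr1 cycle_coef0 mul1r mulN1r oppr_eq0 => /eqP -[] /eqP; rewrite (negbTE B00).
apply/andP/eqP => [[Pi /asboolP same]|->]; last by split=> //; apply/asboolP.
case: i Pi same => b [A B] /andP[/= A0 /= BB0] same.
have lA := cycle_coef_lattice A0; have lB := cycle_coef_lattice BB0.
pose m := total_len A + total_len B; pose n := (-1) ^+ b * (total_len A - total_len B).
pose m0 : R := norm1 c.
have eq1 (x : R) a : (expR (- m))%:C * cis (n * x) *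
    cis ((-1) ^+ b * (2 * pi * pairing (f a) (bond_sum B) - 2 * pi * pairing a (bond_sum A))) =
    (expR (- m0))%:C * cis (m0 * x) * cis (- (2 * pi * pairing (f a) c)).
  have := same ((x, 1), a) (S1 x a); rewrite !XE /= !mulr1 total_len0 bond_sum0 pairing0 B0c B0l expr1.
  by rewrite !add0r !mulN1r opprK mulr0 subr0.
have at0 d : lattice d -> cis (2 * pi * pairing (f 0) d) = 1.
  exact: (character_zero (fE 0)).
have p00 (d : C1) : pairing (0 : Lambda1 G) d = 0 by rewrite /pairing big1// => e _; rewrite theta0 mulr0.
have cpm (u : R) : cis u = 1 -> cis ((-1) ^+ b * u) = 1.
  by case: (b); rewrite ?expr0 ?expr1 ?mul1r// mulN1r cisNV => ->; rewrite invr1.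
have eq2 (x : R) : (expR (- m))%:C * cis (n * x) = (expR (- m0))%:C * cis (m0 * x).
  by have := eq1 x 0; rewrite p00 mulr0 subr0 cpm ?at0// cisNV at0// invr1 !mulr1.
have e0 (r : R) : (expR r)%:C != 0 by apply/eqP => -[] /eqP; rewrite gt_eqF// expR_gt0.
(* The modulus determines the total length, and the dependence on the real part
   of z the difference of the two lengths. *)
have mE : expR (- m) = expR (- m0).
  by have := eq2 0; rewrite !mulr0 cis0 !mulr1 => -[].
have nE : n = m0.
  apply: contrapT => /eqP nm; have d0 : n - m0 != 0 by rewrite subr_eq0.
  have := eq2 (n - m0)^-1; rewrite mE => /(mulfI (e0 _)) nx.
  have : cis 1 = 1 :> R[i].
    by rewrite -{1}(mulfV d0) mulrBl cisD nx cisNV mulfV// cis_neq0.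
  move=> /cis_eq1; rewrite normr1 => /(_ _)/eqP; rewrite oner_eq0 => h; apply/notF/h.
  have := pi_ge2 R; lra.
have {}mE : m = m0 by apply: oppr_inj; exact: expR_inj mE.
have eq3 a : cis ((-1) ^+ b * (2 * pi * pairing (f a) (bond_sum B) - 2 * pi * pairing a (bond_sum A))) =
    cis (- (2 * pi * pairing (f a) c)).
  have := eq1 0 a; rewrite mE !mulr0 cis0 mulr1; exact: (mulfI (e0 _)).
clear cpm eq1 eq2 same; move: mE nE eq3; rewrite /n /m => {n m} mE.
case: b; rewrite /= ?expr1 ?expr0 ?mulN1r ?mul1r => nE eq3.
- have lA0 : total_len A = 0 by lra.
  have lB0 : total_len B = m0 by lra.
  have A00 := total_len_eq0 lA0; rewrite A00; congr (_, (_, _)).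
  have BE : bond_sum B = c.
    apply: lattice_character_inj => // a a' Ea.
    rewrite (character_int (corr_int corrE Ea (fE a) lB)) (character_int (corr_int corrE Ea (fE a) lc)).
    apply: (can_inj (@invrK _)); rewrite /character -!cisNV -eq3 A00 bond_sum0 pairing0.
    by rewrite mulr0 subr0 ?mulN1r.
  by rewrite (tight_bond_sum (A := B)) ?BE ?lB0.
- exfalso; apply: no; exists (bond_sum A); last first.
    rewrite (le_trans (norm1_bond_sum A))// -/m0; lra.
  split=> // a a' Ea.
  rewrite (character_int (corr_int corrE Ea (fE a) lc)).
  apply: (can_inj (@invrK _)); rewrite /character -!cisNV -eq3.
  have -> : B = finset.set0 by apply: total_len_eq0; lra.
  by rewrite bond_sum0 pairing0 mulr0 sub0r mul1r.
Qed.
End Transfer.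

(** * The isometry between the lattices of cycles *)

Section Duality.
Variables (R : realType) (G G' : quantum_graph R).
Variable E : Lambda1 G -> Lambda1 G' -> Prop.
Hypothesis corrE : correspondence E.
Local Notation C1 := 'rV[R]_#|edge G|.
Local Notation C1' := 'rV[R]_#|edge G'|.
Implicit Types (h g : C1) (c d : C1').

Lemma characterD (H : quantum_graph R) (a : Lambda1 H) (c d : 'rV[R]_#|edge H|) :
  character a (c + d) = character a c * character a d.
Proof. by rewrite /character pairingDr mulrDr cisD. Qed.

Lemma dual_flip h c : dual E h c -> dual (fun a' a => E a a') c h.
Proof. by move=> [lh lc ch]; split => // a' a Ea; rewrite (ch _ _ Ea). Qed.

Lemma dualD h g c d : dual E h c -> dual E g d -> dual E (h + g) (c + d).
Proof.
move=> [lh lc hc] [lg ld gd]; split; [exact: latticeD|exact: latticeD|].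
by move=> a a' Ea; rewrite !characterD (hc _ _ Ea) (gd _ _ Ea).
Qed.

Lemma dual_injr h c d : dual E h c -> dual E h d -> c = d.
Proof.
move=> [_ lc hc] [_ ld hd]; apply: (lattice_character_inj corrE) => // a a' Ea.
by rewrite -(hc _ _ Ea) (hd _ _ Ea).
Qed.

(** Norms add up in the decomposition of [c], and can only decrease when the
    duals are added. *)
Lemma dual_exists c : lattice c -> exists2 h, dual E h c & norm1 h <= norm1 c.
Proof.
elim/lattice_ind => [|d id|d d' _ _ nE [h dh nh] [h' dh' nh']].
- exists 0; last by rewrite /norm1 !big1// => e _; rewrite coef0 normr0 mulr0.
  split; [exact: lattice0|exact: lattice0|].
  by move=> a a' _; rewrite /character !pairing0.
- exact: (indecomposable_dual corrE).
- exists (h + h'); first exact: dualD.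
  by rewrite nE (le_trans (norm1D _ _))// lerD.
Qed.
End Duality.

Section Isometry.
Variables (R : realType) (G G' : quantum_graph R).
Variable E : Lambda1 G -> Lambda1 G' -> Prop.
Hypothesis corrE : correspondence E.
Local Notation C1 := 'rV[R]_#|edge G|.
Local Notation C1' := 'rV[R]_#|edge G'|.
Implicit Types (h g : C1) (c d : C1').
Let corrF := correspondence_flip corrE.

Lemma dual_injl h g c : dual E h c -> dual E g c -> h = g.
Proof. by move=> /dual_flip hc /dual_flip gc; exact: (dual_injr corrF hc gc). Qed.

Lemma dual_norm1 h c : dual E h c -> norm1 h = norm1 c.
Proof.
move=> hc; have [lh lc _] := hc; apply/eqP; rewrite eq_le; apply/andP; split.
  by have [g gc] := dual_exists corrE lc; rewrite (dual_injl hc gc).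
have [d dh] := dual_exists corrF lh.
by rewrite (dual_injr corrE hc (dual_flip dh)).
Qed.

Lemma dual0 : dual E 0 0.
Proof.
split; [exact: lattice0|exact: lattice0|].
by move=> a a' _; rewrite /character !pairing0.
Qed.

Lemma dualN h c : dual E h c -> dual E (- h) (- c).
Proof.
move=> [lh lc hc]; rewrite -[- h]sub0r -[- c]sub0r.
split; [exact: latticeB (lattice0 G) lh|exact: latticeB (lattice0 G') lc|].
by move=> a a' /hc; rewrite /character !pairingBr !pairing0 !sub0r !mulrN !cisNV => ->.
Qed.

(** Indecomposability only involves the lattice and its norm. *)
Lemma dual_indecomposable h c : dual E h c -> indecomposable h -> indecomposable c.
Proof.
move=> hc [lh h0 ih]; have [_ lc _] := hc.
split => // [|d ld nd].
  apply: contra_neq h0 => c0; apply: norm1_eq0.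
  by rewrite (dual_norm1 hc) c0 /norm1 big1// => e _; rewrite coef0 normr0 mulr0.
have [g gd _] := dual_exists corrE ld; have [lg _ _] := gd.
have hg : dual E (h - g) (c - d) by apply: dualD => //; exact: dualN.
case: (ih g lg); first by rewrite (dual_norm1 hc) (dual_norm1 gd) (dual_norm1 hg).
  by move=> g0; left; rewrite g0 in gd; exact: (dual_injr corrE gd dual0).
by move=> gh; right; rewrite gh in gd; exact: (dual_injr corrE gd hc).
Qed.
End Isometry.

Section Extension.
Variables (R : realType) (G G' : quantum_graph R).
Variable E : Lambda1 G -> Lambda1 G' -> Prop.
Hypothesis corrE : correspondence E.
Local Notation C1 := 'rV[R]_#|edge G|.
Local Notation C1' := 'rV[R]_#|edge G'|.
Implicit Types (h g : C1) (c d : C1').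
Let corrF := correspondence_flip corrE.

Lemma dual_right h : lattice h -> exists c, dual E h c.
Proof. by move=> lh; have [c ch _] := dual_exists corrF lh; exists c; exact: dual_flip. Qed.

Lemma dual_split h g c : dual E (h + g) c -> lattice h -> lattice g ->
  exists d d', [/\ dual E h d, dual E g d' & c = d + d'].
Proof.
move=> hgc /dual_right[d hd] /dual_right[d' gd']; exists d, d'; split => //.
exact: (dual_injr corrE hgc (dualD hd gd')).
Qed.

(** For simple cycles the inner product is given by the norm; they generate the
    lattice. *)
Lemma dual_inner h g c d : dual E h c -> dual E g d -> inner h g = inner c d.
Proof.
move=> hc gd; have [lh _ _] := hc; have [lg _ _] := gd.
elim/lattice_ind: lh c hc => [c /(dual_injr corrE (dual0 E)) <-|h0 ih0 c hc|h0 h1 l0 l1 _ IH0 IH1 c].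
- by rewrite !inner0l.
- elim/lattice_ind: lg d gd => [d /(dual_injr corrE (dual0 E)) <-|g0 ig0 d gd|g0 g1 l0 l1 _ IH0 IH1 d].
  + by rewrite [LHS]innerC [RHS]innerC !inner0l.
  + have [ic id] := (dual_indecomposable corrE hc ih0, dual_indecomposable corrE gd ig0).
    rewrite !inner_norm1// (dual_norm1 corrE (dualD hc gd)).
    by rewrite (dual_norm1 corrE (dualD hc (dualN gd))).
  + move=> /dual_split[//|//|d0 [d1 [e0 e1 ->]]].
    rewrite [LHS]innerC [RHS]innerC !innerDl !(innerC _ h0) !(innerC _ c).
    by rewrite (IH0 _ e0) (IH1 _ e1).
- move=> /dual_split[//|//|c0 [c1 [e0 e1 ->]]].
  by rewrite !innerDl (IH0 _ e0) (IH1 _ e1).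
Qed.

Lemma inner_mulmx (H : quantum_graph R) m (M : 'M[R]_(m, #|edge H|)) (u v : 'rV[R]_m) :
  inner (u *m M) (v *m M) = \sum_i \sum_j u 0 i * v 0 j * inner (row i M) (row j M).
Proof.
rewrite !mulmx_sum_row inner_suml; apply: eq_bigr => i _.
rewrite innerZl innerC inner_suml mulr_sumr; apply: eq_bigr => j _.
by rewrite innerZl innerC mulrA.
Qed.

(** The dual of a family of lattice vectors spanning the cycles has the same
    Gram matrix, hence satisfies the same linear relations. *)
Lemma dual_matrix : exists N : 'M[R]_(#|edge G|, #|edge G'|),
  [/\ forall h, lattice h -> dual E h (h *m N),
      forall h, (forall v, boundary h v = 0) -> forall v, boundary (h *m N) v = 0 &
      forall h g, (forall v, boundary h v = 0) -> (forall v, boundary g v = 0) ->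
        inner (h *m N) (g *m N) = inner h g].
Proof.
have [m [M [lM spanM indM]]] := lattice_frame G.
have [r rP] := boolp.choice (fun i => dual_right (lM i)).
pose M' : 'M[R]_(m, #|edge G'|) := \matrix_i r i.
have M'P i : dual E (row i M) (row i M') by rewrite rowK.
have gram (u v : 'rV[R]_m) : inner (u *m M) (v *m M) = inner (u *m M') (v *m M').
  by rewrite !inner_mulmx; apply: eq_bigr => i _; apply: eq_bigr => j _; rewrite (dual_inner (M'P i) (M'P j)).
have ker (u : 'rV[R]_m) : u *m M = 0 -> u *m M' = 0.
  by move=> u0; apply: inner_eq0; rewrite -gram u0 inner0l.
have NE (u : 'rV[R]_m) : (u *m M) *m (pinvmx M *m M') = u *m M'.
  apply/eqP; rewrite [X in X == _]mulmxA -subr_eq0 -mulmxBl; apply/eqP/ker.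
  by rewrite mulmxBl mulmxKpV ?submxMl// subrr.
have coord h : (forall v, boundary h v = 0) -> exists u, h = u *m M.
  by move=> /spanM/submxP[u ->]; exists u.
exists (pinvmx M *m M'); split => [h|h|h g].
- elim/lattice_ind => [|h0 ih|h0 h1 _ _ _ IH0 IH1].
  + by rewrite mul0mx; exact: dual0.
  + by have [i ->] := indM _ ih; rewrite rowE NE -!rowE; exact: M'P.
  + by rewrite mulmxDl; exact: dualD.
- move=> /coord[u ->] v; rewrite NE mulmx_sum_row boundary_sum big1// => i _.
  by have [_ [b _] _] := M'P i; rewrite boundaryZ b mulr0.
- by move=> /coord[u ->] /coord[v ->]; rewrite !NE gram.
Qed.
End Extension.

Lemma dual_matrices (R : realType) (G G' : quantum_graph R)
    (E : Lambda1 G -> Lambda1 G' -> Prop) (N : 'M[R]_(#|edge G|, #|edge G'|))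
    (N' : 'M[R]_(#|edge G'|, #|edge G|)) : correspondence E ->
  (forall h, lattice h -> dual E h (h *m N)) ->
  (forall c, lattice c -> dual E (c *m N') c) ->
  forall h, (forall v, boundary h v = 0) -> h *m N *m N' = h.
Proof.
move=> corrE NP N'P h bh; have [m [M [lM spanM _]]] := lattice_frame G.
have /submxP[u ->] := spanM h bh.
suff MN : M *m N *m N' = M by rewrite -!mulmxA [M *m _]mulmxA MN.
apply/row_matrixP => i; rewrite !row_mul.
have d := NP _ (lM i); have [_ l _] := d.
exact: (dual_injl corrE (N'P _ l) d).
Qed.

(** * Albanese tori *)

Lemma torus_classK (R : realType) (G : quantum_graph R) (q : bloch_torus G) :
  torus_class (repr (repr q)) = q.
Proof. by rewrite /torus_class !reprK. Qed.

Lemma bloch_correspondence (R : realType) (G G' : quantum_graph R) :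
  bloch_isospectral G G' -> exists E : Lambda1 G -> Lambda1 G' -> Prop, correspondence E.
Proof.
move=> [Phi [Psi [[PK KP] _ _ PS]]].
exists (fun a a' => Phi (torus_class a) = torus_class a'); split.
- move=> a b a' b' Ea Eb; rewrite /torus_class !raddfD.
  by rewrite -[RHS]/(torus_class a' + torus_class b') -Ea -Eb.
- by move=> a; exists (repr (repr (Phi (torus_class a)))); rewrite torus_classK.
- by move=> a'; exists (repr (repr (Psi (torus_class a')))); rewrite torus_classK KP.
- move=> a a' b' c Ea Eb; apply: torus_class_pairing.
  by rewrite -Ea.
- move=> a b a' c Ea Eb; apply: torus_class_pairing.
  by apply: (can_inj PK); rewrite Ea.
- exact: PS.
Qed.

Section LinearMaps.
Variables (R : realType) (m n : nat) (N : 'M[R]_(m, n)).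

Lemma mulmx_continuous : continuous (mulmxr N : 'rV[R]_m -> 'rV[R]_n).
Proof.
have cr (r : seq 'I_m) : continuous (fun z : 'rV[R]_m => \sum_(i <- r) z 0 i *: row i N).
  elim: r => [|i r IH].
    have -> : (fun z : 'rV[R]_m => \sum_(i <- [::]) z 0 i *: row i N) = fun=> 0.
      by apply/funext => z; rewrite big_nil.
    exact: cst_continuous.
  have -> : (fun z : 'rV[R]_m => \sum_(j <- i :: r) z 0 j *: row j N) =
      (fun z : 'rV[R]_m => z 0 i *: row i N + \sum_(j <- r) z 0 j *: row j N).
    by apply/funext => z; rewrite big_cons.
  have c1 : continuous (fun z : 'rV[R]_m => z 0 i *: row i N).
    move=> x; apply: (@continuous_comp _ _ _ (fun z : 'rV[R]_m => z 0 i) ( *:%R^~ (row i N))).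
      exact: coord_continuous.
    exact: scalel_continuous.
  by move=> x; exact: cvgD (c1 x) (IH x).
rewrite (_ : (mulmxr N : _ -> _) = fun z : 'rV[R]_m => \sum_i z 0 i *: row i N); first exact: cr.
by apply/funext => z; rewrite /= mulmx_sum_row.
Qed.

Lemma mulmx_derive (v x : 'rV[R]_m) : is_derive x v (mulmxr N : 'rV[R]_m -> 'rV[R]_n) (v *m N).
Proof.
have d : differentiable (mulmxr N : 'rV[R]_m -> 'rV[R]_n) x.
  exact/linear_differentiable/mulmx_continuous.
apply: DeriveDef; first exact: diff_derivable.
by rewrite deriveE// diff_lin//; exact: mulmx_continuous.
Qed.

Lemma mulmx_smooth : smooth_map (mulmxr N : 'rV[R]_m -> 'rV[R]_n).
Proof.
have E vs : exists c : 'rV[R]_n, (foldr (fun v K => 'D_v K) (mulmxr N : 'rV[R]_m -> 'rV[R]_n) vs) =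
  (if vs is [::] then (mulmxr N : 'rV[R]_m -> 'rV[R]_n) else fun=> c).
  elim: vs => [|v vs [c IH]]; first by exists 0.
  case: vs IH => [_|w vs IH] /=; first by exists (v *m N); apply/funext => x; exact: (@derive_val _ _ _ _ _ _ _ (mulmx_derive v x)).
  by exists 0; rewrite /= in IH; rewrite IH; apply/funext => x; exact: derive_cst.
move=> vs x; have [c ->] := E vs; case: vs {E} => [|v vs]; last exact: differentiable_cst.
exact/linear_differentiable/mulmx_continuous.
Qed.
End LinearMaps.

Local Open Scope quotient_scope.

Section AlbaneseMap.
Variables (R : realType) (G G' : quantum_graph R).
Variables (E : Lambda1 G -> Lambda1 G' -> Prop) (N : 'M[R]_(#|edge G|, #|edge G'|)).
Hypothesis N_lattice : forall h, lattice h -> lattice (h *m N).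
Hypothesis N_cycle : forall h, (forall v, boundary h v = 0) ->
  forall v, boundary (h *m N) v = 0.

Lemma H1_cycle (H : quantum_graph R) (y : H1 H) v : boundary (chain y) v = 0.
Proof. by have /forallP/(_ v)/eqP := valP y. Qed.

Lemma cycles_mulmx (y : H1 G) : (chain y *m N) \in @cycles R G'.
Proof. by apply/forallP => v; apply/eqP; apply: N_cycle => w; exact: H1_cycle. Qed.

Definition cycle_map (y : H1 G) : H1 G' := Cycle (cycles_mulmx y).

Definition albanese_map (q : Alb G) : Alb G' := \pi_(Alb G') (cycle_map (repr q)).

Lemma pi_AlbP (H : quantum_graph R) (y z : H1 H) :
  \pi_(Alb H) y = \pi_(Alb H) z <-> lattice (chain y - chain z).
Proof.
have -> : (\pi_(Alb H) y = \pi_(Alb H) z) <-> (y - z \in @H1_Z R H).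
  by split => [/eqP|i]; [rewrite -Quotient.idealrBE|apply/eqP; rewrite -Quotient.idealrBE].
split => [/forallP iy|[_ iy]]; last by apply/forallP.
split=> // v; exact: (H1_cycle (y - z)).
Qed.

Lemma albanese_map_pi (y : H1 G) :
  albanese_map (\pi_(Alb G) y) = \pi_(Alb G') (cycle_map y).
Proof.
apply/pi_AlbP => /=; rewrite -mulmxBl; apply: N_lattice; apply/pi_AlbP.
by rewrite reprK.
Qed.

Lemma albanese_map_isometry :
  (forall h g, (forall v, boundary h v = 0) -> (forall v, boundary g v = 0) ->
     inner (h *m N) (g *m N) = inner h g) -> local_isometry albanese_map.
Proof.
move=> N_inner x; exists (mulmxr N); split.
- exact: mulmx_smooth.
- apply: (@nearW _ (nbhs (chain x)) _ _ _) => z y <-; exists (cycle_map y) => //; exact: albanese_map_pi.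
- move=> u v; rewrite (@derive_val _ _ _ _ _ _ _ (mulmx_derive N (chain u) (chain x))).
  rewrite (@derive_val _ _ _ _ _ _ _ (mulmx_derive N (chain v) (chain x))).
  by apply: N_inner; exact: H1_cycle.
Qed.
End AlbaneseMap.

Lemma albanese_mapK (R : realType) (G G' : quantum_graph R)
    (N : 'M[R]_(#|edge G|, #|edge G'|)) (N' : 'M[R]_(#|edge G'|, #|edge G|))
    (Nc : forall h, (forall v, boundary h v = 0) -> forall v, boundary (h *m N) v = 0)
    (N'c : forall h, (forall v, boundary h v = 0) -> forall v, boundary (h *m N') v = 0) :
  (forall c, lattice c -> lattice (c *m N')) ->
  (forall h, (forall v, boundary h v = 0) -> h *m N *m N' = h) ->
  cancel (albanese_map Nc) (albanese_map N'c).
Proof.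
move=> N'l NK q; rewrite -[q in RHS]reprK /albanese_map [LHS]albanese_map_pi//.
congr (\pi_ _ _); apply: val_inj => /=; apply: NK => v; exact: H1_cycle.
Qed.

Theorem theorem1p2 (R : realType) (G G' : quantum_graph R) :
  bloch_isospectral G G' -> isometric_albanese G G'.
Proof.
move=> /bloch_correspondence[E corrE].
have corrF := correspondence_flip corrE.
have [N [Nd Nc Ni]] := dual_matrix corrE.
have [N' [N'd N'c N'i]] := dual_matrix corrF.
have Nl h : lattice h -> lattice (h *m N) by move=> /Nd[].
have N'l h : lattice h -> lattice (h *m N') by move=> /N'd[].
exists (albanese_map Nc), (albanese_map N'c); split.
- apply: albanese_mapK => //; apply: (dual_matrices corrE) => // c lc.
  exact: (dual_flip (N'd c lc)).
- apply: albanese_mapK => //; apply: (dual_matrices corrF) => // c lc.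
  exact: (dual_flip (Nd c lc)).
- exact: albanese_map_isometry.
- exact: albanese_map_isometry.
Qed.
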